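(* Let $\varkappa\in\mathbb C$, $\varkappa\ne0$, and let $c=13-6\varkappa-\frac6\varkappa$ and $\bar c=13+6\varkappa+\frac6\varkappa$. (1) The space $\tilde{\mathbb F}_\varkappa$ has a $\mathrm{Vir}_c\oplus\mathrm{Vir}_{\bar c}$-module structure (two commuting actions of the Virasoro algebra with central charges $c$ and $\bar c$), defined by $$L(z)=\frac1{4\varkappa}:a(z)^2:+\frac{\varkappa-1}{2\varkappa}a'(z)-\frac1\varkappa\mathbb Y(-2,z),$$ $$\bar L(z)=-\frac1{4\varkappa}:\bar a(z)^2:+\frac{\varkappa+1}{2\varkappa}\bar a'(z)+\frac1\varkappa\mathbb Y(-2,z).$$ (2) The space $\tilde{\mathbb F}_\varkappa$ has a compatible vertex operator algebra structure with $\operatorname{rank}\tilde{\mathbb F}_\varkappa=26$.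
   Context: The Virasoro algebra $\mathrm{Vir}$ has generators $L_n$ ($n\in\mathbb Z$) and central $\mathbf c$, $[L_m,L_n]=(m-n)L_{m+n}+\delta_{m+n,0}\frac{m^3-m}{12}\mathbf c$; $L(z)=\sum_nL_nz^{-n-2}$; $\mathrm{Vir}_c$ refers to $\mathbf c$ acting as $c$. Let $\mathbf P=\mathbb Z$ and $\tilde{\mathbb F}_\varkappa=\hat F_\varkappa(a)\otimes\hat F_{-\varkappa}(\bar a)\otimes\mathbb C[\mathbf P]$: here $a(z)=\sum a_nz^{-n-1}$, $\bar a(z)=\sum\bar a_nz^{-n-1}$, $[a_m,a_n]=2\varkappa m\delta_{m+n,0}$, $[\bar a_m,\bar a_n]=-2\varkappa m\delta_{m+n,0}$, $[a_m,\bar a_n]=0$; the first two factors are Fock spaces freely generated by $a_n$, resp. $\bar a_n$, $n<0$, from vacua killed by the positive modes; $\mathbb C[\mathbf P]$ has basis $\mathbf 1_\lambda$ and $a_0\mathbf 1_\lambda=\bar a_0\mathbf 1_\lambda=\lambda\mathbf 1_\lambda$. For $\mu\in\mathbf P$, $$\mathbb Y(\mu,z)=\exp\Big(\tfrac\mu{2\varkappa}\sum_{n<0}\tfrac{a_n}{-n}z^{-n}\Big)\exp\Big(\tfrac\mu{2\varkappa}\sum_{n>0}\tfrac{a_n}{-n}z^{-n}\Big)\exp\Big(-\tfrac\mu{2\varkappa}\sum_{n<0}\tfrac{\bar a_n}{-n}z^{-n}\Big)\exp\Big(-\tfrac\mu{2\varkappa}\sum_{n>0}\tfrac{\bar a_n}{-n}z^{-n}\Big)\mathbf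 1_\mu,$$ where $\mathbf 1_\mu:\mathbf 1_\lambda\mapsto\mathbf 1_{\lambda+\mu}$. Normal ordering $:\ :$ puts the regular part of the left field to the left and its principal part to the right. Vertex algebra: a space $\mathcal V$ with state-field map $v\mapsto\mathcal Y(v,z)$, vacuum $\mathbf 1$, translation operator $\mathcal D$, satisfying locality, $\mathcal Y(\mathbf 1,z)=\mathrm{Id}$, $\mathcal Y(v,z)\mathbf 1|_{z=0}=v$, $\mathcal D\mathbf 1=0$, $[\mathcal D,\mathcal Y(v,z)]=\frac d{dz}\mathcal Y(v,z)$. It is a vertex operator algebra of rank $r$ if there is $\boldsymbol\omega\in\mathcal V$ such that $\mathcal Y(\boldsymbol\omega,z)=\sum_n\mathcal L_nz^{-n-2}$ satisfies the Virasoro relations with central charge $r$ and $\mathcal L_{-1}=\mathcal D$. ''Compatible'' means that the vertex operators are intertwining operators, in the VOA sense, for the $\mathrm{Vir}_c\oplus\mathrm{Vir}_{\bar c}$-action, which amounts to the fields $L(z),\bar L(z)$ being of the form $\mathcal Y(u,z)$ for suitable $u\in\tilde{\mathbb F}_\varkappa$. *)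

(* Defs.v *)
From mathcomp Require Import all_boot all_order all_algebra.
From mathcomp Require Import finmap monalg.
From mathcomp Require Import boolp classical_sets functions fsbigop.

Set Implicit Arguments.
Unset Strict Implicit.
Unset Printing Implicit Defensive.

Import Order.TTheory GRing.Theory Num.Theory.

Local Open Scope classical_set_scope.
Local Open Scope ring_scope.

(* A formal distribution A(z) = \sum_k A_k z^k with coefficients in End(V) is
   the function k |-> A_k; [A k] is the coefficient of the k-th POWER of z.
   Sums and scalar multiples of distributions are the pointwise ones. *)
Notation fdist V := (int -> V -> V) (only parsing).

Section FormalCalculus.
Context {K : fieldType} {V : lmodType K}.
Implicit Types A B : fdist V.

Definition fconst (f : V -> V) : fdist V := fun k v => if k == 0 then f v else 0.

(* \sum_(i \in D) ranges over the i with a nonzero summand, and is 0 when there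
   are infinitely many of them; on every vector, the products and exponentials
   below have only finitely many. *)
Definition fprod A B : fdist V :=
  fun k v => \sum_(i \in [set: int]) A i (B (k - i) v).

Definition fpow A (j : nat) : fdist V := iter j (fprod A) (fconst idfun).

Definition fexp A : fdist V :=
  fun k v => \sum_(j \in [set: nat]) (j`!%:R)^-1 *: fpow A j k v.

Definition fderiv A : fdist V := fun k v => (k + 1)%:~R *: A (k + 1) v.

Definition regular_part A : fdist V := fun k v => if 0 <= k then A k v else 0.
Definition principal_part A : fdist V := fun k v => if k < 0 then A k v else 0.

(* :A(z)B(z): *)
Definition normal_order A B : fdist V :=
  fprod (regular_part A) B + fprod B (principal_part A).

Definition is_field A : Prop :=
  (forall k, linear (A k)) /\
  (forall v, exists N : int, forall k, k < N -> A k v = 0).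

(* (z - w)^N [A(z), B(w)] = 0 for some N, read off at z^k w^l *)
Definition mutually_local A B : Prop :=
  exists N : nat, forall (k l : int) (v : V),
    \sum_(i < N.+1) ((-1) ^+ i * 'C(N, i)%:R : K) *:
      (A (k - N%:Z + i%:Z) (B (l - i%:Z) v) -
       B (l - i%:Z) (A (k - N%:Z + i%:Z) v)) = 0.

(* T_n in T(z) = \sum_n T_n z^(-n-2) *)
Definition vir_mode (T : fdist V) (n : int) : V -> V := T (- n - 2).

(* The coefficients of T(z) define an action of the Virasoro algebra in which
   the central element acts as c. *)
Definition virasoro_action (c : K) (T : fdist V) : Prop :=
  (forall n, linear (vir_mode T n)) /\
  (forall (m n : int) (v : V),
     vir_mode T m (vir_mode T n v) - vir_mode T n (vir_mode T m v) =
     (m - n)%:~R *: vir_mode T (m + n) v +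
     (if m + n == 0 then ((m ^+ 3 - m)%:~R / 12%:R * c) *: v else 0)).

Definition commuting_actions (S T : fdist V) : Prop :=
  forall (m n : int) (v : V),
    vir_mode S m (vir_mode T n v) = vir_mode T n (vir_mode S m v).

End FormalCalculus.

Record vertex_algebra (K : fieldType) (V : lmodType K) := VertexAlgebra {
  va_Y : V -> fdist V;
  va_vac : V;
  va_D : V -> V;
  va_Y_linear : linear va_Y;
  va_Y_field : forall v, is_field (va_Y v);
  va_D_linear : linear va_D;
  va_locality : forall u v, mutually_local (va_Y u) (va_Y v);
  va_Y_vac : va_Y va_vac = fconst idfun;
  va_creation_reg : forall v (k : int), k < 0 -> va_Y v k va_vac = 0;
  va_creation : forall v, va_Y v 0 va_vac = v;
  va_D_vac : va_D va_vac = 0;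
  va_translation : forall v k w,
    va_D (va_Y v k w) - va_Y v k (va_D w) = fderiv (va_Y v) k w
}.

Section VOA.
Context {K : fieldType} {V : lmodType K}.
Implicit Types S : vertex_algebra V.

Definition is_voa_of_rank S (r : K) : Prop :=
  exists omega : V,
    virasoro_action r (va_Y S omega) /\
    vir_mode (va_Y S omega) (-1) = va_D S.

(* m(m-1)...(m-j+1)/j! for an arbitrary integer m *)
Definition gbin (m : int) (j : nat) : K :=
  (\prod_(i < j) (m - i%:Z)%:~R) / (j`!)%:R.

(* A_(n) in A(z) = \sum_n A_(n) z^(-n-1) *)
Definition va_mode (A : fdist V) (n : int) : V -> V := A (- n - 1).

(* The Jacobi identity of an intertwining operator, between T(z) and the
   vertex operators, written out in modes: take
     z0^-1 d((z1-z2)/z0) T(z1) Y(v,z2) - z0^-1 d((z2-z1)/(-z0)) Y(v,z2) T(z1)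
       = z2^-1 d((z1-z0)/z2) Y(T(z0)v,z2)
   at z0^(-n-1) z1^(-m-1) z2^(-k-1). *)
Definition jacobi_identity S (T : fdist V) : Prop :=
  forall (m n k : int) (v w : V),
    \sum_(j \in [set: nat])
      gbin m j *: va_mode (va_Y S (va_mode T (n + j%:Z) v)) (m + k - j%:Z) w =
    \sum_(j \in [set: nat])
      ((-1) ^+ j * gbin n j) *:
        (va_mode T (m + n - j%:Z) (va_mode (va_Y S v) (k + j%:Z) w) -
         ((-1) ^ n) *:
           va_mode (va_Y S v) (n + k - j%:Z) (va_mode T (m + j%:Z) w)).

(* The vertex operators of S intertwine the two Virasoro actions (Jacobi
   identity with each action, and the L_{-1}-derivative property with respect
   to the sum of the two), and both actions are given by vertex operators. *)
Definition compatible S (T Tbar : fdist V) : Prop :=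
  [/\ jacobi_identity S T,
      jacobi_identity S Tbar,
      forall v, va_Y S (vir_mode T (-1) v + vir_mode Tbar (-1) v) =
                fderiv (va_Y S v)
    & (exists u, va_Y S u = T) /\ (exists ubar, va_Y S ubar = Tbar)].

End VOA.

Section FockSpace.
Variable K : fieldType.

(* A basis element (m, mbar, l) of F(a) (x) F(abar) (x) C[Z] stands for
   (\prod_p a_{-p-1}^(m p)) (\prod_p abar_{-p-1}^(mbar p)) 1_l. *)
Definition fock_index : choiceType :=
  (({cmonom nat} * {cmonom nat}) * int)%type.

Definition Ftilde : lmodType K := {malg K[fock_index]}.

Definition linear_ext (f : fock_index -> Ftilde) (v : Ftilde) : Ftilde :=
  \sum_(b <- msupp v) mcoeff b v *: f b.

(* The n-th mode, in the Heisenberg algebra [b_m, b_n] = 2 k m d_{m+n,0}, on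
   the monomial m of the Fock space of lowest weight l, as coefficient and
   monomial: b_{-p-1} is the multiplication by the p-th variable x_p, and
   b_{p+1} is 2 k (p + 1) d/dx_p. *)
Definition heisenberg (k : K) (n : int) (m : {cmonom nat}) (l : int) :
    K * {cmonom nat} :=
  match n with
  | Posz 0 => (l%:~R, m)
  | Posz p.+1 => (2 * k * p.+1%:R * (m p)%:R, divcm m (ucm p))
  | Negz p => (1, mulcm m (ucm p))
  end.

Definition a_mode (kappa : K) (n : int) : Ftilde -> Ftilde :=
  linear_ext (fun b => let: (m, mbar, l) := b in
    let: (x, m') := heisenberg kappa n m l in << x *g (m', mbar, l) >>).

Definition abar_mode (kappa : K) (n : int) : Ftilde -> Ftilde :=
  linear_ext (fun b => let: (m, mbar, l) := b in
    let: (x, mbar') := heisenberg (- kappa) n mbar l in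
    << x *g (m, mbar', l) >>).

Definition shift (mu : int) : Ftilde -> Ftilde :=
  linear_ext (fun b => let: (m, mbar, l) := b in << (m, mbar, l + mu) >>).

Definition a_field (kappa : K) : fdist Ftilde :=
  fun k => a_mode kappa (- k - 1).
Definition abar_field (kappa : K) : fdist Ftilde :=
  fun k => abar_mode kappa (- k - 1).

(* \sum_{n<0} b_n/(-n) z^(-n) and \sum_{n>0} b_n/(-n) z^(-n); the coefficient
   of z^k is the term n = -k. *)
Definition int_creation (b : int -> Ftilde -> Ftilde) : fdist Ftilde :=
  fun k v => if 0 < k then (k%:~R)^-1 *: b (- k) v else 0.
Definition int_annihilation (b : int -> Ftilde -> Ftilde) : fdist Ftilde :=
  fun k v => if k < 0 then (k%:~R)^-1 *: b (- k) v else 0.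

Definition vertex_op (kappa : K) (mu : int) : fdist Ftilde :=
  let s : K := mu%:~R / (2 * kappa) in
  fprod (fexp (s *: int_creation (a_mode kappa)))
  (fprod (fexp (s *: int_annihilation (a_mode kappa)))
  (fprod (fexp ((- s) *: int_creation (abar_mode kappa)))
  (fprod (fexp ((- s) *: int_annihilation (abar_mode kappa)))
         (fconst (shift mu))))).

Definition L_field (kappa : K) : fdist Ftilde :=
  (4 * kappa)^-1 *: normal_order (a_field kappa) (a_field kappa)
  + ((kappa - 1) / (2 * kappa)) *: fderiv (a_field kappa)
  - kappa^-1 *: vertex_op kappa (-2).

Definition Lbar_field (kappa : K) : fdist Ftilde :=
  - ((4 * kappa)^-1 *: normal_order (abar_field kappa) (abar_field kappa))
  + ((kappa + 1) / (2 * kappa)) *: fderiv (abar_field kappa)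
  + kappa^-1 *: vertex_op kappa (-2).

End FockSpace.

(* Main.v *)
Require Import Defs.
From mathcomp Require Import all_boot all_order all_algebra complex reals.
From mathcomp Require Import finmap monalg.
From mathcomp Require Import boolp classical_sets functions fsbigop.
From mathcomp Require Import zify ring.

(** Both Virasoro actions and the vertex algebra come out of one structure: the
    currents a and abar and the vertex operators Y(mu) are mutually local fields
    that generate the space from the vacuum, so they determine a vertex algebra
    in which L and Lbar are the fields of two explicit vectors u and ubar.
    Every remaining claim then reduces to computing finitely many products
    u_(j)u, ubar_(j)ubar and u_(j)ubar.

    Fields are handled through their modes A_(n), the coefficient of z^(-n-1).
    The expression [borcherds A B m n k] pairs z^m w^k (z - w)^n with the two
    orderings of A(z) and B(w). It satisfies the recursion that comes from
    z = (z - w) + w, and locality of A and B says exactly that it vanishes for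
    large n. Together these give the Borcherds identity by induction on m
    ([borcherds_identity]), and, with a third field added, Dong's lemma: the
    products A_(n)B of mutually local fields stay local to whatever A and B are
    local to ([dong]).
    Goddard's argument shows that a translation-covariant field local to the
    generators is determined by the vector it creates from the vacuum
    ([admissible_unique]). Hence iterated products of generators provide exactly
    one field per vector, and this is the state-field map ([reconstruction]); it
    satisfies the Jacobi identity because u_(n)v and the n-th product of the
    fields of u and v create the same vector.

    The generators are free fields. The exponentials in Y(mu) are controlled by
    commutators only: an operator family with the same commutators with the
    currents as Y(mu) vanishes as soon as it vanishes on the vectors 1_l. The
    vector Y(mu)1_l involves only the creation modes of a - abar, and these commute
    with every Y(nu), as a and abar have the same commutator with it. This yields both the commutation of all Y(mu), Y(nu) ([vertexC])
    and translation covariance ([vertex_translation]).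

    Finally [a_m, L_(j)] is a multiple of a plus a central term plus a multiple
    of Y(-2), so all L_(j)u are obtained by moving L_(j) through the creation
    operators in u. The exchange of a with abar and of kappa with - kappa swaps
    L and Lbar, so that only L has to be treated ([stress_system_sym]). The terms
    Y(-2) cancel in L + Lbar, whose mode L_{-1} + Lbar_{-1} is the translation
    operator of free fields, and the two central charges add up to 26. *)

Set Implicit Arguments.
Unset Strict Implicit.
Unset Printing Implicit Defensive.

Import Order.TTheory GRing.Theory Num.Theory.

Local Open Scope classical_set_scope.
Local Open Scope ring_scope.

Local Notation fprod := Defs.fprod.

(** * Linear maps and sums with finitely many nonzero terms *)

Section LinearMaps.
Context {K : fieldType} {U V : lmodType K}.
Variable f : U -> V.
Hypothesis lf : linear f.

Lemma lin0 : f 0 = 0.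
Proof. by have := lf (-1) 0 0; rewrite scaler0 add0r scaleN1r addNr. Qed.
Lemma linD u v : f (u + v) = f u + f v.
Proof. by have := lf 1 u v; rewrite !scale1r. Qed.
Lemma linZ c u : f (c *: u) = c *: f u.
Proof. by have := lf c u 0; rewrite lin0 !addr0. Qed.
Lemma linN u : f (- u) = - f u.
Proof. by rewrite -scaleN1r linZ scaleN1r. Qed.
Lemma linB u v : f (u - v) = f u - f v.
Proof. by rewrite linD linN. Qed.
Lemma lin_sum I (r : seq I) (F : I -> U) :
  f (\sum_(i <- r) F i) = \sum_(i <- r) f (F i).
Proof.
by elim: r => [|i r IH]; rewrite ?big_nil ?lin0// !big_cons linD IH.
Qed.
End LinearMaps.

Section FiniteSums.
Context {K : fieldType} {V : lmodType K}.

(** Sums over an infinite index type are 0 by convention when infinitely many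
    terms are nonzero, so they are additive, and commute with linear maps, only
    under this condition. *)
Definition finsum_ok (I : choiceType) (F : I -> V) :=
  exists s : seq I, forall i, i \notin s -> F i = 0.

Section General.
Context {I : choiceType}.
Implicit Types F G : I -> V.

Lemma fsum_seq (r : seq I) F : uniq r -> (forall i, i \notin r -> F i = 0) ->
  \sum_(i \in [set: I]) F i = \sum_(i <- r) F i.
Proof.
move=> ur Fr; rewrite (fsbigE r)//=; last by move=> i _; exact: Fr.
by apply: eq_bigl => i; rewrite in_setT.
Qed.

Lemma fsum_undup (r : seq I) F : (forall i, i \notin r -> F i = 0) ->
  \sum_(i \in [set: I]) F i = \sum_(i <- undup r) F i.
Proof.
by move=> Fr; apply: fsum_seq; rewrite ?undup_uniq// => i; rewrite mem_undup;
  exact: Fr.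
Qed.

Lemma fsumD F G : finsum_ok F -> finsum_ok G ->
  \sum_(i \in [set: I]) (F i + G i) =
  \sum_(i \in [set: I]) F i + \sum_(i \in [set: I]) G i.
Proof.
move=> [r Fr] [s Gs].
rewrite (@fsum_undup (r ++ s) F) => [|i]; last first.
  by rewrite mem_cat negb_or => /andP[/Fr].
rewrite (@fsum_undup (r ++ s) G) => [|i]; last first.
  by rewrite mem_cat negb_or => /andP[_ /Gs].
rewrite -big_split; apply: fsum_undup => i.
by rewrite mem_cat negb_or => /andP[/Fr-> /Gs->]; rewrite addr0.
Qed.

Lemma fsum_single (i0 : I) F : (forall i, i != i0 -> F i = 0) ->
  \sum_(i \in [set: I]) F i = F i0.
Proof.
move=> F0; rewrite (@fsum_seq [:: i0])// ?big_seq1// => i.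
by rewrite inE => /F0.
Qed.

Lemma fsum0 F : (forall i, F i = 0) -> \sum_(i \in [set: I]) F i = 0.
Proof. by move=> F0; apply: fsbig1 => i _. Qed.

Lemma eq_fsum F G : F =1 G ->
  \sum_(i \in [set: I]) F i = \sum_(i \in [set: I]) G i.
Proof. by move=> FG; apply: eq_fsbigr => i _. Qed.

Lemma finsum_okD F G : finsum_ok F -> finsum_ok G ->
  finsum_ok (fun i => F i + G i).
Proof.
move=> [r Fr] [s Gs]; exists (r ++ s) => i.
by rewrite mem_cat negb_or => /andP[/Fr-> /Gs->]; rewrite addr0.
Qed.

Lemma finsum_okZ (c : I -> K) F : finsum_ok F ->
  finsum_ok (fun i => c i *: F i).
Proof. by move=> [r Fr]; exists r => i /Fr->; rewrite scaler0. Qed.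

Lemma finsum_okN F : finsum_ok F -> finsum_ok (fun i => - F i).
Proof. by move=> [r Fr]; exists r => i /Fr->; rewrite oppr0. Qed.

Lemma finsum_okB F G : finsum_ok F -> finsum_ok G ->
  finsum_ok (fun i => F i - G i).
Proof. by move=> fF fG; apply: finsum_okD => //; exact: finsum_okN. Qed.

Lemma finsum_ok_ext F G : F =1 G -> finsum_ok F -> finsum_ok G.
Proof. by move=> FG [r Fr]; exists r => i /Fr; rewrite FG. Qed.

End General.

Lemma fsum_lin (W : lmodType K) (I : choiceType) (F : I -> V) (f : V -> W) :
    linear f -> finsum_ok F ->
  f (\sum_(i \in [set: I]) F i) = \sum_(i \in [set: I]) f (F i).
Proof.
move=> lf [r Fr]; rewrite (fsum_undup Fr) (lin_sum lf); symmetry.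
rewrite (fsbigE (undup r)) ?undup_uniq//; last first.
  by move=> i _; rewrite mem_undup => /Fr->; rewrite (lin0 lf).
by apply: eq_bigl => i; rewrite in_setT.
Qed.

Lemma scale_linear (c : K) : linear (fun v : V => c *: v).
Proof. by move=> a u v; rewrite scalerDr !scalerA mulrC. Qed.

Lemma fsumZ (I : choiceType) (c : K) (F : I -> V) : finsum_ok F ->
  c *: (\sum_(i \in [set: I]) F i) = \sum_(i \in [set: I]) c *: F i.
Proof. exact: (fsum_lin (@scale_linear c)). Qed.

Lemma fsumN (I : choiceType) (F : I -> V) : finsum_ok F ->
  - (\sum_(i \in [set: I]) F i) = \sum_(i \in [set: I]) - F i.
Proof.
move=> fF; rewrite -scaleN1r fsumZ//; apply: eq_fsum => i.
by rewrite scaleN1r.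
Qed.

Lemma fsumB (I : choiceType) (F G : I -> V) : finsum_ok F -> finsum_ok G ->
  \sum_(i \in [set: I]) (F i - G i) =
  \sum_(i \in [set: I]) F i - \sum_(i \in [set: I]) G i.
Proof. by move=> fF fG; rewrite fsumN// fsumD//; exact: finsum_okN. Qed.

Lemma finsum_ok_reindex (I J : choiceType) (h : J -> I) (F : I -> V) :
  bijective h -> finsum_ok F -> finsum_ok (F \o h).
Proof.
move=> [g hg gh] [r Fr]; exists (map g r) => i /=; rewrite -{1}(hg i).
by rewrite mem_map; [exact: Fr | exact: can_inj gh].
Qed.

Lemma finsum_ok_nat (F : nat -> V) (N : nat) :
  (forall i, (N <= i)%N -> F i = 0) -> finsum_ok F.
Proof.
move=> FN; exists (iota 0 N) => i; rewrite mem_iota /= add0n -leqNgt.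
exact: FN.
Qed.

Lemma finsum_ok_nat_inv (F : nat -> V) :
  finsum_ok F -> exists N : nat, forall i, (N <= i)%N -> F i = 0.
Proof.
move=> [r Fr]; exists (\max_(i <- r) i).+1 => i iN; apply: Fr.
by apply/negP => ir; move: iN; rewrite leqNgt ltnS leq_bigmax_seq.
Qed.

Lemma fsum_ord (F : nat -> V) (N : nat) :
  (forall i, (N <= i)%N -> F i = 0) ->
  \sum_(i \in [set: nat]) F i = \sum_(i < N) F i.
Proof.
move=> FN; rewrite (@fsum_seq _ (iota 0 N)) ?iota_uniq//.
  by rewrite -[X in iota 0 X]subn0 big_mkord.
by move=> i; rewrite mem_iota /= add0n -leqNgt; exact: FN.
Qed.

Lemma fsumS (F : nat -> V) : finsum_ok F ->
  \sum_(i \in [set: nat]) F i = F 0 + \sum_(i \in [set: nat]) F i.+1.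
Proof.
move=> /finsum_ok_nat_inv[N FN].
rewrite (@fsum_ord F N.+1) => [|i /ltnW]; last exact: FN.
by rewrite big_ord_recl (@fsum_ord (fun i => F i.+1) N) => // i iN;
  apply: FN; exact: leqW.
Qed.

Lemma finsum_okS (F : nat -> V) : finsum_ok F -> finsum_ok (fun i => F i.+1).
Proof.
move=> /finsum_ok_nat_inv[N FN]; apply: (@finsum_ok_nat _ N) => i iN.
by apply: FN; exact: leqW.
Qed.

Lemma finsum_ok_int (F : int -> V) (M N : int) :
  (forall i, i < M -> F i = 0) -> (forall i, N < i -> F i = 0) -> finsum_ok F.
Proof.
move=> FM FN; exists (map (fun j : nat => M + j%:Z) (iota 0 `|N - M|.+1)) => i.
move=> /negP iMN; case: (ltP i M) => [/FM//|Mi]; case: (ltP N i) => [/FN//|iN].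
case: iMN; apply/mapP; exists `|i - M|%N; last by lia.
by rewrite mem_iota; lia.
Qed.

End FiniteSums.

(** * Identities between linear combinations *)

Section ModuleExpressions.
Context {K : fieldType} {V : lmodType K}.

Inductive mexpr :=
  | MVar of nat | MZero | MAdd of mexpr & mexpr | MOpp of mexpr
  | MScale of K & mexpr.

Fixpoint meval (env : seq V) (e : mexpr) : V :=
  match e with
  | MVar i => env`_i
  | MZero => 0
  | MAdd e1 e2 => meval env e1 + meval env e2
  | MOpp e1 => - meval env e1
  | MScale c e1 => c *: meval env e1
  end.

Fixpoint mcoef_of (i : nat) (e : mexpr) : K :=
  match e with
  | MVar j => if eqn i j then 1 else 0
  | MZero => 0
  | MAdd e1 e2 => mcoef_of i e1 + mcoef_of i e2
  | MOpp e1 => - mcoef_of i e1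
  | MScale c e1 => c * mcoef_of i e1
  end.

Fixpoint mcoefs_agree (n : nat) (e1 e2 : mexpr) : Prop :=
  if n is n'.+1 then
    mcoef_of n' e1 = mcoef_of n' e2 /\ mcoefs_agree n' e1 e2
  else True.

Lemma mevalE env e :
  meval env e = \sum_(i < size env) mcoef_of i e *: env`_i.
Proof.
elim: e => [j||e1 IH1 e2 IH2|e1 IH1|c e1 IH1] /=.
- case: (ltnP j (size env)) => jN.
    rewrite (bigD1 (Ordinal jN))//= eqnE eqxx scale1r big1 ?addr0// => i.
    by rewrite -val_eqE /= => /negbTE->; rewrite scale0r.
  rewrite nth_default// big1// => i _; rewrite eqnE; case: eqP => [ij|_].
    by move: jN; rewrite -ij leqNgt ltn_ord.
  by rewrite scale0r.
- by rewrite big1// => i _; rewrite scale0r.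
- by rewrite IH1 IH2 -big_split; apply: eq_bigr => i _; rewrite scalerDl.
- by rewrite IH1 -sumrN; apply: eq_bigr => i _; rewrite scaleNr.
- by rewrite IH1 scaler_sumr; apply: eq_bigr => i _; rewrite scalerA.
Qed.

Lemma meval_eq env e1 e2 :
  mcoefs_agree (size env) e1 e2 -> meval env e1 = meval env e2.
Proof.
move=> agree; rewrite !mevalE; apply: eq_bigr => i _; congr (_ *: _).
have: (i < size env)%N by [].
move: (i : nat) => {}i; elim: (size env) agree => //= n IH [cn agree].
by rewrite ltnS leq_eqVlt => /predU1P[->//|/IH]; exact.
Qed.

End ModuleExpressions.

(** To prove an equality of linear combinations it is enough to compare the
    coefficients of each vector that is not itself a sum, an opposite or a
    multiple. The tactic [module_eq] collects these vectors, compared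
    syntactically, and leaves the equations between scalars. *)
Ltac mod_mem x l :=
  lazymatch l with
  | nil => constr:(false)
  | x :: _ => constr:(true)
  | _ :: ?l' => mod_mem x l'
  end.

Ltac mod_index x l :=
  lazymatch l with
  | x :: _ => constr:(0%N)
  | _ :: ?l' => let i := mod_index x l' in constr:(S i)
  end.

Ltac mod_atoms t l :=
  lazymatch t with
  | (?a + ?b)%R => let l1 := mod_atoms a l in mod_atoms b l1
  | (- ?a)%R => mod_atoms a l
  | (?c *: ?a)%R => mod_atoms a l
  | (0)%R => l
  | _ => lazymatch mod_mem t l with true => l | false => constr:(t :: l) end
  end.

Ltac mod_reify K t l :=
  lazymatch t with
  | (?a + ?b)%R => let a' := mod_reify K a l in let b' := mod_reify K b l in
                   constr:(@MAdd K a' b')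
  | (- ?a)%R => let a' := mod_reify K a l in constr:(@MOpp K a')
  | (?c *: ?a)%R => let a' := mod_reify K a l in constr:(@MScale K c a')
  | (0)%R => constr:(@MZero K)
  | _ => let i := mod_index t l in constr:(@MVar K i)
  end.

Ltac mod_split :=
  lazymatch goal with
  | |- True => exact I
  | |- _ /\ _ => split; [| mod_split]
  end.

Ltac module_eq K :=
  lazymatch goal with
  | |- @eq ?T ?t1 ?t2 =>
    let l := mod_atoms t1 (@nil T) in
    let l := mod_atoms t2 l in
    let e1 := mod_reify K t1 l in
    let e2 := mod_reify K t2 l in
    apply: (@meval_eq K _ l e1 e2);
    cbn [mcoefs_agree size mcoef_of eqn]; mod_split
  end.
Ltac module_ring K := module_eq K; try ring.

(** * Modes of fields and their products *)

Section Binomials.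
Context {K : numFieldType}.
Implicit Types (n : int) (j : nat).

Local Notation gbin := (@gbin K).

Lemma gbin0 n : gbin n 0 = 1.
Proof. by rewrite /gbin big_ord0 fact0 divr1. Qed.

Lemma gbinS n j : (j.+1)%:R * gbin n j.+1 = (n - j%:Z)%:~R * gbin n j.
Proof.
rewrite /gbin big_ord_recr /= factS natrM.
have j1 : j.+1%:R != 0 :> K by rewrite pnatr_eq0.
have jf : j`!%:R != 0 :> K by rewrite pnatr_eq0 -lt0n fact_gt0.
by field; rewrite ?jf ?j1 ?nat1r ?j1.
Qed.

Lemma gbin_pascal n j : gbin (n + 1) j.+1 = gbin n j.+1 + gbin n j.
Proof.
rewrite /gbin big_ord_recl big_ord_recr /= factS natrM.
have j1 : j.+1%:R != 0 :> K by rewrite pnatr_eq0.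
have jf : j`!%:R != 0 :> K by rewrite pnatr_eq0 -lt0n fact_gt0.
have shiftE (i : 'I_j) : n + 1 - (bump 0 i)%:Z = n - i%:Z.
  by rewrite /bump /=; lia.
under eq_bigr => i _ do rewrite shiftE.
rewrite (_ : (n + 1 - 0%N%:Z)%:~R = (n - j%:Z)%:~R + j.+1%:R :> K); last first.
  by rewrite [j.+1%:R]pmulrn -intrD; congr (_%:~R); lia.
by field; rewrite ?jf ?j1 ?nat1r ?j1.
Qed.

Lemma gbin1 n : gbin n 1 = n%:~R.
Proof. by have := gbinS n 0; rewrite gbin0 mul1r mulr1 subr0. Qed.

Lemma gbin3 n : gbin n 3 = (n * (n - 1) * (n - 2))%:~R / 6.
Proof.
have := gbinS n 1; have := gbinS n 2; rewrite gbin1 => E3 E2.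
have -> : gbin n 3 = 3 * (2 * gbin n 3) / 6 by field.
by rewrite [3 * _]mulrCA E3 mulrCA E2 -!intrM; congr (_%:~R / _); ring.
Qed.

Lemma gbin_zero j : gbin 0 j.+1 = 0.
Proof. by rewrite /gbin big_ord_recl subr0 !mul0r. Qed.

Lemma gbinN1 j : gbin (-1) j = (-1) ^+ j.
Proof.
elim: j => [|j IH]; first by rewrite gbin0.
have j1 : j.+1%:R != 0 :> K by rewrite pnatr_eq0.
apply: (mulfI j1); rewrite gbinS IH exprS.
rewrite (_ : (-1 - j%:Z)%:~R = - (j.+1%:R) :> K); last first.
  by rewrite [_%:R in RHS]pmulrn -mulrNz; congr (_%:~R); lia.
by ring.
Qed.

Lemma gbinN2 j : gbin (-2) j = (-1) ^+ j * j.+1%:R.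
Proof.
elim: j => [|j IH]; first by rewrite gbin0 mulr1.
have j1 : j.+1%:R != 0 :> K by rewrite pnatr_eq0.
apply: (mulfI j1); rewrite gbinS IH exprS.
rewrite (_ : (-2 - j%:Z)%:~R = - (j.+2%:R) :> K); last first.
  by rewrite [_%:R in RHS]pmulrn -mulrNz; congr (_%:~R); lia.
by ring.
Qed.

End Binomials.

Section BinomialSums.
Context {K : numFieldType} {V : lmodType K}.
Implicit Types (t : int -> int -> V) (n p q : int).

Definition antidiagonal_ok t :=
  forall p q : int, finsum_ok (fun j : nat => t (p - j%:Z) (q + j%:Z)).

(** If t p q is the coefficient of z^(-p-1) w^(-q-1) in t(z, w), then [bsum t n p q]
    is that coefficient in z^(-n) (z - w)^n t(z, w), where (z - w)^n is expanded
    in nonnegative powers of w. *)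
Definition bsum t (n p q : int) : V :=
  \sum_(j \in [set: nat]) ((-1) ^+ j * gbin n j) *: t (p - j%:Z) (q + j%:Z).

(** Pascal's rule turns into (z - w)^(n+1) = (z - w)^n (z - w). *)
Lemma bsum_pascal t n p q : antidiagonal_ok t ->
  bsum t (n + 1) (p + 1) q = bsum t n (p + 1) q - bsum t n p (q + 1).
Proof.
move=> ft.
have fZ c p' q' : finsum_ok (fun j : nat => c j *: t (p' - j%:Z) (q' + j%:Z)).
  by apply: finsum_okZ; exact: ft.
rewrite /bsum fsumS; last exact: fZ.
rewrite [X in _ = X - _]fsumS; last exact: fZ.
rewrite /= !gbin0 -[RHS]addrA; congr (_ + _).
rewrite -fsumB; last 2 first.
- apply: (finsum_okS (F := fun j : nat =>
    ((-1) ^+ j * gbin n j) *: t (p + 1 - j%:Z) (q + j%:Z))); exact: fZ.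
- exact: fZ.
apply: eq_fsum => j; rewrite gbin_pascal mulrDr scalerDl; congr (_ + _).
rewrite exprS !mulNr !mul1r scaleNr; congr (- (_ *: t _ _)); lia.
Qed.

Lemma bsum0 t p q : antidiagonal_ok t -> bsum t 0 p q = t p q.
Proof.
move=> ft; rewrite /bsum (@fsum_single _ _ _ 0); last first.
  by case=> // j _; rewrite gbin_zero mulr0 scale0r.
by rewrite gbin0 mulr1 scale1r subr0 addr0.
Qed.

End BinomialSums.

Section Fields.
Context {K : numFieldType} {V : lmodType K}.
Implicit Types (A B : int -> V -> V) (m n k : int).

Definition mode_field A : Prop :=
  (forall n, linear (A n)) /\
  (forall v, exists N : int, forall n, N <= n -> A n v = 0).

Definition commutator A B (v : V) (m k : int) := A m (B k v) - B k (A m v).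

Lemma antidiagonal_field A B v : mode_field A -> mode_field B ->
  antidiagonal_ok (fun p q => A p (B q v)).
Proof.
move=> [lA _] [_ fB] p q; have [N BN] := fB v.
apply: (@finsum_ok_nat _ _ _ `|N - q|%N) => j Nj.
by rewrite BN ?(lin0 (lA _))//; lia.
Qed.

(** The residue of z^m w^k (z - w)^n A(z)B(w), with |z| > |w|, minus that of
    z^m w^k (z - w)^n B(w)A(z), with |w| > |z|. This is one side of the Jacobi
    identity, and its case m = 0 defines the n-th product. *)
Definition borcherds A B (m n k : int) (v : V) : V :=
  \sum_(j \in [set: nat])
      ((-1) ^+ j * gbin n j) *:
        (A (m + n - j%:Z) (B (k + j%:Z) v) -
         ((-1) ^ n) *: B (n + k - j%:Z) (A (m + j%:Z) v)).

Definition nprod A B (n : int) : int -> V -> V := fun k => borcherds A B 0 n k.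

Lemma borcherdsE A B m n k v : mode_field A -> mode_field B ->
  borcherds A B m n k v =
    bsum (fun p q => A p (B q v)) n (m + n) k -
    (-1) ^ n *: bsum (fun p q => B p (A q v)) n (n + k) m.
Proof.
move=> fA fB; have fAB := antidiagonal_field v fA fB; have fBA := antidiagonal_field v fB fA.
rewrite /borcherds /bsum fsumZ; last exact/finsum_okZ/fBA.
rewrite -fsumB; last 2 first.
- exact/finsum_okZ/fAB.
- exact/finsum_okZ/finsum_okZ/fBA.
by apply: eq_fsum => j; rewrite scalerBr !scalerA [_ * (-1) ^ n]mulrC.
Qed.

Lemma borcherds_ok A B m n k v : mode_field A -> mode_field B ->
  finsum_ok (fun j : nat => ((-1) ^+ j * gbin n j) *:
        (A (m + n - j%:Z) (B (k + j%:Z) v) -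
         ((-1) ^ n) *: B (n + k - j%:Z) (A (m + j%:Z) v))).
Proof.
move=> fA fB; apply: finsum_okZ; apply: finsum_okB.
  exact: (antidiagonal_field v fA fB).
by apply: finsum_okZ; exact: (antidiagonal_field v fB fA).
Qed.

(** This is z = (z - w) + w. The Borcherds identity follows from this recursion,
    the values at n = 0 and the vanishing for large n. *)
Lemma borcherds_rec A B m n k v : mode_field A -> mode_field B ->
  borcherds A B (m + 1) n k v =
  borcherds A B m (n + 1) k v + borcherds A B m n (k + 1) v.
Proof.
move=> fA fB; rewrite !borcherdsE//.
rewrite (_ : m + 1 + n = m + n + 1); last by lia.
rewrite (_ : m + (n + 1) = m + n + 1); last by lia.
rewrite (_ : n + 1 + k = n + k + 1); last by lia.
rewrite (_ : n + (k + 1) = n + k + 1); last by lia.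
have fAB := antidiagonal_field v fA fB; have fBA := antidiagonal_field v fB fA.
rewrite !bsum_pascal// exprzDr ?unitrN1// expr1z.
by module_ring K.
Qed.

Lemma borcherds0 A B m k v : mode_field A -> mode_field B ->
  borcherds A B m 0 k v = commutator A B v m k.
Proof.
move=> fA fB; rewrite borcherdsE// expr0z scale1r addr0 add0r.
by rewrite (bsum0 _ _ (antidiagonal_field v fA fB))
  (bsum0 _ _ (antidiagonal_field v fB fA)).
Qed.

End Fields.

(** * Difference operators and the abstract form of Dong's lemma *)

Lemma int_downward (P : int -> Prop) (N : int) :
  (forall n, N <= n -> P n) -> (forall n, P (n + 1) -> P n) -> forall n, P n.
Proof.
move=> PN Pstep n; case: (leP N n) => [/PN//|nN].
have [d ->] : exists d : nat, n = N - d%:Z by exists `|N - n|%N; lia.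
elim: d => [|d IH]; first by apply: PN; lia.
by apply: Pstep; rewrite (_ : N - d.+1%:Z + 1 = N - d%:Z)//; lia.
Qed.

Section Differences.
Context {K : numFieldType} {V : lmodType K}.

Section DifferenceOperator.
Context {X : Type}.
Implicit Types (s t : X -> X) (h : X -> V).

(** On functions of mode indices, multiplying by a variable shifts an index, so
    [diff s t] is the multiplication by the difference of two variables. *)
Definition diff s t h : X -> V := fun x => h (s x) - h (t x).

Lemma iter_diff0 s t N : iter N (diff s t) (fun=> 0) = fun=> 0.
Proof. by elim: N => //= N ->; apply/funext => x; rewrite /diff subrr. Qed.

(** The scalar may vary as long as the shifts preserve it: it will depend on a
    mode index that the two variables leave alone. *)
Lemma iter_diff_lin s t N (c : X -> K) h1 h2 :
    (forall x, c (s x) = c x) -> (forall x, c (t x) = c x) ->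
  iter N (diff s t) (fun x => c x *: h1 x + h2 x) =
  fun x => c x *: iter N (diff s t) h1 x + iter N (diff s t) h2 x.
Proof.
move=> cs ct; elim: N => //= N ->; apply/funext => x; rewrite /diff cs ct.
by module_ring K.
Qed.

Lemma iter_diff_fsum s t N (F : nat -> X -> V) :
    (forall x, finsum_ok (fun j => F j x)) ->
  iter N (diff s t) (fun x => \sum_(j \in [set: nat]) F j x) =
  fun x => \sum_(j \in [set: nat]) iter N (diff s t) (F j) x.
Proof.
move=> okF.
have okN M x : finsum_ok (fun j => iter M (diff s t) (F j) x).
  elim: M x => //= M IH x; exact: finsum_okB.
by elim: N => //= N ->; apply/funext => x; rewrite /diff fsumB.
Qed.

Lemma diffC s t s' t' h : (forall x, s (s' x) = s' (s x)) ->
    (forall x, s (t' x) = t' (s x)) -> (forall x, t (s' x) = s' (t x)) ->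
    (forall x, t (t' x) = t' (t x)) ->
  diff s t (diff s' t' h) = diff s' t' (diff s t h).
Proof.
move=> ss st ts tt; apply/funext => x; rewrite /diff ss st ts tt.
by module_ring K.
Qed.

Lemma diff_swap s t N h :
  iter N (diff t s) h = fun x => (-1) ^+ N *: iter N (diff s t) h x.
Proof.
elim: N => [|N IH]; apply/funext => x /=; first by rewrite scale1r.
by rewrite IH /diff exprS; module_ring K.
Qed.

Lemma iter_diff_ge s t N M h : (N <= M)%N ->
  iter N (diff s t) h = (fun=> 0) -> iter M (diff s t) h = fun=> 0.
Proof. by move=> /subnK<- h0; rewrite iterD h0 iter_diff0. Qed.

End DifferenceOperator.

Lemma iter_diff_comp (X Y : Type) (s t : X -> X) (s' t' : Y -> Y)
    (r : X -> Y) (h : Y -> V) N :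
    (forall x, r (s x) = s' (r x)) -> (forall x, r (t x) = t' (r x)) ->
  iter N (diff s t) (fun x => h (r x)) = fun x => iter N (diff s' t') h (r x).
Proof.
by move=> rs rt; elim: N => //= N ->; apply/funext => x; rewrite /diff rs rt.
Qed.

End Differences.

(** Think of g as a function of z, y = z - w, w and x, where [level] is the
    exponent of y. Since w - x = (z - x) - y, applying w - x once either uses up
    a factor z - x or raises the level, and both can happen only finitely often:
    a power of z - x kills g, and g vanishes at high levels. *)
Section DongAbstract.
Context {K : numFieldType} {V : lmodType K} {X : Type}.
Variables (z y w x : X -> X) (level : X -> int).
Hypotheses (zy : forall p, z (y p) = y (z p)) (zw : forall p, z (w p) = w (z p))
  (zx : forall p, z (x p) = x (z p)) (yw : forall p, y (w p) = w (y p))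
  (yx : forall p, y (x p) = x (y p)) (wx : forall p, w (x p) = x (w p)).
Hypotheses (level_z : forall p, level (z p) = level p)
  (level_w : forall p, level (w p) = level p)
  (level_x : forall p, level (x p) = level p)
  (level_y : forall p, level (y p) = level p + 1).
Implicit Types g h : X -> V.

Let killed_from (n : int) g := exists M : nat,
  forall p, n <= level p -> iter M (diff w x) g p = 0.

Lemma killed_from_ge M M' n g : (M <= M')%N ->
    (forall p, n <= level p -> iter M (diff w x) g p = 0) ->
  forall p, n <= level p -> iter M' (diff w x) g p = 0.
Proof.
move=> /subnK<-; elim: (M' - M)%N => //= d IH gM p np.
by rewrite /diff !IH ?subrr ?level_w ?level_x.
Qed.

Lemma dong_abstract (N : int) g (R S : nat) :
    (forall p, g (z p) = g (y p) + g (w p)) ->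
    (forall p, N <= level p -> g p = 0) ->
    iter R (diff z x) (iter S (diff w x) g) = (fun=> 0) ->
  forall n, killed_from n g.
Proof.
move=> rec_g van_g kill_g n.
move: n g R rec_g van_g kill_g; apply: (int_downward (N := N)).
  by move=> n Nn g R _ van_g _; exists 0%N => p np; apply: van_g; lia.
move=> n IHn g R; elim: R g => [|R IHR] g rec_g van_g kill_g.
  by exists S => p _; rewrite -[iter S _ g]/(iter 0 (diff z x) _) kill_g.
(* One factor z - x is absorbed into the function. *)
have [M1 kill1] : killed_from n (diff z x g).
  apply: IHR.
  - by move=> p; rewrite /diff zy zw -zx -yx -wx !rec_g; module_ring K.
  - by move=> p Np; rewrite /diff !van_g ?level_z ?level_x ?subrr.
  - rewrite -[RHS]kill_g iterSr; congr iter.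
    have commute T : iter T (diff w x) (diff z x g) =
                     diff z x (iter T (diff w x) g).
      by elim: T => //= T ->; apply: diffC.
    exact: commute.
(* The term y g is g evaluated one level higher. *)
have [M2 kill2] := IHn g R.+1 rec_g van_g kill_g.
exists (M1 + M2).+1 => p np; rewrite iterSr.
have -> : diff w x g = fun p => (-1) *: g (y p) + diff z x g p.
  by apply/funext => q; rewrite /diff rec_g; module_ring K.
rewrite (@iter_diff_lin _ _ _ _ _ _ (fun=> -1))//.
rewrite (@iter_diff_comp _ _ _ _ w x w x y)//.
rewrite (killed_from_ge (leq_addl M1 M2) kill2); last by rewrite level_y; lia.
by rewrite (killed_from_ge (leq_addr M2 M1) kill1)// scaler0 addr0.
Qed.

End DongAbstract.

(** * Locality and the Borcherds identity *)

Section Locality.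
Context {K : numFieldType} {V : lmodType K}.
Implicit Types (A B C : int -> V -> V) (m n k l : int).

Definition shift1 (x : int * int) := (x.1 + 1, x.2).
Definition shift2 (x : int * int) := (x.1, x.2 + 1).

Definition commutator_at A B v := fun x : int * int => commutator A B v x.1 x.2.

(** (z - w)^N [A(z), B(w)] = 0, with z and w acting by raising the mode indices. *)
Definition local_order (N : nat) A B :=
  forall v, iter N (diff shift1 shift2) (commutator_at A B v) = fun=> 0.
Definition local A B := exists N, local_order N A B.

Lemma local_sym A B : local A B -> local B A.
Proof.
move=> [N lAB]; exists N => v.
have -> : commutator_at B A v =
    fun x => (-1) *: commutator_at A B v (x.2, x.1) + 0.
  by apply/funext => -[m k]; rewrite /commutator_at /commutator /=;
    module_ring K.
rewrite (@iter_diff_lin _ _ _ _ _ _ (fun=> -1) _ (fun=> 0))// iter_diff0.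
rewrite (@iter_diff_comp _ _ _ _ _ _ shift2 shift1 (fun x => (x.2, x.1)))//.
rewrite diff_swap lAB.
by apply/funext => x; rewrite !scaler0 addr0.
Qed.

Lemma local_lin c A B C : (forall n, linear (C n)) ->
  local A C -> local B C -> local (fun n v => c *: A n v + B n v) C.
Proof.
move=> lC [N lAC] [M lBC]; exists (N + M)%N => v.
have -> : commutator_at (fun n v => c *: A n v + B n v) C v =
    fun x => c *: commutator_at A C v x + commutator_at B C v x.
  apply/funext => -[m k]; rewrite /commutator_at /commutator /=.
  by rewrite (linD (lC _)) (linZ (lC _)); module_ring K.
rewrite (@iter_diff_lin _ _ _ _ _ _ (fun=> c))//.
rewrite (iter_diff_ge (leq_addr M N) (lAC v)).
rewrite (iter_diff_ge (leq_addl N M) (lBC v)).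
by apply/funext => x; rewrite scaler0 addr0.
Qed.

(** For n = N >= 0 both expansions of (z - w)^N are the same polynomial, so only
    the commutator remains: [borcherds] measures locality. *)
Lemma borcherds_nat A B (N : nat) m k v : mode_field A -> mode_field B ->
  borcherds A B m N%:Z k v =
  iter N (diff shift1 shift2) (commutator_at A B v) (m, k).
Proof.
move=> fA fB; elim: N m k => [|N IH] m k; first by rewrite borcherds0.
rewrite /= /diff -!IH /=; apply/eqP; rewrite eq_sym subr_eq; apply/eqP.
by rewrite borcherds_rec// (_ : N%:Z + 1 = N.+1%:Z)//; lia.
Qed.

Lemma borcherds_vanish A B (N : nat) : mode_field A -> mode_field B ->
  local_order N A B ->
  forall m n k v, N%:Z <= n -> borcherds A B m n k v = 0.
Proof.
move=> fA fB lAB m [n|n] k v Nn; last by lia.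
by rewrite borcherds_nat// (iter_diff_ge _ (lAB v)).
Qed.

Lemma borcherds_identity_ok A B : mode_field A -> mode_field B -> local A B ->
  forall (c : nat -> K) n k k' v,
  finsum_ok (fun j : nat => c j *: borcherds A B k' (n + j%:Z) (k - j%:Z) v).
Proof.
move=> fA fB [N lAB] c n k k' v; apply: (@finsum_ok_nat _ _ _ `|N%:Z - n|%N).
by move=> j Nj; rewrite (borcherds_vanish fA fB lAB) ?scaler0//; lia.
Qed.

(** Both sides satisfy the recursion [borcherds_rec] and agree at m = 0. The
    recursion carries the equality to m > 0. Towards m < 0 it determines a value
    at (m, n) from values at (m + 1, n) and (m, n + 1), and locality makes both
    sides vanish for large n, which starts a downward induction on n. *)
Lemma borcherds_identity A B : mode_field A -> mode_field B -> local A B ->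
  forall m n k v,
  \sum_(j \in [set: nat]) gbin m j *: nprod A B (n + j%:Z) (m + k - j%:Z) v =
  borcherds A B m n k v.
Proof.
move=> fA fB lAB; have [N lN] := lAB.
have okG := borcherds_identity_ok fA fB lAB.
pose G m n k v :=
  \sum_(j \in [set: nat]) gbin m j *: nprod A B (n + j%:Z) (m + k - j%:Z) v.
have GS m n k v : G (m + 1) n k v = G m (n + 1) k v + G m n (k + 1) v.
  rewrite /G fsumS; last exact: okG.
  rewrite [X in _ = _ + X]fsumS; last exact: okG.
  rewrite addrCA; congr (_ + _).
    by rewrite !gbin0 (_ : m + 1 + k = m + (k + 1))//; lia.
  rewrite -fsumD; last 2 first.
  - exact: okG.
  - exact: (finsum_okS (okG (gbin m) n (m + (k + 1)) 0 v)).
  apply: eq_fsum => j.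
  rewrite (_ : n + 1 + j%:Z = n + j.+1%:Z); last by lia.
  rewrite (_ : m + k - j%:Z = m + 1 + k - j.+1%:Z); last by lia.
  rewrite (_ : m + (k + 1) - j.+1%:Z = m + 1 + k - j.+1%:Z); last by lia.
  by rewrite gbin_pascal; module_ring K.
have G_van m n k v : N%:Z <= n -> G m n k v = 0.
  move=> Nn; apply: fsum0 => j.
  by rewrite /nprod (borcherds_vanish fA fB lN) ?scaler0//; lia.
have base n k v : G 0 n k v = borcherds A B 0 n k v.
  rewrite /G (fsum_single (i0 := 0%N)); last first.
    by case=> // j _; rewrite gbin_zero scale0r.
  by rewrite gbin0 scale1r addr0 add0r subr0.
have up (p : nat) n k v : G p%:Z n k v = borcherds A B p%:Z n k v.
  elim: p n k => [|p IH] n k; first exact: base.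
  by rewrite -addn1 PoszD GS borcherds_rec// !IH.
have down (p : nat) n k v : G (- p%:Z) n k v = borcherds A B (- p%:Z) n k v.
  elim: p n k => [|p IH]; first by move=> n k; rewrite oppr0 base.
  apply: (int_downward (N := N%:Z)) => [n Nn k|n IHn k].
    by rewrite G_van// (borcherds_vanish fA fB lN).
  have := GS (- p.+1%:Z) n (k - 1) v.
  have := borcherds_rec (- p.+1%:Z) n (k - 1) v fA fB.
  rewrite (_ : - p.+1%:Z + 1 = - p%:Z); last by lia.
  by rewrite subrK IH IHn => -> /addrI.
move=> m n k v; rewrite -/(G m n k v).
by case: (intP m) => [|p|p]; [exact: base|exact: up|exact: down].
Qed.

Lemma borcherds_linear A B m n k : mode_field A -> mode_field B ->
  linear (borcherds A B m n k).
Proof.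
move=> fA fB c u v; have [[lA _] [lB _]] := (fA, fB).
have ok := borcherds_ok m n k _ fA fB.
rewrite /borcherds fsumZ; last exact: ok.
rewrite -fsumD; last 2 first.
- exact/(finsum_okZ (fun=> c))/ok.
- exact: ok.
apply: eq_fsum => j.
by rewrite !(linD (lA _), linZ (lA _), linD (lB _), linZ (lB _)); module_ring K.
Qed.

Lemma nprod_field A B n : mode_field A -> mode_field B ->
  mode_field (nprod A B n).
Proof.
move=> fA fB; split=> [k|v]; first exact: borcherds_linear.
have [[lA bA] [lB bB]] := (fA, fB).
have [NA AN] := bA v; have [NB BN] := bB v.
(* Only finitely many A_(j)v are nonzero, so one bound serves them all. *)
have [M BM] : exists M : int, forall (j : nat) q, j%:Z < NA -> M <= q ->
    B q (A j%:Z v) = 0.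
  elim: {AN} NA => [|NA [M BM]|NA _]; try by exists 0 => j q; lia.
  have [M' BM'] := bB (A NA%:Z v); exists (Num.max M M') => j q jN.
  rewrite ge_max => /andP[Mq M'q]; have [->|jA] := eqVneq j NA; first exact: BM'.
  by apply: BM => //; move/eqP: jA => jA; lia.
exists (Num.max NB (M + `|NA|%:Z - n)) => k; rewrite ge_max => /andP[NBk Mk].
apply: fsum0 => j; rewrite BN; last by lia.
rewrite (lin0 (lA _)) (_ : B (n + k - j%:Z) (A (0 + j%:Z) v) = 0).
  by rewrite scaler0 subrr scaler0.
rewrite (_ : 0 + j%:Z = j%:Z); last by lia.
case: (ltP j%:Z NA) => jNA; last by rewrite AN// (lin0 (lB _)).
by rewrite BM//; lia.
Qed.

End Locality.

(** * Dong's lemma *)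

Section Dong.
Context {K : numFieldType} {V : lmodType K}.
Implicit Types (A B C : int -> V -> V) (m n k l : int).

Let triple : Type := int * int * int * V.
Let s1 (q : triple) : triple := let: (m, k, l, w) := q in (m + 1, k, l, w).
Let s2 (q : triple) : triple := let: (m, k, l, w) := q in (m, k + 1, l, w).
Let s3 (q : triple) : triple := let: (m, k, l, w) := q in (m, k, l + 1, w).

Let bracket3 A B C (q : triple) : V :=
  let: (m, k, l, w) := q in A m (B k (C l w)) - C l (A m (B k w)).

(** By the Leibniz rule [A(z)B(w), C(x)] = A(z)[B(w), C(x)] + [A(z), C(x)]B(w);
    (w - x)^S kills the first term and (z - x)^R the second. *)
Lemma bracket3_kill A B C (R S : nat) : (forall n, linear (A n)) ->
    local_order R A C -> local_order S B C ->
  iter R (diff s1 s3) (iter S (diff s2 s3) (bracket3 A B C)) = fun=> 0.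
Proof.
move=> lA lAC lBC.
pose p1 (q : triple) : V := let: (m, k, l, w) := q in
  A m (commutator B C w k l).
pose p2 (q : triple) : V := let: (m, k, l, w) := q in
  commutator A C (B k w) m l.
have -> : bracket3 A B C = fun q => 1 *: p1 q + p2 q.
  apply/funext => -[[[m k] l] w] /=; rewrite /commutator (linB (lA _)).
  by module_ring K.
have kill1 : iter S (diff s2 s3) p1 = fun=> 0.
  have -> : iter S (diff s2 s3) p1 = fun q => let: (m, k, l, w) := q in
      A m (iter S (diff shift1 shift2) (commutator_at B C w) (k, l)).
    elim: S {lBC} => [|S IH]; first by apply/funext => -[[[m k] l] w].
    by apply/funext => -[[[m k] l] w]; rewrite /= IH /diff (linB (lA _)).
  by apply/funext => -[[[m k] l] w]; rewrite lBC (lin0 (lA _)).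
have kill2 : iter R (diff s1 s3) p2 = fun=> 0.
  have -> : iter R (diff s1 s3) p2 = fun q => let: (m, k, l, w) := q in
      iter R (diff shift1 shift2) (commutator_at A C (B k w)) (m, l).
    elim: R {lAC} => [|R IH]; first by apply/funext => -[[[m k] l] w].
    by apply/funext => -[[[m k] l] w]; rewrite /= IH.
  by apply/funext => -[[[m k] l] w]; rewrite lAC.
rewrite (@iter_diff_lin _ _ _ _ _ _ (fun=> 1))// kill1.
rewrite (@iter_diff_lin _ _ _ _ _ _ (fun=> 1))// iter_diff0.
have commute T : iter R (diff s1 s3) (iter T (diff s2 s3) p2) =
                 iter T (diff s2 s3) (iter R (diff s1 s3) p2).
  elim: T => //= T <-; elim: R {lAC kill2} (iter T _ _) => //= R IH h.
  by rewrite IH; apply: diffC => -[[[m k] l] w].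
rewrite commute kill2 iter_diff0.
by apply/funext => q; rewrite scaler0 addr0.
Qed.

(** [dong_abstract] applied to the commutator of [borcherds A B m n k] with C_(l).
    The vector on which the operators act is one of the coordinates of g, because
    the exponent obtained must not depend on it. *)
Lemma dong A B C n : mode_field A -> mode_field B -> mode_field C ->
  local A B -> local A C -> local B C -> local (nprod A B n) C.
Proof.
move=> fA fB fC [N lAB] [R lAC] [S lBC]; have [[lA _] [lB _]] := (fA, fB).
have lC := fC.1.
pose point : Type := int * int * int * int * V.
pose z (p : point) : point :=
  let: (m, n, k, l, w) := p in (m + 1, n, k, l, w).
pose y (p : point) : point :=
  let: (m, n, k, l, w) := p in (m, n + 1, k, l, w).
pose w (p : point) : point :=
  let: (m, n, k, l, w) := p in (m, n, k + 1, l, w).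
pose x (p : point) : point :=
  let: (m, n, k, l, w) := p in (m, n, k, l + 1, w).
pose level (p : point) : int := let: (m, n, k, l, w) := p in n.
pose g (p : point) : V := let: (m, n, k, l, w) := p in
  borcherds A B m n k (C l w) - C l (borcherds A B m n k w).
(* (z - x)^R (w - x)^S commutes with the expansion of (z - w)^n and kills it
   term by term. *)
have kill : iter R (diff z x) (iter S (diff w x) g) = fun=> 0.
  pose r1 (j : nat) (p : point) : triple :=
    let: (m, n, k, l, w) := p in (m + n - j%:Z, k + j%:Z, l, w).
  pose r2 (j : nat) (p : point) : triple :=
    let: (m, n, k, l, w) := p in (n + k - j%:Z, m + j%:Z, l, w).
  pose t j p : V := ((-1) ^+ j * gbin (level p) j) *:
    ((- (-1) ^ level p) *: bracket3 B A C (r2 j p) + bracket3 A B C (r1 j p))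
    + 0.
  have gE : g = fun p => \sum_(j \in [set: nat]) t j p.
    apply/funext => -[[[[m n'] k] l] v] /=; rewrite /borcherds.
    rewrite (fsum_lin (lC l)); last exact: (borcherds_ok m n' k v fA fB).
    rewrite -fsumB; last 2 first.
    - exact: (borcherds_ok m n' k (C l v) fA fB).
    - have [s sP] := borcherds_ok m n' k v fA fB; exists s => j /sP->.
      exact: lin0.
    apply: eq_fsum => j; rewrite /t /= (linZ (lC _)) (linB (lC _)).
    by rewrite (linZ (lC _)); module_ring K.
  have tok p : finsum_ok (fun j => t j p).
    case: p => [[[[m n'] k] l] v].
    have ok1 := borcherds_ok m n' k (C l v) fA fB.
    have ok2 : finsum_ok (fun j : nat => C l (((-1) ^+ j * gbin n' j) *:
        (A (m + n' - j%:Z) (B (k + j%:Z) v) -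
         ((-1) ^ n') *: B (n' + k - j%:Z) (A (m + j%:Z) v)))).
      have [s sP] := borcherds_ok m n' k v fA fB; exists s => j /sP->.
      exact: lin0.
    apply: finsum_ok_ext (finsum_okB ok1 ok2) => j.
    rewrite /t /= (linZ (lC _)) (linB (lC _)).
    by rewrite (linZ (lC _)); module_ring K.
  rewrite gE iter_diff_fsum//.
  have killt j : iter R (diff z x) (iter S (diff w x) (t j)) = fun=> 0.
    have zl (c : int -> K) p : c (level (z p)) = c (level p).
      by case: p => [[[[m n'] k] l] v].
    have wl (c : int -> K) p : c (level (w p)) = c (level p).
      by case: p => [[[[m n'] k] l] v].
    have xl (c : int -> K) p : c (level (x p)) = c (level p).
      by case: p => [[[[m n'] k] l] v].
    rewrite /t.
    pose c1 (n : int) : K := (-1) ^+ j * gbin n j.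
    pose c2 (n : int) : K := - (-1) ^ n.
    rewrite (@iter_diff_lin _ _ _ w x S (fun p => c1 (level p)) _ (fun=> 0))//.
    rewrite (@iter_diff_lin _ _ _ z x R (fun p => c1 (level p)))//.
    rewrite !iter_diff0.
    rewrite (@iter_diff_lin _ _ _ w x S (fun p => c2 (level p)))//.
    rewrite (@iter_diff_lin _ _ _ z x R (fun p => c2 (level p)))//.
    rewrite (@iter_diff_comp _ _ _ _ w x s1 s3 (r2 j)); last 2 first.
    - by move=> [[[[m n'] k] l] v]; congr (_, _, _, _); lia.
    - by move=> [[[[m n'] k] l] v].
    rewrite (@iter_diff_comp _ _ _ _ z x s2 s3 (r2 j)); last 2 first.
    - by move=> [[[[m n'] k] l] v]; congr (_, _, _, _); lia.
    - by move=> [[[[m n'] k] l] v].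
    rewrite (@iter_diff_comp _ _ _ _ w x s2 s3 (r1 j)); last 2 first.
    - by move=> [[[[m n'] k] l] v]; congr (_, _, _, _); lia.
    - by move=> [[[[m n'] k] l] v].
    rewrite (@iter_diff_comp _ _ _ _ z x s1 s3 (r1 j)); last 2 first.
    - by move=> [[[[m n'] k] l] v]; congr (_, _, _, _); lia.
    - by move=> [[[[m n'] k] l] v].
    rewrite bracket3_kill//.
    have commute T h : iter R (diff s2 s3) (iter T (diff s1 s3) h) =
                 iter T (diff s1 s3) (iter R (diff s2 s3) h).
      elim: T => //= T <-; elim: (R) (iter T _ _) => //= R' IH h'.
      by rewrite IH; apply: diffC => -[[[m k] l] v].
    rewrite commute bracket3_kill//.
    by apply/funext => p; rewrite !scaler0 !addr0 scaler0.
  rewrite iter_diff_fsum; last first.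
    have okN M p : finsum_ok (fun j => iter M (diff w x) (t j) p).
      elim: M p => //= M IH p; exact: finsum_okB.
    exact: okN.
  by apply/funext => p; apply: fsum0 => j; rewrite killt.
have pt (P : point -> Prop) : (forall m n k l v, P (m, n, k, l, v)) ->
    forall p, P p by move=> Pp [[[[m n'] k] l] v].
have [| |M kM] := dong_abstract
  (pt _ (fun _ _ _ _ _ => erefl) : forall p, z (y p) = y (z p))
  (pt _ (fun _ _ _ _ _ => erefl) : forall p, z (w p) = w (z p))
  (pt _ (fun _ _ _ _ _ => erefl) : forall p, z (x p) = x (z p))
  (pt _ (fun _ _ _ _ _ => erefl) : forall p, y (w p) = w (y p))
  (pt _ (fun _ _ _ _ _ => erefl) : forall p, y (x p) = x (y p))
  (pt _ (fun _ _ _ _ _ => erefl) : forall p, w (x p) = x (w p))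
  (pt _ (fun _ _ _ _ _ => erefl) : forall p, level (z p) = level p)
  (pt _ (fun _ _ _ _ _ => erefl) : forall p, level (w p) = level p)
  (pt _ (fun _ _ _ _ _ => erefl) : forall p, level (x p) = level p)
  (pt _ (fun _ _ _ _ _ => erefl) : forall p, level (y p) = level p + 1)
  (N := N%:Z) (g := g) (R := R) (S := S) _ _ kill n.
- case=> [[[[m n'] k] l] v] /=.
  by rewrite !borcherds_rec// (linD (lC _)); module_ring K.
- case=> [[[[m n'] k] l] v] /= nN.
  by rewrite !(borcherds_vanish fA fB lAB)// (lin0 (lC _)) subr0.
exists M => v; apply/funext => -[k l].
have := kM (0, n, k, l, v) (lexx _); move=> <-.
have -> : commutator_at (nprod A B n) C v = fun q => g (0, n, q.1, q.2, v) by [].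
by rewrite (@iter_diff_comp _ _ _ _ _ _ w x (fun q => (0, n, q.1, q.2, v))).
Qed.

End Dong.

(** * Translation covariance and uniqueness *)

Section Covariance.
Context {K : numFieldType} {V : lmodType K}.
Implicit Types (A B C : int -> V -> V) (m n k l : int).
Variable D : V -> V.
Hypothesis lD : linear D.

(** [D, A(z)] = A'(z). *)
Definition covariant A :=
  forall n v, D (A n v) - A n (D v) = - (n%:~R *: A (n - 1) v).

(** The derivations d/dz and d/dw act on z^m w^k (z - w)^n; their actions on
    (z - w)^n cancel, which is the identity (j + 1) C(n, j + 1) = (n - j) C(n, j). *)
Lemma covariant_bsum A B n p q v : mode_field A -> mode_field B ->
    covariant A -> covariant B ->
  D (bsum (fun p q => A p (B q v)) n p q) -
  bsum (fun p q => A p (B q (D v))) n p q =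
  - ((p - n)%:~R *: bsum (fun p q => A p (B q v)) n (p - 1) q)
  - q%:~R *: bsum (fun p q => A p (B q v)) n p (q - 1).
Proof.
move=> fA fB cA cB; have lA := fA.1.
have ok := antidiagonal_field v fA fB.
have okD := antidiagonal_field (D v) fA fB.
pose c j : K := (-1) ^+ j * gbin n j.
pose T1 (j : nat) := A (p - 1 - j%:Z) (B (q + j%:Z) v).
pose T2 (j : nat) := A (p - j%:Z) (B (q - 1 + j%:Z) v).
have ok1 (e : nat -> K) : finsum_ok (fun j => e j *: T1 j).
  by apply: finsum_okZ; exact: ok.
have ok2 (e : nat -> K) : finsum_ok (fun j => e j *: T2 j).
  by apply: finsum_okZ; exact: ok.
rewrite /bsum (fsum_lin lD); last exact/finsum_okZ/ok.
rewrite -fsumB; last 2 first.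
- have [s sP] := ok p q; exists s => j /sP->.
  by rewrite scaler0 (lin0 lD).
- exact/finsum_okZ/okD.
rewrite !fsumZ; last 2 first.
- exact: ok2.
- exact: ok1.
transitivity (\sum_(j \in [set: nat])
    (- ((c j * (p - j%:Z)%:~R) *: T1 j) - (c j * (q + j%:Z)%:~R) *: T2 j)).
  apply: eq_fsum => j; rewrite (linZ lD) -scalerBr -/(c j).
  have := cA (p - j%:Z) (B (q + j%:Z) v).
  have := cB (q + j%:Z) v => /(congr1 (A (p - j%:Z))).
  rewrite (linB (lA _)) (linN (lA _)) (linZ (lA _)) => /eqP.
  rewrite subr_eq => /eqP E1 /eqP; rewrite subr_eq => /eqP E2.
  rewrite E2 E1 (_ : p - j%:Z - 1 = p - 1 - j%:Z); last by lia.
  rewrite (_ : q + j%:Z - 1 = q - 1 + j%:Z); last by lia.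
  by rewrite -/(T1 j) -/(T2 j); module_ring K.
transitivity (\sum_(j \in [set: nat])
  ((- (p - n)%:~R * c j) *: T1 j + (- q%:~R * c j) *: T2 j)
  + (\sum_(j \in [set: nat]) (- (c j * (n - j%:Z)%:~R)) *: T1 j -
     \sum_(j \in [set: nat]) ((c j * j%:R) *: T2 j))).
  rewrite -fsumB; [|exact: ok1|exact: ok2].
  rewrite -fsumD; last 2 first.
  - by apply: finsum_okD; [exact: ok1|exact: ok2].
  - by apply: finsum_okB; [exact: ok1|exact: ok2].
  apply: eq_fsum => j; rewrite !rmorphD /= !rmorphN /= -!pmulrn.
  by module_ring K.
have -> : \sum_(j \in [set: nat]) ((c j * j%:R) *: T2 j) =
          \sum_(j \in [set: nat]) (- (c j * (n - j%:Z)%:~R)) *: T1 j.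
  rewrite fsumS; last exact: ok2.
  rewrite mulr0 scale0r add0r; apply: eq_fsum => j.
  have -> : T2 j.+1 = T1 j by rewrite /T1 /T2; congr (A _ (B _ _)); lia.
  congr (_ *: _).
  rewrite /c -mulrA [_ * j.+1%:R]mulrC gbinS exprS; ring.
rewrite subrr addr0 fsumN; last exact: (finsum_okZ (fun=> _) (ok1 c)).
rewrite -fsumB; last 2 first.
- exact/finsum_okN/(finsum_okZ (fun=> _) (ok1 c)).
- exact: (finsum_okZ (fun=> _) (ok2 c)).
by apply: eq_fsum => j; rewrite -/(T1 j) -/(T2 j) -/(c j); module_ring K.
Qed.

Lemma nprod_covariant A B n : mode_field A -> mode_field B ->
  covariant A -> covariant B -> covariant (nprod A B n).
Proof.
move=> fA fB cA cB k v; rewrite /nprod !borcherdsE// !add0r.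
rewrite (linB lD) (linZ lD).
have := covariant_bsum n n k v fA fB cA cB => /eqP.
rewrite subr_eq => /eqP->.
have := covariant_bsum n (n + k) 0 v fB fA cB cA => /eqP.
rewrite subr_eq => /eqP->.
rewrite subrr.
rewrite (_ : n + k - n = k); last by lia.
rewrite (_ : n + k - 1 = n + (k - 1)); last by lia.
by rewrite !scale0r; module_ring K.
Qed.

Lemma covariant_lin c A B : covariant A -> covariant B ->
  (forall n, linear (A n)) -> (forall n, linear (B n)) ->
  covariant (fun n v => c *: A n v + B n v).
Proof.
move=> cA cB lA lB n v; rewrite (linD lD) (linZ lD).
have /eqP := cA n v; rewrite subr_eq => /eqP->.
have /eqP := cB n v; rewrite subr_eq => /eqP->.
by module_ring K.
Qed.

(** The identity operator as a constant field: its only mode is the one of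
    index -1. *)
Definition id_mode (n : int) (v : V) : V := if n == -1 then v else 0.

Lemma id_mode_field : mode_field id_mode.
Proof.
split=> [n c u v|v]; first by rewrite /id_mode; case: eqP; rewrite ?scaler0 ?addr0.
by exists 0 => n n0; rewrite /id_mode; case: eqP => // nE; lia.
Qed.

Lemma id_mode_covariant : covariant id_mode.
Proof.
move=> n v; rewrite /id_mode; case: (eqVneq n (-1)) => [->|n1] /=.
  by rewrite subrr scaler0 oppr0.
rewrite (lin0 lD) subrr; case: eqP => [n0|_]; last by rewrite scaler0 oppr0.
by rewrite (_ : n = 0) ?scale0r ?oppr0//; lia.
Qed.

Lemma id_mode_local C : (forall n, linear (C n)) -> local id_mode C.
Proof.
move=> lC; exists 0%N => v; apply/funext => -[m k] /=.
rewrite /commutator_at /commutator /id_mode /=; case: eqP => _.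
  by rewrite subrr.
by rewrite (lin0 (lC _)) subr0.
Qed.

Section Vacuum.
Variable vac : V.
Hypothesis D_vac : D vac = 0.

(** [D, A_(n)] = - n A_(n-1) applied to the vacuum; the factor n is invertible. *)
Lemma covariant_vac_step A n : mode_field A -> covariant A -> n != 0 ->
  A n vac = 0 -> A (n - 1) vac = 0.
Proof.
move=> [lA _] cA n0 An; have := cA n vac.
rewrite An D_vac (lin0 lD) (lin0 (lA _)) subrr => /esym/eqP.
by rewrite oppr_eq0 scaler_eq0 intr_eq0 (negbTE n0) => /eqP.
Qed.

(** A_(n) kills the vacuum for large n, and the previous step descends from there
    down to n = 0, where it stops. *)
Lemma covariant_creation A : mode_field A -> covariant A ->
  forall n, 0 <= n -> A n vac = 0.
Proof.
move=> fA cA; have [N AN] := fA.2 vac.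
apply: (int_downward (N := N)) => [n /AN//|n IHn n0].
by rewrite (_ : n = n + 1 - 1) ?covariant_vac_step ?IHn//; lia.
Qed.

Lemma covariant_vac0 A : mode_field A -> covariant A -> A (-1) vac = 0 ->
  forall n, A n vac = 0.
Proof.
move=> fA cA A1 n; case: (leP 0 n) => n0; first exact: covariant_creation.
have [d ->] : exists d : nat, n = -1 - d%:Z by exists (absz (n + 1)); lia.
elim: d {n n0} => [|d IH]; first by rewrite subr0.
rewrite (_ : -1 - d.+1%:Z = -1 - d%:Z - 1); last by lia.
by apply: covariant_vac_step => //; apply/eqP; lia.
Qed.

(** The creation property removes every term except A_(n) B_(-1). *)
Lemma nprod_vac A B n : mode_field A -> mode_field B ->
    covariant A -> covariant B ->
  nprod A B n (-1) vac = A n (B (-1) vac).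
Proof.
move=> fA fB cA cB; have [[lA _] [lB _]] := (fA, fB).
rewrite /nprod /borcherds (fsum_single (i0 := 0%N)); last first.
  case=> // j _; rewrite (covariant_creation fA cA (n := 0 + j.+1%:Z))//.
  rewrite (lin0 (lB _)) (covariant_creation fB cB); last by lia.
  by rewrite (lin0 (lA _)) scaler0 subrr scaler0.
rewrite gbin0 mulr1 scale1r (covariant_creation fA cA); last by lia.
rewrite (lin0 (lB _)) scaler0 subr0; congr (A _ (B _ _)); lia.
Qed.

(** If (z - w) h = 0, then h is constant along antidiagonals, on each of which it
    vanishes eventually. *)
Lemma bounded_diff_eq0 (N : nat) (M : int) (h : int * int -> V) :
    (forall m k, M <= k -> h (m, k) = 0) ->
    iter N (diff shift1 shift2) h = (fun=> 0) ->
  h = fun=> 0.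
Proof.
move=> hM; elim: N => //= N IH h0; apply: IH.
have hNM (m k : int) : M <= k -> iter N (diff shift1 shift2) h (m, k) = 0.
  elim: N {h0} m k => [|N IHN] m k Mk; first exact: hM.
  by rewrite /= /diff /shift1 /shift2 /= !IHN ?subrr//; lia.
set g := iter N _ h in h0 hNM *.
apply/funext => -[m k]; move: k m; apply: (int_downward (N := M)).
  by move=> k Mk m; exact: hNM.
move=> k IHk m; have := congr1 (fun f => f (m - 1, k)) h0.
by rewrite /diff /shift1 /shift2 /= IHk subr0 subrK.
Qed.

(** Goddard's argument: if A(z)v = 0, locality gives
    (z - w)^N A(z) C(w) v = 0, and A(z) C(w) v has only finitely many positive
    modes in w, so that (z - w)^N can be cancelled. *)
Lemma local_kill A C v : mode_field A -> mode_field C -> local A C ->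
  (forall n, A n v = 0) -> forall k n, A n (C k v) = 0.
Proof.
move=> [lA _] [lC bC] [N lAC] Av k n; have [M CM] := bC v.
have := bounded_diff_eq0 (N := N) (M := M) (h := commutator_at A C v) _ (lAC v).
move=> /(_ _)/(congr1 (fun f => f (n, k))); rewrite /commutator_at /commutator /=.
rewrite Av (lin0 (lC _)) subr0; apply.
by move=> m k' Mk; rewrite CM// Av (lin0 (lC _)) subr0 (lin0 (lA _)).
Qed.

End Vacuum.
End Covariance.

(** * The vertex algebra generated by local fields *)

Section ModesAndPowers.
Context {K : numFieldType} {V : lmodType K}.
Implicit Types (A B : int -> V -> V).

Lemma va_modeK A : va_mode (va_mode A) = A.
Proof. by apply/funext => n; rewrite /va_mode; congr A; lia. Qed.

Lemma mode_field_is_field A : mode_field A -> is_field (va_mode A).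
Proof.
move=> [lA bA]; split=> [k|v]; first exact: lA.
have [N AN] := bA v; exists (- N) => k kN; apply: AN; lia.
Qed.

Lemma is_field_mode_field A : is_field A -> mode_field (va_mode A).
Proof.
move=> [lA bA]; split=> [k|v]; first exact: lA.
have [N AN] := bA v; exists (- N) => k kN; apply: AN; lia.
Qed.

Lemma iter_diff_binomial (N : nat) (h : int * int -> V) m k :
  iter N (diff shift1 shift2) h (m, k) =
  \sum_(i < N.+1) ((-1) ^+ i * 'C(N, i)%:R : K) *:
    h (m + N%:Z - i%:Z, k + i%:Z).
Proof.
elim: N m k => [|N IH] m k.
  rewrite big_ord_recl big_ord0 addr0 /= bin0 mulr1 scale1r.
  by congr (h (_, _)); lia.
rewrite /= /diff /shift1 /shift2 /= !IH.
have widen (g : nat -> V) : \sum_(i < N.+1) ((-1) ^+ i * 'C(N, i)%:R : K) *: g i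
    = \sum_(i < N.+2) ((-1) ^+ i * 'C(N, i)%:R : K) *: g i.
  by rewrite [RHS]big_ord_recr /= bin_small// mulr0 scale0r addr0.
rewrite (widen (fun i : nat => h (m + 1 + N%:Z - i%:Z, k + i%:Z))).
rewrite big_ord_recl [RHS]big_ord_recl -addrA /= !bin0; congr (_ + _).
  by congr (_ *: h (_, _)); lia.
rewrite -sumrB; apply: eq_bigr => i _; rewrite /bump /= !add1n binS natrD.
rewrite (_ : m + 1 + N%:Z - i.+1%:Z = m + N%:Z - i%:Z); last by lia.
rewrite (_ : m + N.+1%:Z - i.+1%:Z = m + N%:Z - i%:Z); last by lia.
rewrite (_ : k + 1 + i%:Z = k + i.+1%:Z); last by lia.
by rewrite exprS; module_ring K.
Qed.

Lemma local_mutually_local A B : local A B ->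
  mutually_local (va_mode A) (va_mode B).
Proof.
move=> [N lAB]; exists N => k l v.
transitivity (iter N (diff shift1 shift2) (commutator_at A B v)
    (- k - 1, - l - 1)); last by rewrite lAB.
rewrite iter_diff_binomial; apply: eq_bigr => i _; congr (_ *: _).
rewrite /commutator_at /commutator /va_mode /=.
rewrite (_ : - (k - N%:Z + i%:Z) - 1 = - k - 1 + N%:Z - i%:Z); last by lia.
by rewrite (_ : - (l - i%:Z) - 1 = - l - 1 + i%:Z)//; lia.
Qed.

Lemma virasoro_action_sum (c d : K) (S T : int -> V -> V) :
  virasoro_action c S -> virasoro_action d T -> commuting_actions S T ->
  virasoro_action (c + d) (S + T).
Proof.
move=> [lS SS] [lT TT] ST.
have E n v : vir_mode (S + T) n v = vir_mode S n v + vir_mode T n v by [].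
split=> [n x v w|m n v]; first by rewrite !E (lS n x v w) (lT n x v w); module_ring K.
rewrite !E (linD (lS m)) (linD (lT m)) (linD (lS n)) (linD (lT n)).
have := SS m n v => /eqP; rewrite subr_eq => /eqP->.
have := TT m n v => /eqP; rewrite subr_eq => /eqP->.
rewrite (ST m n v) -(ST n m v).
by case: eqP => _; module_ring K.
Qed.

End ModesAndPowers.

Section Reconstruction.
Context {K : numFieldType} {V : lmodType K}.
Variables (vac : V) (D : V -> V) (G : (int -> V -> V) -> Prop).
Hypothesis lD : linear D.
Hypothesis D_vac : D vac = 0.
Hypothesis G_field : forall A, G A -> mode_field A.
Hypothesis G_covariant : forall A, G A -> covariant D A.
Hypothesis G_local : forall A B, G A -> G B -> local A B.
Hypothesis G_generates : forall W : V -> Prop,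
  (forall c u v, W u -> W v -> W (c *: u + v)) -> W vac ->
  (forall A n v, G A -> W v -> W (A n v)) -> forall v, W v.
Implicit Types (A B C : int -> V -> V) (m n k : int).

(** The fields of the vertex algebra will be exactly these ones. *)
Definition admissible A :=
  [/\ mode_field A, covariant D A & forall C, G C -> local A C].

Lemma field_lin c A B : mode_field A -> mode_field B ->
  mode_field (fun n v => c *: A n v + B n v).
Proof.
move=> [lA bA] [lB bB]; split=> [n a u v|v].
  by rewrite (lA n) (lB n); module_ring K.
have [N AN] := bA v; have [M BM] := bB v; exists (Num.max N M) => n.
by rewrite ge_max => /andP[Nn Mn]; rewrite AN// BM// scaler0 addr0.
Qed.

Lemma admissible_lin c A B : admissible A -> admissible B ->
  admissible (fun n v => c *: A n v + B n v).
Proof.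
move=> [fA cA lA] [fB cB lB]; split.
- exact: field_lin.
- by apply: covariant_lin => //; [exact: fA.1|exact: fB.1].
- by move=> C GC; apply: local_lin; [exact: (G_field GC).1|exact: lA|exact: lB].
Qed.

Lemma admissible_scale c A : admissible A -> admissible (fun n v => c *: A n v).
Proof.
move=> adA; have := admissible_lin (c - 1) adA adA; congr admissible.
by apply/funext => n; apply/funext => v; module_ring K.
Qed.

Lemma admissible_id : admissible id_mode.
Proof.
split; [exact: id_mode_field|exact: id_mode_covariant|move=> C GC].
by apply: id_mode_local; exact: (G_field GC).1.
Qed.

Lemma admissible_gen A : G A -> admissible A.
Proof. by move=> GA; split; [exact: G_field|exact: G_covariant|move=> C; exact: G_local]. Qed.

(** The difference of the two fields kills the vacuum, hence by [local_kill]
    everything that the generators produce from it. *)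
Lemma admissible_unique A B : admissible A -> admissible B ->
  A (-1) vac = B (-1) vac -> A = B.
Proof.
move=> adA adB AB.
have [fC cC locC] := admissible_lin (-1) adA adB.
set C := fun n v => _ in fC cC locC.
have C0 : forall v n, C n v = 0.
  apply: G_generates.
  - by move=> c u v Cu Cv n; rewrite (fC.1 n) Cu Cv scaler0 addr0.
  - by apply: (covariant_vac0 lD D_vac fC cC); rewrite /C AB scaleN1r addNr.
  - move=> A' n v GA' Cv n'; apply: local_kill Cv _ _ => //.
      exact: G_field.
    exact: locC.
apply/funext => n; apply/funext => v; have /eqP := C0 v n.
by rewrite /C scaleN1r addrC subr_eq0 => /eqP.
Qed.

(** Products are allowed only with a generator on the left: then the locality of A
    and B that Dong's lemma requires in order to treat A_(n)B is already part of
    the induction hypothesis on B. *)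
Inductive generated : (int -> V -> V) -> Prop :=
  | generated_id : generated id_mode
  | generated_lin c A B : generated A -> generated B ->
      generated (fun n v => c *: A n v + B n v)
  | generated_nprod A B n : G A -> generated B -> generated (nprod A B n).

Lemma generated_admissible A : generated A -> admissible A.
Proof.
elim=> {A} [|c A B _ adA _ adB|A B n GA _ [fB cB lB]].
- exact: admissible_id.
- exact: admissible_lin.
- have fA := G_field GA; have cA := G_covariant GA; split.
  + exact: nprod_field.
  + exact: nprod_covariant.
  + move=> C GC; apply: dong => //; [exact: G_field|exact/local_sym/lB| |].
      exact: G_local.
    exact: lB.
Qed.

Lemma generated_surj v : exists A, generated A /\ A (-1) vac = v.
Proof.
move: v; apply: G_generates.
- move=> c u v [A [gA <-]] [B [gB <-]].
  by exists (fun n v => c *: A n v + B n v); split=> //; exact: generated_lin.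
- by exists id_mode; split; [exact: generated_id|rewrite /id_mode eqxx].
- move=> A n v GA [B [gB <-]]; exists (nprod A B n); split.
    exact: generated_nprod.
  have [fB cB _] := generated_admissible gB.
  by rewrite (nprod_vac lD D_vac)//; [exact: G_field|exact: G_covariant].
Qed.

(** Some generated field creates the same vector as A, and uniqueness applies. *)
Lemma admissible_generated A : admissible A -> generated A.
Proof.
move=> adA; have [B [gB BA]] := generated_surj (A (-1) vac).
by rewrite (admissible_unique adA (generated_admissible gB)).
Qed.

(** Being local to the generators implies being local to everything built from
    them, by Dong's lemma. *)
Lemma admissible_local A B : admissible A -> admissible B -> local A B.
Proof.
move=> /admissible_generated gA adB; elim: gA => {A} [|c A A' _ lA _ lA'|A A' n GA gA' lA'].
- by apply: id_mode_local; have [[]] := adB.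
- by apply: local_lin; have [[]] := adB.
- have [fA' _ locA'] := generated_admissible gA'; have [fB _ locB] := adB.
  by apply: dong => //; [exact: G_field|exact/local_sym/locA'
                        |exact/local_sym/locB].
Qed.

Lemma admissible_nprod A B n : admissible A -> admissible B ->
  admissible (nprod A B n).
Proof.
move=> adA adB; have [[fA cA lA] [fB cB lB]] := (adA, adB); split.
- exact: nprod_field.
- exact: nprod_covariant.
- move=> C GC; apply: dong => //; [exact: G_field|exact: admissible_local
    |exact: lA|exact: lB].
Qed.

Lemma state_field_exists v : exists A, admissible A /\ A (-1) vac = v.
Proof.
by have [A [gA <-]] := generated_surj v; exists A; split=> //;
  exact: generated_admissible.
Qed.

Definition state_field v : int -> V -> V := projT1 (cid (state_field_exists v)).

Lemma state_field_admissible v : admissible (state_field v).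
Proof. by rewrite /state_field; case: cid => A []. Qed.

Lemma state_field_vac v : state_field v (-1) vac = v.
Proof. by rewrite /state_field; case: cid => A []. Qed.

Lemma state_fieldE A : admissible A -> state_field (A (-1) vac) = A.
Proof.
move=> adA; apply: admissible_unique => //; first exact: state_field_admissible.
exact: state_field_vac.
Qed.

Lemma state_field_linear : linear state_field.
Proof.
move=> c u v.
have ad := admissible_lin c (state_field_admissible u) (state_field_admissible v).
by rewrite -[RHS](state_fieldE ad) !state_field_vac.
Qed.

(** Both fields are admissible and create u_(n)v. *)
Lemma state_field_nprod u v n :
  state_field (state_field u n v) = nprod (state_field u) (state_field v) n.
Proof.
have [adu adv] := (state_field_admissible u, state_field_admissible v).
have [[fu cu _] [fv cv _]] := (adu, adv).
rewrite -[RHS](state_fieldE (admissible_nprod n adu adv)).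
by rewrite (nprod_vac lD D_vac)// state_field_vac.
Qed.

Let Y v := va_mode (state_field v).

Fact Y_linear : linear Y.
Proof. by move=> c u v; rewrite /Y state_field_linear. Qed.

Fact Y_field v : is_field (Y v).
Proof. by apply: mode_field_is_field; have [] := state_field_admissible v. Qed.

Fact Y_locality u v : mutually_local (Y u) (Y v).
Proof.
by apply/local_mutually_local/admissible_local; exact: state_field_admissible.
Qed.

Fact Y_vac : Y vac = fconst idfun.
Proof.
rewrite /Y -[X in state_field X]/(if -1 == -1 :> int then vac else 0).
rewrite -/(id_mode (-1) vac) state_fieldE; last exact: admissible_id.
apply/funext => k; apply/funext => v; rewrite /va_mode /id_mode /fconst.
by rewrite (_ : (- k - 1 == -1) = (k == 0))//; lia.
Qed.

Fact Y_creation_reg v k : k < 0 -> Y v k vac = 0.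
Proof.
move=> k0; have [fv cv _] := state_field_admissible v.
by apply: (covariant_creation lD D_vac fv cv); lia.
Qed.

Fact Y_creation v : Y v 0 vac = v.
Proof. exact: state_field_vac. Qed.

Fact Y_translation v k w : D (Y v k w) - Y v k (D w) = fderiv (Y v) k w.
Proof.
have [_ cv _] := state_field_admissible v.
rewrite cv /fderiv /Y /va_mode -scaleNr -mulrNz.
rewrite (_ : - (k + 1) - 1 = - k - 1 - 1); last by lia.
by congr (_%:~R *: _); lia.
Qed.

Definition reconstruction : vertex_algebra V :=
  VertexAlgebra Y_linear Y_field lD Y_locality Y_vac Y_creation_reg Y_creation
    D_vac Y_translation.

Lemma reconstructionE A : admissible A ->
  va_Y reconstruction (A (-1) vac) = va_mode A.
Proof. by move=> adA; rewrite /= /Y state_fieldE. Qed.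

Lemma reconstruction_jacobi u :
  jacobi_identity reconstruction (va_Y reconstruction u).
Proof.
move=> m n k v w; rewrite /= /Y !va_modeK.
have [fu _ _] := state_field_admissible u.
have [fv _ _] := state_field_admissible v.
rewrite -[RHS]/(borcherds (state_field u) (state_field v) m n k w).
rewrite -(borcherds_identity fu fv)//; last first.
  by apply: admissible_local; exact: state_field_admissible.
by apply: eq_fsum => j; rewrite va_modeK state_field_nprod.
Qed.

(** A' = A_(-2)1, so that derivatives need no separate proof of locality. *)
Lemma nprod_idN2 A : mode_field A ->
  nprod A id_mode (-2) = fun n v => - (n%:~R *: A (n - 1) v).
Proof.
move=> [lA bA]; apply/funext => k; apply/funext => v.
rewrite /nprod /borcherds /id_mode.
have [k0|k0|->] := ltgtP k 0.
- rewrite (fsum_single (i0 := absz (k + 1))) => [|j jk].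
    rewrite gbinN2 mulrA -expr2 sqrr_sign mul1r.
    rewrite [X in if X then v else 0](_ : _ = true); last by lia.
    rewrite [X in if X then _ else 0](_ : _ = false); last by lia.
    rewrite scaler0 subr0 -scaleNr pmulrn -mulrNz.
    by congr (_%:~R *: A _ _); lia.
  rewrite [X in if X then v else 0](_ : _ = false); last by lia.
  rewrite [X in if X then _ else 0](_ : _ = false); last by lia.
  by rewrite (lin0 (lA _)) scaler0 subrr scaler0.
- rewrite (fsum_single (i0 := absz (k - 1))) => [|j jk].
    rewrite gbinN2 mulrA -expr2 sqrr_sign mul1r.
    rewrite [X in if X then v else 0](_ : _ = false); last by lia.
    rewrite [X in if X then _ else 0](_ : _ = true); last by lia.
    rewrite (lin0 (lA _)) sub0r scalerN pmulrn.
    rewrite -[_ ^ (-2)]/(((-1) ^+ 2)^-1) sqrrN expr1n invr1 scale1r.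
    by congr (- (_%:~R *: A _ _)); lia.
  rewrite [X in if X then v else 0](_ : _ = false); last by lia.
  rewrite [X in if X then _ else 0](_ : _ = false); last by lia.
  by rewrite (lin0 (lA _)) scaler0 subrr scaler0.
- rewrite scale0r oppr0; apply: fsum0 => j.
  rewrite (_ : (0 + j%:Z == -1) = false); last by lia.
  rewrite (_ : (-2 + 0 - j%:Z == -1) = false); last by lia.
  by rewrite (lin0 (lA _)) scaler0 subrr scaler0.
Qed.

Lemma admissible_deriv A : admissible A ->
  admissible (fun n v => - (n%:~R *: A (n - 1) v)).
Proof.
move=> adA; have [fA _ _] := adA; rewrite -nprod_idN2//.
exact/admissible_nprod/admissible_id.
Qed.

Lemma state_field_D v :
  state_field (D v) = fun n w => - (n%:~R *: state_field v (n - 1) w).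
Proof.
have adv := state_field_admissible v; have [fv cv _] := adv.
rewrite -[RHS](state_fieldE (admissible_deriv adv)); congr state_field.
have := cv (-1) vac; rewrite state_field_vac D_vac (lin0 (fv.1 _)) subr0.
by move=> ->.
Qed.

Lemma reconstruction_D v :
  va_Y reconstruction (D v) = fderiv (va_Y reconstruction v).
Proof.
apply/funext => k; apply/funext => w.
rewrite /= /Y state_field_D /fderiv /va_mode -scaleNr -mulrNz.
rewrite (_ : - (k + 1) - 1 = - k - 1 - 1); last by lia.
by congr (_%:~R *: _); lia.
Qed.

(** The Borcherds identity with n = 0. *)
Lemma admissible_commutator A B m k w : admissible A -> admissible B ->
  A m (B k w) - B k (A m w) =
  \sum_(j \in [set: nat])
     gbin m j *: state_field (A j%:Z (B (-1) vac)) (m + k - j%:Z) w.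
Proof.
move=> adA adB; have [[fA cA _] [fB cB _]] := (adA, adB).
rewrite -[LHS](borcherds0 m k w fA fB) -borcherds_identity//; last first.
  exact: admissible_local.
apply: eq_fsum => j; rewrite -(nprod_vac lD D_vac j%:Z fA fB cA cB).
by rewrite state_fieldE ?add0r//; exact: admissible_nprod.
Qed.

Lemma vir_mode_va_mode A n : vir_mode (va_mode A) n = A (n + 1).
Proof. by rewrite /vir_mode /va_mode; congr A; lia. Qed.

Lemma state_field0 n w : state_field 0 n w = 0.
Proof. by rewrite (lin0 state_field_linear). Qed.

Lemma commuting_of_ope A B : admissible A -> admissible B ->
  (forall n, 0 <= n -> A n (B (-1) vac) = 0) ->
  commuting_actions (va_mode A) (va_mode B).
Proof.
move=> adA adB AB m n v; rewrite !vir_mode_va_mode; apply/eqP.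
rewrite -subr_eq0 (admissible_commutator _ _ _ adA adB); apply/eqP; apply: fsum0 => j.
by rewrite AB// state_field0 scaler0.
Qed.

(** In the commutator formula only u_(0)u, u_(1)u and u_(3)u contribute, and
    C(m + 1, 3) = (m^3 - m) / 6 produces the central term. *)
Lemma virasoro_of_ope (c : K) A (u := A (-1) vac) : admissible A ->
  A 0 u = D u -> A 1 u = 2 *: u -> A 2 u = 0 -> A 3 u = (c / 2) *: vac ->
  (forall n, 4 <= n -> A n u = 0) ->
  virasoro_action c (va_mode A).
Proof.
move=> adA A0 A1 A2 A3 A4; have [fA _ _] := adA.
split=> [n|m n v]; first by rewrite vir_mode_va_mode; exact: fA.1.
rewrite !vir_mode_va_mode (admissible_commutator _ _ _ adA adA).
rewrite (@fsum_ord _ _ _ 4) => [|j j4]; last first.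
  by rewrite A4 ?state_field0 ?scaler0//; lia.
rewrite !big_ord_recl big_ord0 addr0 /bump /= A0 A1 A2 A3.
rewrite state_field_D !(linZ state_field_linear) state_field0 scaler0 add0r.
rewrite state_fieldE//.
have -> : state_field vac = id_mode.
  by rewrite -(state_fieldE admissible_id).
rewrite -[(2 *: A) _ _]/(2 *: A _ _) -[(_ *: id_mode) _ _]/(_ *: id_mode _ _).
rewrite gbin1 gbin3.
rewrite gbin0 /bump /= (_ : m + 1 + (n + 1) - 1%N%:Z = m + n + 1); last by lia.
rewrite /id_mode (_ : (m + 1 + (n + 1) - _ == -1) = (m + n == 0)); last first.
  by rewrite /=; lia.
have E : (m - n)%:~R = - (m + 1 + (n + 1))%:~R + 2 * (m + 1)%:~R :> K.
  by rewrite !rmorphD /= rmorphN; ring.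
have -> : (m ^+ 3 - m)%:~R = ((m + 1) * (m + 1 - 1) * (m + 1 - 2))%:~R :> K.
  by congr (_%:~R); ring.
by rewrite E; case: eqP => _; module_eq K; field.
Qed.
End Reconstruction.

(** * Stress tensors built from a current and a vertex operator *)

Section Sugawara.
Context {K : numFieldType} {V : lmodType K}.
Implicit Types (A B b : int -> V -> V) (m n j : int).

Lemma nprodN1 A B n v : mode_field A -> mode_field B ->
  nprod A B (-1) n v =
  \sum_(i \in [set: nat]) (A (-1 - i%:Z) (B (n + i%:Z) v) +
                          B (n - 1 - i%:Z) (A i%:Z v)).
Proof.
move=> fA fB; apply: eq_fsum => i.
rewrite gbinN1 -expr2 sqrr_sign scale1r -[_ ^ (-1)]/((-1)^-1) invrN1.
rewrite scaleN1r opprK add0r (_ : 0 + i%:Z = i); last by lia.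
by rewrite (_ : -1 + n = n - 1); last by lia.
Qed.

Lemma fsum_delta (h : int -> V) (a : int) :
  \sum_(i \in [set: nat]) (if a == i%:Z then h i%:Z else 0) =
  if 0 <= a then h a else 0.
Proof.
case: a => [a|a] /=; last by apply: fsum0.
rewrite (fsum_single (i0 := a)) => [|i ia]; first by rewrite eqxx.
by case: eqP => // -[ai]; move: ia; rewrite ai eqxx.
Qed.

Lemma finsum_ok_delta (h : int -> V) (a : int) :
  finsum_ok (fun i : nat => if a == i%:Z then h i%:Z else 0).
Proof.
by apply: (@finsum_ok_nat _ _ _ (absz a).+1) => i ai; case: eqP => // ?; lia.
Qed.

Definition heisenberg_bracket (k : K) b := forall m n v,
  b m (b n v) - b n (b m v) = (if m + n == 0 then 2 * k * m%:~R else 0) *: v.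

Section OneCurrent.
Variables (k : K) (b : int -> V -> V).
Hypothesis fb : mode_field b.
Hypothesis hb : heisenberg_bracket k b.
Let lb := fb.1.

Let okS n v : finsum_ok (fun i : nat => b (-1 - i%:Z) (b (n + i%:Z) v) +
                          b (n - 1 - i%:Z) (b i%:Z v)).
Proof.
have ok1 := antidiagonal_field v fb fb (-1) n.
have ok2 := antidiagonal_field v fb fb (n - 1) 0.
apply: finsum_okD ok1 _; apply: finsum_ok_ext ok2 => i.
by rewrite add0r.
Qed.

(** The commutator of b_(m) with b_(p)b_(q) is a sum of two multiples of b that does
    not depend on the order of the factors. Each of the four sums over i that result
    has at most one nonzero term, always the same vector; whether the index of that
    term is nonnegative is decided in pairs by complementary conditions, so that
    exactly two sums contribute. *)
Lemma sugawara_current m n v :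
  b m (nprod b b (-1) n v) - nprod b b (-1) n (b m v) =
  (4 * k * m%:~R) *: b (m + n - 1) v.
Proof.
rewrite !nprodN1// (fsum_lin (lb m)); last exact: okS.
rewrite -fsumB; last 2 first.
- by have [s sP] := okS n v; exists s => i /sP->; exact: lin0.
- exact: okS.
pose c : K := 2 * k * m%:~R.
pose d1 (i : int) := c *: b (n + i) v.
pose d2 (i : int) := c *: b (-1 - i) v.
pose d3 (i : int) := c *: b i v.
pose d4 (i : int) := c *: b (n - 1 - i) v.
transitivity (\sum_(i \in [set: nat])
   (((if m - 1 == i%:Z then d1 i%:Z else 0) +
     (if - m - n == i%:Z then d2 i%:Z else 0)) +
    ((if m + n - 1 == i%:Z then d3 i%:Z else 0) +
     (if - m == i%:Z then d4 i%:Z else 0)))).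
  apply: eq_fsum => i; rewrite (linD (lb m)).
  have pair p q : b m (b p (b q v)) - b p (b q (b m v)) =
      (if m + p == 0 then c else 0) *: b q v +
      (if m + q == 0 then c else 0) *: b p v.
    have := hb m q v => /(congr1 (b p)); rewrite (linB (lb p)) (linZ (lb p)).
    move/eqP; rewrite subr_eq => /eqP E; have := hb m p (b q v).
    move/eqP; rewrite subr_eq => /eqP->.
    by rewrite E -/c; case: ifP => _; case: ifP => _; module_ring K.
  rewrite opprD addrACA !pair.
  rewrite (_ : (m + (-1 - i%:Z) == 0) = (m - 1 == i%:Z)); last by lia.
  rewrite (_ : (m + (n + i%:Z) == 0) = (- m - n == i%:Z)); last by lia.
  rewrite (_ : (m + (n - 1 - i%:Z) == 0) = (m + n - 1 == i%:Z)); last by lia.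
  rewrite (_ : (m + i%:Z == 0) = (- m == i%:Z)); last by lia.
  rewrite /d1 /d2 /d3 /d4.
  by do 4 (case: ifP => _); rewrite ?scale0r.
have okd := finsum_ok_delta.
rewrite fsumD; [|exact: finsum_okD (okd d1 _) (okd d2 _)
                |exact: finsum_okD (okd d3 _) (okd d4 _)].
rewrite [X in X + _](fsumD (okd d1 _) (okd d2 _)).
rewrite [X in _ + X](fsumD (okd d3 _) (okd d4 _)).
rewrite !fsum_delta /d1 /d2 /d3 /d4.
rewrite (_ : n + (m - 1) = m + n - 1); last by lia.
rewrite (_ : -1 - (- m - n) = m + n - 1); last by lia.
rewrite (_ : n - 1 - - m = m + n - 1); last by lia.
have -> : (0 <= m - 1) = ~~ (0 <= - m) by lia.
have -> : (0 <= - m - n) = ~~ (0 <= m + n - 1) by lia.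
by case: (0 <= - m); case: (0 <= m + n - 1); rewrite /c /=; module_ring K.
Qed.

Lemma sugawara_commute (x : V -> V) n v : linear x ->
  (forall m w, x (b m w) = b m (x w)) ->
  x (nprod b b (-1) n v) = nprod b b (-1) n (x v).
Proof.
move=> lx xb; rewrite !nprodN1// (fsum_lin lx); last exact: okS.
by apply: eq_fsum => i; rewrite (linD lx) !xb.
Qed.

(** In both sums only i = 0 can contribute, as b_(i) with i > 0 kills x. *)
Lemma sugawara_lowest j x : (forall n, 0 < n -> b n x = 0) -> 0 <= j ->
  nprod b b (-1) j x =
  (if j == 0 then b (-1) (b 0 x) else 0) + b (j - 1) (b 0 x).
Proof.
move=> bx j0; rewrite nprodN1// (fsum_single (i0 := 0%N)) => [|i i0].
  rewrite !subr0.
  congr (_ + _); case: eqP => [->//|/eqP jn0].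
  by rewrite bx ?(lin0 (lb _))//; lia.
by rewrite !bx ?(lin0 (lb _)) ?addr0//; lia.
Qed.

Lemma sugawara_vac x : (forall n, 0 <= n -> b n x = 0) ->
  nprod b b (-1) (-1) x = b (-1) (b (-1) x).
Proof.
move=> bx; rewrite nprodN1// (fsum_single (i0 := 0%N)) => [|i i0].
  by rewrite (bx 0%N%:Z)// (lin0 (lb _)) addr0; congr (b _ (b _ _)).
by rewrite !bx ?(lin0 (lb _)) ?addr0//; lia.
Qed.

End OneCurrent.
End Sugawara.

Section StressTensor.
Context {K : numFieldType} {V : lmodType K}.
Implicit Types (m n j : int).

(** This is L for k = kappa and b = a, and Lbar for k = - kappa and b = abar. *)
Definition stress (k : K) (b y : int -> V -> V) : int -> V -> V := fun n v =>
  (4 * k)^-1 *: nprod b b (-1) n v +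
  ((k - 1) / (2 * k)) *: (- (n%:~R *: b (n - 1) v)) - k^-1 *: y n v.

Definition charge (k : K) : K := 13 - 6 * k - 6 / k.

(** What the computation of operator products uses of the two currents, the vertex
    operator y = Y(-2) and the vacuum. The last clause is the value of the
    translate of y_(-1) vac. *)
Record stress_system (k : K) (b b' y : int -> V -> V) (vac : V) : Prop :=
  StressSystem {
  sys_k0 : k != 0;
  sys_fb : mode_field b;
  sys_fb' : mode_field b';
  sys_fy : mode_field y;
  sys_hb : heisenberg_bracket k b;
  sys_hb' : heisenberg_bracket (- k) b';
  sys_bb' : forall m n v, b m (b' n v) = b' n (b m v);
  sys_by : forall m n v, b m (y n v) - y n (b m v) = - 2 *: y (m + n) v;
  sys_b'y : forall m n v, b' m (y n v) - y n (b' m v) = - 2 *: y (m + n) v;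
  sys_yy : forall m n v, y m (y n v) = y n (y m v);
  sys_b_vac : forall n, 0 <= n -> b n vac = 0;
  sys_b'_vac : forall n, 0 <= n -> b' n vac = 0;
  sys_y_vac : forall n, 0 <= n -> y n vac = 0;
  sys_y_deriv : y (-2) vac =
    - k^-1 *: (b (-1) (y (-1) vac) - b' (-1) (y (-1) vac))
}.

(** Exchanging the currents and the sign of k: this is what makes every statement
    about L also a statement about Lbar. *)
Lemma stress_system_sym k b b' y vac :
  stress_system k b b' y vac -> stress_system (- k) b' b y vac.
Proof.
case=> k0 fb fb' fy hb hb' bb' by_ b'y yy b_vac b'_vac y_vac yD.
split=> //; first by rewrite oppr_eq0.
- by rewrite opprK.
- by rewrite yD invrN; module_ring K.
Qed.

Section OneSystem.
Variables (k : K) (b b' y : int -> V -> V) (vac : V).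
Hypothesis sys : stress_system k b b' y vac.

Let k0 := sys_k0 sys.
Let fb := sys_fb sys.
Let fb' := sys_fb' sys.
Let fy := sys_fy sys.
Let hb := sys_hb sys.
Let bb' := sys_bb' sys.
Let by_ := sys_by sys.
Let yy := sys_yy sys.
Let b_vac := sys_b_vac sys.
Let y_vac := sys_y_vac sys.
Let lb := fb.1.
Let ly := fy.1.
Let T := stress k b y.
Let T' := stress (- k) b' y.
Let e := y (-1) vac.

Lemma stress_linear n : linear (T n).
Proof.
move=> c u v; rewrite /T /stress.
have lS : linear (nprod b b (-1) n) := borcherds_linear 0 (-1) n fb fb.
by rewrite lS (lb (n - 1)) (ly n); module_ring K.
Qed.

Lemma stress_current m n v : T n (b m v) =
  b m (T n v) - m%:~R *: b (m + n - 1) v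
  + (if m + n - 1 == 0 then (k - 1) * n%:~R * m%:~R else 0) *: v
  - (2 / k) *: y (m + n) v.
Proof.
rewrite /T /stress (linB (lb m)) (linD (lb m)) !(linZ (lb m)) (linN (lb m)).
rewrite (linZ (lb m)).
have := sugawara_current fb hb m n v => /eqP; rewrite subr_eq => /eqP->.
have := hb m (n - 1) v => /eqP; rewrite subr_eq => /eqP->.
have := by_ m n v => /eqP; rewrite subr_eq => /eqP->.
rewrite addrA; case: eqP => _; module_eq K; field; exact: k0.
Qed.

Lemma stress_other_current m n v : T' n (b m v) =
  b m (T' n v) + (2 / k) *: y (m + n) v.
Proof.
rewrite /T' /stress (linB (lb m)) (linD (lb m)) !(linZ (lb m)) (linN (lb m)).
rewrite (linZ (lb m)).
rewrite (sugawara_commute fb' _ _ (lb m))// bb'.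
have := by_ m n v => /eqP; rewrite subr_eq => /eqP->.
module_eq K; field; exact: k0.
Qed.

Lemma stress_vac n : 0 <= n -> T n vac = 0.
Proof.
move=> n0; rewrite /T /stress (sugawara_lowest fb)//; last first.
  by move=> m /ltW; exact: b_vac.
rewrite b_vac// !(lin0 (lb _)) y_vac//.
have [->|n1] := eqVneq n 0; first by rewrite !scale0r; module_ring K.
by rewrite b_vac; [module_ring K|lia].
Qed.

Lemma current_lowest n : 0 <= n -> b n e = if n == 0 then - 2 *: e else 0.
Proof.
move=> n0; have := by_ n (-1) vac; rewrite b_vac// (lin0 (ly _)) subr0 => ->.
case: eqP => [->//|/eqP n1]; first by rewrite y_vac ?scaler0//; lia.
Qed.

Lemma vertex_current n : 0 <= n -> y n (b (-1) vac) = 2 *: y (n - 1) vac.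
Proof.
move=> n0; have := by_ (-1) n vac; rewrite y_vac// (lin0 (lb _)) sub0r.
move=> /eqP; rewrite eqr_oppLR => /eqP->.
by rewrite (_ : -1 + n = n - 1); [module_ring K|lia].
Qed.

Lemma stress_lowest n : 0 <= n -> T n e =
  if n == 0 then - k^-1 *: b (-1) e else if n == 1 then e else 0.
Proof.
move=> n0; rewrite /T /stress (sugawara_lowest fb)//; last first.
  by move=> m m0; rewrite current_lowest ?ltW//; case: eqP m0 => // ->.
rewrite current_lowest// eqxx !(linZ (lb _)).
have -> : y n e = 0 by rewrite /e yy y_vac// (lin0 (ly _)).
have [->|n1] := eqVneq n 0.
  rewrite (_ : 0 - 1 = -1)// scale0r; module_eq K; field; exact: k0.
have [->|n2] := eqVneq n 1.
  by rewrite subrr current_lowest// eqxx; module_eq K; field; exact: k0.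
rewrite current_lowest; last by lia.
case: eqP => [|_]; first by lia.
by module_ring K.
Qed.

Lemma stress_state : T (-1) vac =
  (4 * k)^-1 *: b (-1) (b (-1) vac) + ((k - 1) / (2 * k)) *: b (-2) vac
  - k^-1 *: e.
Proof.
rewrite /T /stress (sugawara_vac fb)// (_ : (-1)%:~R = -1 :> K)//.
by rewrite scaleN1r opprK.
Qed.

End OneSystem.

(** The vector u is quadratic in b, and T_(n) is moved to the right through the
    creation operators of u by [stress_current] and [stress_other_current]. *)
Section OperatorProducts.
Variables (k : K) (b b' y : int -> V -> V) (vac : V).
Hypothesis sys : stress_system k b b' y vac.

Let k0 := sys_k0 sys.
Let lb := (sys_fb sys).1.
Let ly := (sys_fy sys).1.
Let T := stress k b y.
Let T' := stress (- k) b' y.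
Let e := y (-1) vac.
Let u := T (-1) vac.
Let sys' := stress_system_sym sys.

Let uE : u = (4 * k)^-1 *: b (-1) (b (-1) vac)
  + ((k - 1) / (2 * k)) *: b (-2) vac - k^-1 *: e.
Proof. exact: stress_state sys. Qed.

Let T_linear n : linear (T n) := stress_linear sys n.
Let T'_linear n : linear (T' n) := stress_linear sys' n.

(** The contributions of y in T' and in u compensate: for n = 0 this uses the value
    of y_(-2) vac, and for n = 1 that e has weight 1 under T'. *)
Lemma stress_other_state n : 0 <= n -> T' n u = 0.
Proof.
move=> n0; rewrite uE (linB (T'_linear n)) (linD (T'_linear n)).
rewrite !(linZ (T'_linear n)).
rewrite /T' !(stress_other_current sys) (stress_vac sys')//.
rewrite (stress_lowest sys')// -/e !(linD (lb _), linZ (lb _), lin0 (lb _)).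
rewrite (_ : -1 + n = n - 1); last by lia.
rewrite (_ : -2 + n = n - 2); last by lia.
have [->|n1] := eqVneq n 0.
  have := sys_by sys (-1) (-1) vac => /eqP; rewrite subr_eq => /eqP E.
  rewrite (_ : 0 - 1 = -1)// (_ : 0 - 2 = -2)// (sys_y_deriv sys) -/e.
  have -> : y (-1) (b (-1) vac) = b (-1) e + 2 *: y (-2) vac.
    by rewrite /e E (_ : -1 + -1 = -2)//; module_ring K.
  rewrite (sys_y_deriv sys) -/e.
  by module_eq K; field; rewrite ?oppr_eq0 k0.
have [->|n2] := eqVneq n 1.
  rewrite subrr (vertex_current sys)// sub0r (sys_y_vac sys)//.
  rewrite (lin0 (lb _)) (_ : 1 - 2 = -1)// -/e.
  by module_eq K; field; rewrite ?oppr_eq0 k0.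
rewrite (vertex_current sys); last by lia.
rewrite !(sys_y_vac sys); try lia.
by rewrite (lin0 (lb _)); module_ring K.
Qed.

Let cur_cur m n v : b m (b n v) =
  b n (b m v) + (if m + n == 0 then 2 * k * m%:~R else 0) *: v.
Proof.
by have := sys_hb sys m n v => /eqP; rewrite subr_eq => /eqP->; rewrite addrC.
Qed.

Let stress_state_expand n : 1 <= n -> T n u =
  (4 * k)^-1 *: (b (-1) (b (n - 2) vac) + b (n - 2) (b (-1) vac)
    - (if n == 2 then 2 * (k - 1) * 2 else 0) *: b (-1) vac
    - (4 / k) *: y (n - 2) vac)
  + ((k - 1) / (2 * k)) *: (2 *: b (n - 3) vac
    - (if n == 3 then 6 * (k - 1) else 0) *: vac - (2 / k) *: y (n - 2) vac)
  - k^-1 *: (if n == 1 then e else 0).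
Proof.
move=> n1; have n0 : 0 <= n by lia.
rewrite uE (linB (T_linear n)) (linD (T_linear n)).
rewrite !(linZ (T_linear n)) /T (stress_lowest sys)// -/e.
rewrite !(stress_current sys) (stress_vac sys)//.
rewrite (_ : -1 + n - 1 = n - 2); last by lia.
rewrite (_ : -2 + n - 1 = n - 3); last by lia.
rewrite (_ : -1 + n = n - 1); last by lia.
rewrite (_ : -2 + n = n - 2); last by lia.
rewrite (sys_y_vac sys (n := n - 1)); last by lia.
rewrite (vertex_current sys); last by lia.
rewrite (_ : n - 1 - 1 = n - 2); last by lia.
rewrite !(linB (lb _), linD (lb _), linN (lb _), linZ (lb _), lin0 (lb _)).
have -> : (n == 0) = false by lia.
have -> : (n - 2 == 0) = (n == 2) by lia.
have -> : (n - 3 == 0) = (n == 3) by lia.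
rewrite !rmorphN /=.
have [->|] := eqVneq n 2; last have [->|_] := eqVneq n 3.
- by rewrite (_ : (2 == 3 :> int) = false)//; module_eq K; field; rewrite k0.
- rewrite (_ : (3 == 1 :> int) = false)//.
  by move=> _; module_eq K; field; rewrite k0.
- by move=> _; case: (n == 1); module_eq K; field; rewrite k0.
Qed.

Lemma stress_ope1 : T 1 u = 2 *: u.
Proof.
rewrite stress_state_expand// uE (_ : 1 - 2 = -1)// (_ : 1 - 3 = -2)// -/e /=.
by module_eq K; field; rewrite k0.
Qed.

Lemma stress_ope2 : T 2 u = 0.
Proof.
rewrite stress_state_expand//= subrr (_ : 2 - 3 = -1)//.
rewrite (cur_cur 0) (sys_b_vac sys (n := 0))// (sys_y_vac sys)//.
rewrite !(lin0 (lb _)) /=.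
by module_eq K; field; rewrite k0.
Qed.

(** The quadratic term contributes 1 / 2 and the derivative term
    - 3 (k - 1)^2 / k. *)
Lemma stress_ope3 : T 3 u = (charge k / 2) *: vac.
Proof.
rewrite stress_state_expand//= subrr (_ : 3 - 2 = 1)//.
rewrite (cur_cur 1) (sys_b_vac sys (n := 1))// (sys_b_vac sys (n := 0))//.
rewrite (sys_y_vac sys)//.
rewrite !(lin0 (lb _)) /= /charge.
by module_eq K; field; rewrite k0.
Qed.

Lemma stress_ope_ge4 n : 4 <= n -> T n u = 0.
Proof.
move=> n4; rewrite stress_state_expand; last by lia.
have -> : (n == 1) = false by lia.
have -> : (n == 2) = false by lia.
have -> : (n == 3) = false by lia.
rewrite (cur_cur (n - 2)) (_ : (n - 2 + -1 == 0) = false); last by lia.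
rewrite (sys_b_vac sys (n := n - 2)) ?(sys_b_vac sys (n := n - 3)); try lia.
rewrite (sys_y_vac sys (n := n - 2)); last by lia.
by rewrite !(lin0 (lb _)); module_ring K.
Qed.

End OperatorProducts.
End StressTensor.

(** * The Heisenberg modes on the Fock space *)

Section CommutativeMonomials.
Implicit Types (m : {cmonom nat}) (p q : nat).

Lemma mulcm_ucmC m p q :
  mulcm (mulcm m (ucm p)) (ucm q) = mulcm (mulcm m (ucm q)) (ucm p).
Proof. by rewrite -!mulcmA [mulcm (ucm p) _]mulcmC. Qed.

Lemma divcm_ucmC m p q :
  divcm (divcm m (ucm p)) (ucm q) = divcm (divcm m (ucm q)) (ucm p).
Proof. by apply/eqP/cmP => i; rewrite !divcmE subnAC. Qed.

Lemma mulcm_ucmK m p : divcm (mulcm m (ucm p)) (ucm p) = m.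
Proof. by apply/eqP/cmP => i; rewrite divcmE mulcmE addnK. Qed.

Lemma divcm_ucmK m p : (0 < m p)%N -> mulcm (divcm m (ucm p)) (ucm p) = m.
Proof.
move=> mp; apply/eqP/cmP => i; rewrite mulcmE divcmE ucmE subnK//.
by case: eqP => // <-.
Qed.

Lemma mulcm_divcm_ucm m p q : p != q ->
  divcm (mulcm m (ucm p)) (ucm q) = mulcm (divcm m (ucm q)) (ucm p).
Proof.
move=> pq; apply/eqP/cmP => i; rewrite !(mulcmE, divcmE) !ucmE.
have [pi|_] := eqVneq p i; have [qi|_] := eqVneq q i;
  rewrite ?addn0 ?subn0//.
by move: pq; rewrite pi qi eqxx.
Qed.

Lemma cmonom_ind (P : {cmonom nat} -> Prop) :
  P (@onecm nat) -> (forall m p, P m -> P (mulcm m (ucm p))) -> forall m, P m.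
Proof.
move=> P1 PU m; have [d] := ubnP (mdeg m); elim: d m => // d IH m md.
have [->//|] := eqVneq m (@onecm nat) => m1.
have [p mp] : exists p, (0 < m p)%N.
  apply: contrapT => /forallNP m0; move/eqP: m1; apply.
  apply/eqP/cmP => i; rewrite onecmE; have /negP := m0 i.
  by rewrite -eqn0Ngt => /eqP.
rewrite -(divcm_ucmK mp); apply/PU/IH.
have := md; rewrite -{1}(divcm_ucmK mp).
by rewrite -[mulcm _ _]/(mmul _ _) mdegM mdegU addn1 ltnS.
Qed.

End CommutativeMonomials.

Section LinearExtension.
Context {K : numFieldType}.
Local Notation F := (Ftilde K).

Lemma Ftilde_ind (W : F -> Prop) :
  (forall c u v, W u -> W v -> W (c *: u + v)) -> W 0 ->
  (forall b, W << b >>) -> forall v, W v.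
Proof.
move=> Wlin W0 Wb v; rewrite [v]monalgE.
elim/big_ind: _ => [//|u w Wu Ww|b _]; first by rewrite -[u]scale1r; exact: Wlin.
have -> : << v@_b *g b >> = v@_b *: << b >> + 0 :> F.
  by apply/malgP => b'; rewrite addr0 mcoeffZ !mcoeffU mulr_natr.
exact: Wlin.
Qed.

Lemma malgUZ (x : K) (b : fock_index) : << x *g b >> = x *: << b >> :> F.
Proof. by apply/malgP => b'; rewrite mcoeffZ !mcoeffU mulr_natr. Qed.

Lemma linear_extE (f : fock_index -> F) v :
  linear_ext f v = \sum_(b \in [set: fock_index]) v@_b *: f b.
Proof.
rewrite (@fsum_seq _ _ _ (msupp v)) ?fset_uniq// => b bv.
by rewrite mcoeff_outdom ?scale0r.
Qed.

Let ok_ext (f : fock_index -> F) v : finsum_ok (fun b => v@_b *: f b).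
Proof. by exists (msupp v) => b bv; rewrite mcoeff_outdom ?scale0r. Qed.

Lemma linear_ext_linear f : linear (linear_ext f : F -> F).
Proof.
move=> c u v; rewrite !linear_extE fsumZ; last exact: ok_ext.
rewrite -fsumD; [|exact/(finsum_okZ (fun=> c))/ok_ext|exact: ok_ext].
by apply: eq_fsum => b; rewrite mcoeffD mcoeffZ; module_ring K.
Qed.

Lemma linear_ext_basis f (b : fock_index) : linear_ext f (<< b >> : F) = f b.
Proof.
rewrite linear_extE (fsum_single (i0 := b)) => [|b' b'b].
  by rewrite mcoeffUU scale1r.
by rewrite mcoeffU eq_sym (negbTE b'b) scale0r.
Qed.

Lemma linear_comp (f g : F -> F) :
  linear f -> linear g -> linear (fun v => f (g v)).
Proof. by move=> lf lg c u v; rewrite lg lf. Qed.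

End LinearExtension.

Section Fock.
Context {K : numFieldType}.
Local Notation F := (Ftilde K).
Implicit Types (k kappa : K) (m mb : {cmonom nat}) (l n mu : int).

(** Stated for any vectors phi indexed by monomials, to serve for both factors of
    the Fock space. *)
Lemma heisenberg_comm k (V : lmodType K) (phi : {cmonom nat} -> V) n1 n2 m l
    (h := fun n m => heisenberg k n m l)
    (H := fun n m => (h n m).1 *: phi (h n m).2) :
  (h n2 m).1 *: H n1 (h n2 m).2 - (h n1 m).1 *: H n2 (h n1 m).2 =
  (if n1 + n2 == 0 then 2 * k * n1%:~R else 0) *: phi m.
Proof.
rewrite /H /h.
case: n1 => [[|p]|p]; case: n2 => [[|q]|q] /=.
- by rewrite mulr0 scale0r subrr.
- by rewrite scale0r; module_ring K.
- by rewrite scale0r; module_ring K.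
- by rewrite scale0r; module_ring K.
- rewrite scale0r divcm_ucmC !divcmE !ucmE.
  have [->|_] := eqVneq p q; first exact: subrr.
  by rewrite !subn0; module_ring K.
- have -> : (Posz p.+1 + Negz q == 0) = (p == q) by lia.
  rewrite mulcmE ucmE; have [->|pq] := eqVneq p q.
    rewrite mulcm_ucmK addn1; case: (posnP (m q)) => mq.
      by rewrite mq mulr0 scale0r subr0 scale1r mulr1.
    rewrite divcm_ucmK// -addn1 natrD; module_eq K.
    by rewrite -pmulrn; ring.
  rewrite addn0 mulcm_divcm_ucm 1?eq_sym//.
  by module_ring K.
- by rewrite scale0r; module_ring K.
- have -> : (Negz p + Posz q.+1 == 0) = (p == q) by lia.
  rewrite mulcmE ucmE; have [->|pq] := eqVneq p q.
    rewrite mulcm_ucmK addn1; case: (posnP (m q)) => mq.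
      rewrite mq mulr0 scale0r sub0r scale1r mulr1 -scaleNr NegzE rmorphN /=.
      by rewrite mulrN -pmulrn.
    rewrite divcm_ucmK// -addn1 natrD; module_eq K.
    by rewrite NegzE rmorphN /= -pmulrn; ring.
  rewrite addn0 mulcm_divcm_ucm//.
  by module_ring K.
- by rewrite mulcm_ucmC !scale1r subrr scale0r.
Qed.

Lemma a_mode_linear kappa n : linear (a_mode kappa n : F -> F).
Proof. exact: linear_ext_linear. Qed.
Lemma abar_mode_linear kappa n : linear (abar_mode kappa n : F -> F).
Proof. exact: linear_ext_linear. Qed.
Lemma shift_linear mu : linear (shift mu : F -> F).
Proof. exact: linear_ext_linear. Qed.

Definition ket m mb l : F := << (m, mb, l) >>.

Lemma linear_eq (f g : F -> F) : linear f -> linear g ->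
  (forall m mb l, f (ket m mb l) = g (ket m mb l)) -> forall v, f v = g v.
Proof.
move=> lf lg fg; apply: Ftilde_ind => [c u v fu fv||[[m mb] l]].
- by rewrite lf lg fu fv.
- by rewrite (lin0 lf) (lin0 lg).
- exact: fg.
Qed.

Lemma a_mode_basis kappa n m mb l : a_mode kappa n (ket m mb l) =
  (heisenberg kappa n m l).1 *: ket (heisenberg kappa n m l).2 mb l.
Proof.
by rewrite /a_mode /ket linear_ext_basis; case: heisenberg => x m'; exact: malgUZ.
Qed.

Lemma abar_mode_basis kappa n m mb l : abar_mode kappa n (ket m mb l) =
  (heisenberg (- kappa) n mb l).1 *:
    ket m (heisenberg (- kappa) n mb l).2 l.
Proof.
by rewrite /abar_mode /ket linear_ext_basis; case: heisenberg => x m'; exact: malgUZ.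
Qed.

Lemma shift_basis mu m mb l :
  shift mu (ket m mb l) = ket m mb (l + mu).
Proof. by rewrite /shift /ket linear_ext_basis. Qed.

Lemma a_mode_heisenberg kappa : heisenberg_bracket kappa (a_mode kappa).
Proof.
move=> n1 n2; have la := a_mode_linear kappa.
have lc c : linear (fun v : F => c *: v) := scale_linear c.
apply: linear_eq => //.
  move=> c u v; rewrite !(linD (la _), linZ (la _)); module_ring K.
move=> m mb l; rewrite !a_mode_basis !(linZ (la _)) !a_mode_basis.
exact: (heisenberg_comm kappa (fun m' => ket m' mb l)).
Qed.

Lemma abar_mode_heisenberg kappa :
  heisenberg_bracket (- kappa) (abar_mode kappa).
Proof.
move=> n1 n2; have la := abar_mode_linear kappa.
have lc c : linear (fun v : F => c *: v) := scale_linear c.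
apply: linear_eq => //.
  move=> c u v; rewrite !(linD (la _), linZ (la _)); module_ring K.
move=> m mb l; rewrite !abar_mode_basis !(linZ (la _)) !abar_mode_basis.
exact: (heisenberg_comm (- kappa) (fun m' => ket m m' l)).
Qed.

Lemma a_abar_commute kappa n1 n2 (v : F) :
  a_mode kappa n1 (abar_mode kappa n2 v) =
  abar_mode kappa n2 (a_mode kappa n1 v).
Proof.
have [la lab] := (a_mode_linear kappa, abar_mode_linear kappa).
move: v; apply: (linear_eq (linear_comp (la n1) (lab n2))
                          (linear_comp (lab n2) (la n1))).
move=> m mb l; rewrite a_mode_basis abar_mode_basis (linZ (la _)).
rewrite (linZ (lab _)) a_mode_basis abar_mode_basis !scalerA.
by congr (_ *: _); rewrite mulrC.
Qed.

Lemma bounded_ind (A : int -> F -> F) : (forall n, linear (A n)) ->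
    (forall m mb l, exists N : int, forall n, N <= n -> A n (ket m mb l) = 0) ->
  mode_field A.
Proof.
move=> lA bA; split=> //; apply: Ftilde_ind => [||[[m mb] l]]; last exact: bA.
- move=> c u v [N AN] [M AM]; exists (Num.max N M) => n.
  rewrite ge_max => /andP[Nn Mn].
  by rewrite (linD (lA n)) (linZ (lA n)) AN// AM// scaler0 addr0.
- by exists 0 => n _; exact: lin0.
Qed.

Lemma heisenberg_bounded k m l : exists N : int, forall n, N <= n ->
  (heisenberg k n m l).1 = 0.
Proof.
have [M mM] : exists M : nat, forall p, (M <= p)%N -> m p = 0%N.
  exists (\max_(p <- finsupp m) p).+1 => p Mp; apply/eqP; apply: contraTT Mp => mp.
  by rewrite -leqNgt leq_bigmax_seq// -cmE_neq0.
exists M.+1%:Z => -[[|p]|p] Mp //=; rewrite mM ?mulr0//; lia.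
Qed.

Lemma a_mode_field kappa : mode_field (a_mode kappa : int -> F -> F).
Proof.
apply: bounded_ind => [n|m mb l]; first exact: a_mode_linear.
have [N hN] := heisenberg_bounded kappa m l; exists N => n Nn.
by rewrite a_mode_basis hN// scale0r.
Qed.

Lemma abar_mode_field kappa : mode_field (abar_mode kappa : int -> F -> F).
Proof.
apply: bounded_ind => [n|m mb l]; first exact: abar_mode_linear.
have [N hN] := heisenberg_bounded (- kappa) mb l; exists N => n Nn.
by rewrite abar_mode_basis hN// scale0r.
Qed.

Definition one_ (l : int) : F := ket (@onecm nat) (@onecm nat) l.

Lemma a_mode_one kappa n l : 0 <= n ->
  a_mode kappa n (one_ l) = if n == 0 then l%:~R *: one_ l else 0.
Proof.
case: n => [[|p]|p] // _; rewrite a_mode_basis//=.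
by rewrite onecmE mulr0 scale0r.
Qed.

Lemma abar_mode_one kappa n l : 0 <= n ->
  abar_mode kappa n (one_ l) = if n == 0 then l%:~R *: one_ l else 0.
Proof.
case: n => [[|p]|p] // _; rewrite abar_mode_basis//=.
by rewrite onecmE mulr0 scale0r.
Qed.

Lemma shift_one mu l : shift mu (one_ l) = one_ (l + mu).
Proof. exact: shift_basis. Qed.

Lemma commutator_eigen (A S : F -> F) v w p q r x1 x2 : linear S ->
    S v = w -> A w = x1 *: p -> A v = x2 *: q -> S q = r -> p = r ->
  A (S v) - S (A v) = (x1 - x2) *: p.
Proof. by move=> lS -> -> -> Sq ->; rewrite (linZ lS) Sq scalerBl. Qed.

Lemma a_mode_shift kappa mu n (v : F) :
  a_mode kappa n (shift mu v) - shift mu (a_mode kappa n v) =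
  (if n == 0 then mu%:~R else 0) *: shift mu v.
Proof.
have [la ls] := (a_mode_linear kappa, shift_linear mu).
move: v; apply: linear_eq => [c u v|c u v|m mb l].
- by rewrite !(linD (la _), linZ (la _), linD ls, linZ ls); module_ring K.
- by rewrite !(linD ls, linZ ls) scalerDr !scalerA mulrC.
apply: etrans (commutator_eigen ls (shift_basis mu m mb l)
  (a_mode_basis kappa n m mb (l + mu)) (a_mode_basis kappa n m mb l)
  (shift_basis mu _ mb l) _) _; first by case: n => [[|p]|p].
case: n => [[|p]|p] /=; rewrite ?subrr ?scale0r// intrD addrAC subrr add0r.
by rewrite shift_basis.
Qed.

Lemma abar_mode_shift kappa mu n (v : F) :
  abar_mode kappa n (shift mu v) - shift mu (abar_mode kappa n v) =
  (if n == 0 then mu%:~R else 0) *: shift mu v.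
Proof.
have [la ls] := (abar_mode_linear kappa, shift_linear mu).
move: v; apply: linear_eq => [c u v|c u v|m mb l].
- by rewrite !(linD (la _), linZ (la _), linD ls, linZ ls); module_ring K.
- by rewrite !(linD ls, linZ ls) scalerDr !scalerA mulrC.
apply: etrans (commutator_eigen ls (shift_basis mu m mb l)
  (abar_mode_basis kappa n m mb (l + mu)) (abar_mode_basis kappa n m mb l)
  (shift_basis mu m _ l) _) _; first by case: n => [[|p]|p].
case: n => [[|p]|p] /=; rewrite ?subrr ?scale0r// intrD addrAC subrr add0r.
by rewrite shift_basis.
Qed.

(** Removing one creation operator after the other reaches 1_l. *)
Lemma fock_ind kappa (W : F -> Prop) :
  (forall c u v, W u -> W v -> W (c *: u + v)) ->
  (forall l, W (one_ l)) ->
  (forall n v, n < 0 -> W v -> W (a_mode kappa n v)) ->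
  (forall n v, n < 0 -> W v -> W (abar_mode kappa n v)) ->
  forall v, W v.
Proof.
move=> Wlin W1 Wa Wab; apply: Ftilde_ind => //.
  by have := Wlin (-1) _ _ (W1 0) (W1 0); rewrite scaleN1r addNr.
move=> [[m mb] l]; rewrite -/(ket m mb l); elim/cmonom_ind: m => [|m p IH].
  elim/cmonom_ind: mb => [|mb p IH]; first exact: W1.
  have := Wab (Negz p) _ isT IH.
  by rewrite abar_mode_basis /= scale1r.
have := Wa (Negz p) _ isT IH.
by rewrite a_mode_basis /= scale1r.
Qed.

End Fock.

(** * Formal products and exponentials of operators *)

Section FormalProducts.
Context {K : numFieldType} {V : lmodType K}.
Implicit Types (A B : int -> V -> V) (X D : V -> V) (i k m : int).

Definition summable A B :=
  forall k v, finsum_ok (fun i : int => A i (B (k - i) v)).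

Definition bounded_below A := forall v, exists N : int,
  forall k, k < N -> A k v = 0.

Lemma fsum_shift m (F : int -> V) :
  \sum_(i \in [set: int]) F i = \sum_(i \in [set: int]) F (i + m).
Proof.
apply: (@reindex_fsbigT _ _ _ int int (fun i : int => i + m)).
by exists (fun i => i - m) => i; rewrite ?addrK ?subrK.
Qed.

Lemma finsum_ok_shift m (F : int -> V) :
  finsum_ok F -> finsum_ok (fun i => F (i + m)).
Proof.
apply: (finsum_ok_reindex (h := fun i : int => i + m)).
by exists (fun i => i - m) => i; rewrite ?addrK ?subrK.
Qed.

Lemma fprod_linear A B : (forall i, linear (A i)) -> (forall i, linear (B i)) ->
  summable A B -> forall k, linear (fprod A B k).
Proof.
move=> lA lB ok k c u v; rewrite /fprod fsumZ; last exact: ok.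
rewrite -fsumD; [|exact/(finsum_okZ (fun=> c))/ok|exact: ok].
by apply: eq_fsum => i; rewrite (lB _ c u v) (lA _ c).
Qed.

(** The Leibniz rule for the commutator with X, when X rescales and shifts the two
    factors. *)
Lemma fprod_comm A B X m (x y : K) : (forall i, linear (A i)) -> linear X ->
    summable A B ->
    (forall k v, X (A k v) - A k (X v) = x *: A (k - m) v) ->
    (forall k v, X (B k v) - B k (X v) = y *: B (k - m) v) ->
  forall k v,
  X (fprod A B k v) - fprod A B k (X v) = (x + y) *: fprod A B (k - m) v.
Proof.
move=> lA lX ok XA XB k v; rewrite /fprod.
rewrite (fsum_lin lX); last exact: ok.
rewrite -fsumB; last 2 first.
- by have [s sP] := ok k v; exists s => i /sP->; exact: lin0.
- exact: ok.
pose t i := A i (B (k - m - i) v).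
have okt : finsum_ok t by exact: ok.
transitivity (\sum_(i \in [set: int]) (x *: t (i - m) + y *: t i)).
  apply: eq_fsum => i; rewrite /t.
  have := XA i (B (k - i) v) => /eqP; rewrite subr_eq => /eqP->.
  have := XB (k - i) v => /eqP; rewrite subr_eq => /eqP->.
  rewrite (linD (lA _)) (linZ (lA _)).
  rewrite (_ : k - m - (i - m) = k - i); last by lia.
  rewrite (_ : k - m - i = k - i - m); last by lia.
  by module_ring K.
rewrite fsumD; last 2 first.
- apply: (finsum_okZ (fun=> x)); exact: (finsum_ok_shift (- m) okt).
- exact: (finsum_okZ (fun=> y)).
rewrite -fsumZ; last exact: (finsum_ok_shift (- m) okt).
rewrite -fsumZ// -(fsum_shift (- m) t).
by rewrite -scalerDl.
Qed.

(** The same for [D, -] - d/dz, which is a derivation of the product. *)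
Lemma fprod_der A B D (p q : V -> V) : (forall i, linear (A i)) ->
    (forall i, linear (B i)) -> linear D -> linear p -> linear q ->
    summable A B ->
    (forall i v, A i (q v) = q (A i v)) ->
    (forall k v, D (A k v) - A k (D v) = (k + 1)%:~R *: A (k + 1) v - p (A k v)) ->
    (forall k v, D (B k v) - B k (D v) = (k + 1)%:~R *: B (k + 1) v - q (B k v)) ->
  forall k v, D (fprod A B k v) - fprod A B k (D v) =
    (k + 1)%:~R *: fprod A B (k + 1) v
    - (p (fprod A B k v) + q (fprod A B k v)).
Proof.
move=> lA lB lD lp lq ok Aq DA DB k v; rewrite /fprod.
rewrite (fsum_lin lD); last exact: ok.
rewrite -fsumB; last 2 first.
- by have [s sP] := ok k v; exists s => i /sP->; exact: lin0.
- exact: ok.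
pose t i := A i (B (k + 1 - i) v).
have okt : finsum_ok t by exact: ok.
have okp : finsum_ok (fun i : int => p (A i (B (k - i) v))).
  by have [s sP] := ok k v; exists s => i /sP->; exact: lin0.
have okq : finsum_ok (fun i : int => q (A i (B (k - i) v))).
  by have [s sP] := ok k v; exists s => i /sP->; exact: lin0.
have okt1 : finsum_ok (fun i : int => i%:~R *: t i) by exact: finsum_okZ.
have okt2 : finsum_ok (fun i : int => (k + 1 - i)%:~R *: t i).
  exact: finsum_okZ.
transitivity (\sum_(i \in [set: int]) (((i + 1)%:~R *: t (i + 1)
   + (k + 1 - i)%:~R *: t i)
   - (p (A i (B (k - i) v)) + q (A i (B (k - i) v))))).
  apply: eq_fsum => i; rewrite /t.
  have := DA i (B (k - i) v) => /eqP; rewrite subr_eq => /eqP->.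
  have := DB (k - i) v => /eqP; rewrite subr_eq => /eqP->.
  rewrite (linD (lA _)) (linB (lA _)) (linZ (lA _)) Aq.
  rewrite (_ : k + 1 - (i + 1) = k - i); last by lia.
  rewrite (_ : k + 1 - i = k - i + 1); last by lia.
  by module_ring K.
have oks : finsum_ok (fun i : int => (i + 1)%:~R *: t (i + 1)).
  exact: (finsum_ok_shift 1 okt1).
rewrite fsumB; [|exact: finsum_okD|exact: finsum_okD].
congr (_ - _).
  rewrite fsumD// -(fsum_shift 1 (fun i => i%:~R *: t i)) -fsumD//.
  rewrite fsumZ//; apply: eq_fsum => i; rewrite -scalerDl -intrD.
  by congr (_%:~R *: _); lia.
by rewrite fsumD// -(fsum_lin lp)// -(fsum_lin lq).
Qed.

End FormalProducts.

(** A has either only positive powers of z (sgn = 1) or only negative ones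
    (sgn = -1); in both cases the j-th power of A starts at distance j from 0, so
    each coefficient of the exponential is a finite sum. *)
Section FormalExponentials.
Context {K : numFieldType} {V : lmodType K}.
Implicit Types (X D : V -> V) (i k m : int) (j : nat).

Variables (sgn : int) (A : int -> V -> V).
Hypothesis sgn1 : sgn = 1 \/ sgn = -1.
Hypothesis lA : forall i, linear (A i).
Hypothesis A0 : forall i v, sgn * i <= 0 -> A i v = 0.

Lemma fpowS j : fpow A j.+1 = fprod A (fpow A j).
Proof. by []. Qed.

Lemma fpow_support j k v : sgn * k < j%:Z -> fpow A j k v = 0.
Proof.
elim: j k v => [|j IH] k v kj.
  rewrite /fpow /= /fconst; case: eqP => // k0.
  by move: kj; rewrite k0 mulr0.
rewrite fpowS /fprod; apply: fsum0 => i.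
case: (leP (sgn * i) 0) => i0; first exact: A0.
by rewrite IH ?(lin0 (lA _))// mulrBr; lia.
Qed.

Lemma fpow_summable j : summable A (fpow A j).
Proof.
move=> k v; apply: (finsum_ok_int (M := - `|k|) (N := `|k|)) => i ik.
  case: (leP (sgn * i) 0) => i0; first exact: A0.
  by rewrite fpow_support ?(lin0 (lA _))// mulrBr; case: sgn1 => E; rewrite E in i0 *; lia.
case: (leP (sgn * i) 0) => i0; first exact: A0.
by rewrite fpow_support ?(lin0 (lA _))// mulrBr; case: sgn1 => E; rewrite E in i0 *; lia.
Qed.

Lemma fpow_linear j k : linear (fpow A j k).
Proof.
elim: j k => [|j IH] k.
  by move=> c u v; rewrite /fpow /= /fconst; case: eqP; rewrite ?scaler0 ?addr0.
exact: (fprod_linear lA IH (@fpow_summable j)).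
Qed.

Lemma fexp_ok (c : nat -> K) k v : finsum_ok (fun j => c j *: fpow A j k v).
Proof.
apply: (@finsum_ok_nat _ _ _ `|k|.+1) => j kj.
by rewrite fpow_support ?scaler0//; case: sgn1 => ->; lia.
Qed.

Lemma fexp_support k v : sgn * k < 0 -> fexp A k v = 0.
Proof.
move=> k0; apply: fsum0 => j; rewrite fpow_support ?scaler0//.
exact: lt_le_trans k0 _.
Qed.

Lemma fexp0 v : fexp A 0 v = v.
Proof.
rewrite /fexp (fsum_single (i0 := 0%N)) => [|[|j] // _].
  by rewrite fact0 invr1 scale1r /fpow /= /fconst eqxx.
by rewrite fpow_support ?scaler0// mulr0.
Qed.

Lemma fexp_linear k : linear (fexp A k).
Proof.
move=> c u v; rewrite /fexp fsumZ; last exact: fexp_ok.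
rewrite -fsumD; [|exact/(finsum_okZ (fun=> c))/fexp_ok|exact: fexp_ok].
by apply: eq_fsum => j; rewrite (fpow_linear j k c u v); module_ring K.
Qed.

Lemma fexp_fixed v : (forall i, A i v = 0) ->
  forall k, fexp A k v = if k == 0 then v else 0.
Proof.
move=> Av k; have pow0 j k' : fpow A j.+1 k' v = 0.
  elim: j k' => [|j IH] k'; rewrite fpowS; apply: fsum0 => i.
    by rewrite /fpow /= /fconst; case: eqP; rewrite ?Av ?(lin0 (lA _)).
  by rewrite IH (lin0 (lA _)).
rewrite /fexp (fsum_single (i0 := 0%N)) => [|[|j] // _].
  by rewrite fact0 invr1 scale1r.
by rewrite pow0 scaler0.
Qed.

Lemma fpow_comm X m (x : K) : linear X ->
    (forall i v, X (A i v) - A i (X v) = (if i == m then x else 0) *: v) ->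
  forall j k v, X (fpow A j k v) - fpow A j k (X v) =
                (j%:R * x) *: fpow A j.-1 (k - m) v.
Proof.
move=> lX XA; elim=> [|j IH] k v.
  rewrite mul0r scale0r /fpow /= /fconst.
  by case: eqP; rewrite ?(lin0 lX) ?subrr.
rewrite fpowS /fprod.
have ok := @fpow_summable j.
rewrite (fsum_lin lX); last exact: ok.
rewrite -fsumB; last 2 first.
- by have [s sP] := ok k v; exists s => i /sP->; exact: lin0.
- exact: ok.
have okj : finsum_ok (fun i : int => A i (fpow A j.-1 (k - m - i) v)).
  exact: fpow_summable.
transitivity (\sum_(i \in [set: int])
  ((if i == m then x *: fpow A j (k - m) v else 0) +
   (j%:R * x) *: A i (fpow A j.-1 (k - m - i) v))).
  apply: eq_fsum => i.
  have := XA i (fpow A j (k - i) v) => /eqP; rewrite subr_eq => /eqP->.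
  have := IH (k - i) v => /eqP; rewrite subr_eq => /eqP->.
  rewrite (linD (lA _)) (linZ (lA _)) (_ : k - i - m = k - m - i); last by lia.
  by case: eqP => [->|_]; module_ring K.
rewrite fsumD; last 2 first.
- by exists [:: m] => i; rewrite inE => /negbTE->.
- exact: (finsum_okZ (fun=> j%:R * x)).
rewrite (fsum_single (i0 := m)) => [|i /negbTE->//]; rewrite eqxx -fsumZ//.
case: j {IH ok} okj => [|j] okj.
  by rewrite mul0r scale0r addr0 mul1r.
rewrite -[\sum_(i \in _) _]/(fpow A j.+1 (k - m) v) -scalerDl.
by congr (_ *: _); rewrite -[j.+2]addn1 natrD; ring.
Qed.

Let factS_inv j : (j.+1`!%:R)^-1 * j.+1%:R = (j`!%:R)^-1 :> K.
Proof.
have j1 : j.+1%:R != 0 :> K by rewrite pnatr_eq0.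
have jf : j`!%:R != 0 :> K by rewrite pnatr_eq0 -lt0n fact_gt0.
by rewrite factS natrM; field; rewrite jf ?nat1r ?j1.
Qed.

(** If [X, A(z)] = x z^m is a scalar, then [X, A^j] = j x z^m A^(j-1), and
    j / j! = 1 / (j - 1)! sums up to [X, exp A] = x z^m exp A. *)
Lemma fexp_comm X m (x : K) : linear X ->
    (forall i v, X (A i v) - A i (X v) = (if i == m then x else 0) *: v) ->
  forall k v, X (fexp A k v) - fexp A k (X v) = x *: fexp A (k - m) v.
Proof.
move=> lX XA k v; rewrite /fexp (fsum_lin lX); last exact: fexp_ok.
rewrite -fsumB; last 2 first.
- have [s sP] := fexp_ok (fun j => (j`!%:R)^-1) k v.
  by exists s => i /sP->; exact: lin0.
- exact: fexp_ok.
transitivity (\sum_(j \in [set: nat])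
    ((j`!%:R)^-1 * (j%:R * x)) *: fpow A j.-1 (k - m) v).
  apply: eq_fsum => j; rewrite (linZ lX) -scalerBr (fpow_comm lX XA).
  by rewrite scalerA.
rewrite fsumS; last first.
  have /finsum_ok_nat_inv[N FN] := fexp_ok (fun j => (j`!%:R)^-1) (k - m) v.
  apply: (@finsum_ok_nat _ _ _ N.+1) => -[//|j] jN /=.
  have := FN j jN; rewrite mulrA factS_inv => E.
  by rewrite mulrC -scalerA E scaler0.
rewrite mul0r mulr0 scale0r add0r fsumZ; last exact: fexp_ok.
by apply: eq_fsum => j /=; rewrite mulrA factS_inv scalerA mulrC.
Qed.

Lemma fexp_commute X : linear X -> (forall i v, X (A i v) = A i (X v)) ->
  forall k v, X (fexp A k v) = fexp A k (X v).
Proof.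
move=> lX XA k v; apply/eqP; rewrite -subr_eq0; apply/eqP.
rewrite (@fexp_comm X 0 0)// ?scale0r// => i w.
by rewrite XA subrr; case: eqP; rewrite scale0r.
Qed.

Lemma fpow_der D : linear D -> (forall i v, A 1 (A i v) = A i (A 1 v)) ->
    (forall i v, D (A i v) - A i (D v) =
       (i + 1)%:~R *: A (i + 1) v - (if i == 0 then A 1 v else 0)) ->
  forall j k v, D (fpow A j k v) - fpow A j k (D v) =
    (k + 1)%:~R *: fpow A j (k + 1) v - j%:R *: A 1 (fpow A j.-1 k v).
Proof.
move=> lD A1 DA; elim=> [|j IH] k v.
  rewrite scale0r subr0 /fpow /= /fconst.
  case: (eqVneq k 0) => [->|k0]; last case: eqP => [->|_].
  - by rewrite subrr add0r scaler0.
  - by rewrite (lin0 lD) subrr scale0r.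
  - by rewrite (lin0 lD) subrr scaler0.
rewrite fpowS /fprod.
have ok := @fpow_summable j.
rewrite (fsum_lin lD); last exact: ok.
rewrite -fsumB; last 2 first.
- by have [s sP] := ok k v; exists s => i /sP->; exact: lin0.
- exact: ok.
have okj : finsum_ok (fun i : int => A i (fpow A j.-1 (k - i) v)).
  exact: fpow_summable.
pose t i := A i (fpow A j (k + 1 - i) v).
have okt : finsum_ok t by exact: ok.
have okt1 : finsum_ok (fun i : int => i%:~R *: t i) by exact: finsum_okZ.
have okt2 : finsum_ok (fun i : int => (k + 1 - i)%:~R *: t i).
  exact: finsum_okZ.
have oks : finsum_ok (fun i : int => (i + 1)%:~R *: t (i + 1)).
  exact: (finsum_ok_shift 1 okt1).
have okd : finsum_ok (fun i : int => if i == 0 then A 1 (fpow A j k v) else 0).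
  by exists [:: 0] => i; rewrite inE => /negbTE->.
have okA : finsum_ok (fun i : int => A 1 (A i (fpow A j.-1 (k - i) v))).
  by have [s sP] := okj; exists s => i /sP->; exact: lin0.
transitivity (\sum_(i \in [set: int])
  (((i + 1)%:~R *: t (i + 1) + (k + 1 - i)%:~R *: t i)
   - ((if i == 0 then A 1 (fpow A j k v) else 0) +
      j%:R *: A 1 (A i (fpow A j.-1 (k - i) v))))).
  apply: eq_fsum => i; rewrite /t.
  have := DA i (fpow A j (k - i) v) => /eqP; rewrite subr_eq => /eqP->.
  have := IH (k - i) v => /eqP; rewrite subr_eq => /eqP->.
  rewrite (linD (lA _)) (linB (lA _)) !(linZ (lA _)) A1.
  rewrite (_ : k + 1 - (i + 1) = k - i); last by lia.
  rewrite (_ : k + 1 - i = k - i + 1); last by lia.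
  by case: eqP => [->|_]; rewrite ?subr0; module_ring K.
rewrite fsumB; [|exact: finsum_okD
  |exact: finsum_okD okd (finsum_okZ (fun=> j%:R) okA)].
congr (_ - _).
  rewrite fsumD// -(fsum_shift 1 (fun i => i%:~R *: t i)) -fsumD//.
  rewrite fsumZ//; apply: eq_fsum => i; rewrite -scalerDl -intrD.
  by congr (_%:~R *: _); lia.
rewrite fsumD//; last exact: (finsum_okZ (fun=> j%:R)).
rewrite (fsum_single (i0 := 0)) => [|i /negbTE->//]; rewrite eqxx -fsumZ//.
rewrite -(fsum_lin (lA 1))//.
case: j {IH ok t okt okt1 okt2 oks okd okA} okj => [|j] okj.
  by rewrite scale0r addr0 scale1r.
rewrite -[\sum_(i \in _) _]/(fpow A j.+1 k v).
by rewrite -[j.+2%:R]natr1 -[j.+2.-1]/j.+1; module_ring K.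
Qed.

(** Here the derivation [D, -] - d/dz maps A to - A_1, the coefficient of z, which
    commutes with A. *)
Lemma fexp_der D : linear D -> (forall i v, A 1 (A i v) = A i (A 1 v)) ->
    (forall i v, D (A i v) - A i (D v) =
       (i + 1)%:~R *: A (i + 1) v - (if i == 0 then A 1 v else 0)) ->
  forall k v, D (fexp A k v) - fexp A k (D v) =
    (k + 1)%:~R *: fexp A (k + 1) v - A 1 (fexp A k v).
Proof.
move=> lD A1 DA k v; rewrite /fexp (fsum_lin lD); last exact: fexp_ok.
rewrite -fsumB; last 2 first.
- have [s sP] := fexp_ok (fun j => (j`!%:R)^-1) k v.
  by exists s => i /sP->; exact: lin0.
- exact: fexp_ok.
have okS : finsum_ok (fun j =>
    ((j`!%:R)^-1 * j%:R) *: A 1 (fpow A j.-1 k v)).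
  have /finsum_ok_nat_inv[N FN] := fexp_ok (fun j => (j`!%:R)^-1) k v.
  apply: (@finsum_ok_nat _ _ _ N.+1) => -[//|j] jN /=.
  by rewrite factS_inv -(linZ (lA 1)) FN// (lin0 (lA 1)).
transitivity (\sum_(j \in [set: nat])
  ((j`!%:R)^-1 *: ((k + 1)%:~R *: fpow A j (k + 1) v) -
   ((j`!%:R)^-1 * j%:R) *: A 1 (fpow A j.-1 k v))).
  apply: eq_fsum => j; rewrite (linZ lD) -scalerBr (fpow_der lD A1 DA).
  by module_ring K.
rewrite fsumB; last 2 first.
- apply: (finsum_ok_ext (F := fun j =>
    ((k + 1)%:~R * (j`!%:R)^-1) *: fpow A j (k + 1) v)); last exact: fexp_ok.
  by move=> j; rewrite scalerA mulrC.
- exact: okS.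
congr (_ - _).
  rewrite fsumZ; last exact: fexp_ok.
  by apply: eq_fsum => j; rewrite !scalerA mulrC.
rewrite fsumS// mulr0 scale0r add0r (fsum_lin (lA 1)); last exact: fexp_ok.
by apply: eq_fsum => j /=; rewrite factS_inv (linZ (lA 1)).
Qed.

End FormalExponentials.

(** * Exponentials of currents *)

Section Currents.
Context {K : numFieldType} {V : lmodType K}.
Implicit Types (X D : V -> V) (i k m n : int).

Definition creation (c : int -> V -> V) : int -> V -> V :=
  fun k v => if 0 < k then (k%:~R)^-1 *: c (- k) v else 0.
Definition annihilation (c : int -> V -> V) : int -> V -> V :=
  fun k v => if k < 0 then (k%:~R)^-1 *: c (- k) v else 0.

Variables (t : K) (c : int -> V -> V).
Hypothesis lc : forall n, linear (c n).

Let Ac : int -> V -> V := t *: creation c.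
Let Aa : int -> V -> V := t *: annihilation c.

Lemma creationE k v : Ac k v =
  if 0 < k then (t / k%:~R) *: c (- k) v else 0.
Proof.
rewrite -[Ac k v]/(t *: creation c k v) /creation.
by case: ifP; rewrite ?scaler0 ?scalerA.
Qed.

Lemma annihilationE k v : Aa k v =
  if k < 0 then (t / k%:~R) *: c (- k) v else 0.
Proof.
rewrite -[Aa k v]/(t *: annihilation c k v) /annihilation.
by case: ifP; rewrite ?scaler0 ?scalerA.
Qed.

Lemma creation_linear i : linear (Ac i).
Proof.
move=> x u v; rewrite !creationE; case: ifP; rewrite ?scaler0 ?addr0//.
by move=> _; rewrite (linD (lc _)) (linZ (lc _)); module_ring K.
Qed.

Lemma annihilation_linear i : linear (Aa i).
Proof.
move=> x u v; rewrite !annihilationE; case: ifP; rewrite ?scaler0 ?addr0//.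
by move=> _; rewrite (linD (lc _)) (linZ (lc _)); module_ring K.
Qed.

Lemma creation0 i v : 1 * i <= 0 -> Ac i v = 0.
Proof. by rewrite mul1r creationE ltNge => ->. Qed.

Lemma annihilation0 i v : -1 * i <= 0 -> Aa i v = 0.
Proof. by rewrite mulN1r oppr_le0 annihilationE ltNge => ->. Qed.

Definition creation_exp : int -> V -> V := fexp Ac.
Definition annihilation_exp : int -> V -> V := fexp Aa.

Let sgn_c : (1 : int) = 1 \/ (1 : int) = -1 := or_introl erefl.
Let sgn_a : (-1 : int) = 1 \/ (-1 : int) = -1 := or_intror erefl.

Lemma creation_exp_linear k : linear (creation_exp k).
Proof. exact: (fexp_linear sgn_c creation_linear creation0). Qed.

Lemma annihilation_exp_linear k : linear (annihilation_exp k).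
Proof. exact: (fexp_linear sgn_a annihilation_linear annihilation0). Qed.

Lemma creation_exp_neg k v : k < 0 -> creation_exp k v = 0.
Proof.
move=> k0; rewrite /creation_exp (fexp_support sgn_c creation_linear creation0)//.
by rewrite mul1r.
Qed.

Lemma annihilation_exp_pos k v : 0 < k -> annihilation_exp k v = 0.
Proof.
move=> k0; rewrite /annihilation_exp.
rewrite (fexp_support sgn_a annihilation_linear annihilation0)//.
by rewrite mulN1r oppr_lt0.
Qed.

Lemma creation_exp0 v : creation_exp 0 v = v.
Proof. exact: (fexp0 sgn_c creation_linear creation0). Qed.

Lemma annihilation_exp_fixed v : (forall n, 0 < n -> c n v = 0) ->
  forall k, annihilation_exp k v = if k == 0 then v else 0.
Proof.
move=> cv; apply: (fexp_fixed annihilation_linear) => i.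
rewrite annihilationE; case: ifP => // i0.
by rewrite cv ?scaler0// oppr_gt0.
Qed.

Lemma creation_exp_commute X : linear X ->
    (forall n v, n < 0 -> X (c n v) = c n (X v)) ->
  forall k v, X (creation_exp k v) = creation_exp k (X v).
Proof.
move=> lX Xc; apply: (fexp_commute sgn_c creation_linear creation0 lX) => i v.
rewrite !creationE; case: ifP => i0; last exact: lin0.
by rewrite (linZ lX) Xc// oppr_lt0.
Qed.

Lemma annihilation_exp_commute X : linear X ->
    (forall n v, 0 < n -> X (c n v) = c n (X v)) ->
  forall k v, X (annihilation_exp k v) = annihilation_exp k (X v).
Proof.
move=> lX Xc; apply: (fexp_commute sgn_a annihilation_linear annihilation0 lX) => i v.
rewrite !annihilationE; case: ifP => i0; last exact: lin0.
by rewrite (linZ lX) Xc// oppr_gt0.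
Qed.

Section Heisenberg.
Variable k0 : K.
Hypothesis hc : heisenberg_bracket k0 c.

(** [c_(n), A(z)] = 2 t k0 z^n when n is positive. *)
Lemma creation_exp_current n k v :
  c n (creation_exp k v) - creation_exp k (c n v) =
  (if 0 < n then 2 * t * k0 else 0) *: creation_exp (k - n) v.
Proof.
apply: (fexp_comm sgn_c creation_linear creation0 (lc n)) => i w.
rewrite !creationE; case: ifP => i0.
  rewrite (linZ (lc n)) -scalerBr hc scalerA.
  rewrite (_ : (n + - i == 0) = (i == n)); last by lia.
  case: eqP => [ni|_]; last by rewrite mulr0.
  rewrite -ni i0; congr (_ *: _).
  have i1 : i%:~R != 0 :> K by rewrite intr_eq0; lia.
  by field.
rewrite (lin0 (lc n)) subrr; case: eqP => [<-|_]; last by rewrite scale0r.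
by rewrite i0 scale0r.
Qed.

Lemma annihilation_exp_current n k v :
  c n (annihilation_exp k v) - annihilation_exp k (c n v) =
  (if n < 0 then 2 * t * k0 else 0) *: annihilation_exp (k - n) v.
Proof.
apply: (fexp_comm sgn_a annihilation_linear annihilation0 (lc n)) => i w.
rewrite !annihilationE; case: ifP => i0.
  rewrite (linZ (lc n)) -scalerBr hc scalerA.
  rewrite (_ : (n + - i == 0) = (i == n)); last by lia.
  case: eqP => [ni|_]; last by rewrite mulr0.
  rewrite -ni i0; congr (_ *: _).
  have i1 : i%:~R != 0 :> K by rewrite intr_eq0; lia.
  by field.
rewrite (lin0 (lc n)) subrr; case: eqP => [<-|_]; last by rewrite scale0r.
by rewrite i0 scale0r.
Qed.

(** D raises the creation modes, so [D, A] differs from A' by the lowest term. *)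
Lemma creation_exp_der D : linear D -> covariant D c -> forall k v,
  D (creation_exp k v) - creation_exp k (D v) =
  (k + 1)%:~R *: creation_exp (k + 1) v - t *: c (-1) (creation_exp k v).
Proof.
move=> lD Dc k v.
have A1 w : Ac 1 w = t *: c (-1) w by rewrite creationE /= divr1.
rewrite -A1; apply: (fexp_der sgn_c creation_linear creation0 lD) => i w.
  rewrite !A1 !creationE; case: ifP => i0; last first.
    by rewrite (lin0 (lc _)) scaler0.
  have := hc (-1) (- i) w; rewrite (_ : (-1 + - i == 0) = false); last by lia.
  rewrite scale0r => /eqP; rewrite subr_eq0 => /eqP E.
  by rewrite (linZ (lc _)) E (linZ (lc _)) !scalerA mulrC.
rewrite A1 !creationE; case: (ltgtP i 0) => [i0|i0|->].
- rewrite (lin0 lD) subrr (_ : (0 < i + 1) = false); last by lia.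
  by rewrite scaler0 subr0.
- rewrite (_ : (0 < i + 1) = true); last by lia.
  have := Dc (- i) w => /eqP; rewrite subr_eq => /eqP E.
  rewrite (linZ lD) E -opprD (_ : - (i + 1) = - i - 1); last by lia.
  have i1 : i%:~R != 0 :> K by rewrite intr_eq0; lia.
  have i2 : (i + 1)%:~R != 0 :> K by rewrite intr_eq0; lia.
  rewrite rmorphN /= subr0; rewrite intrD in i2 *.
  by module_eq K; field; rewrite i1 i2.
- rewrite (lin0 lD) subrr add0r /= divr1 scale1r (_ : - 1 = -1)//.
  by rewrite subrr.
Qed.

End Heisenberg.
End Currents.

(** * Vertex operators of a pair of free fields *)

Section BoundedProducts.
Context {K : numFieldType} {V : lmodType K}.
Implicit Types (A B : int -> V -> V).

Lemma summable_creation A B : (forall i, linear (A i)) ->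
  (forall i v, i < 0 -> A i v = 0) -> bounded_below B -> summable A B.
Proof.
move=> lA A0 bB k v; have [N BN] := bB v.
apply: (finsum_ok_int (M := 0) (N := k - N)) => i ik; first exact: A0.
by rewrite BN ?(lin0 (lA _))//; lia.
Qed.

Lemma bounded_below_creation A B : (forall i, linear (A i)) ->
  (forall i v, i < 0 -> A i v = 0) -> bounded_below B ->
  bounded_below (fprod A B).
Proof.
move=> lA A0 bB v; have [N BN] := bB v; exists N => k kN.
apply: fsum0 => i; case: (ltP i 0) => [/A0//|i0].
by rewrite BN ?(lin0 (lA _))//; lia.
Qed.

(** The coefficients of an annihilation exponential reach arbitrarily negative
    powers of z, but only finitely many of them are nonzero on a given v. As they
    commute with B, the bound for v serves for all the vectors B_j v. *)
Lemma summable_annihilation A B : (forall i, linear (B i)) ->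
    (forall i v, 0 < i -> A i v = 0) -> bounded_below A ->
    (forall i j v, A i (B j v) = B j (A i v)) -> summable A B.
Proof.
move=> lB A0 bA AB k v; have [N AN] := bA v.
apply: (finsum_ok_int (M := N) (N := 0)) => i ik; last exact: A0.
by rewrite AB AN ?(lin0 (lB _)).
Qed.

Lemma bounded_below_annihilation A B : (forall i, linear (A i)) ->
    (forall i, linear (B i)) ->
    (forall i v, 0 < i -> A i v = 0) -> bounded_below A -> bounded_below B ->
    (forall i j v, A i (B j v) = B j (A i v)) ->
  bounded_below (fprod A B).
Proof.
move=> lA lB A0 bA bB AB v; have [N AN] := bA v; have [M BM] := bB v.
exists (N + M) => k kNM; apply: fsum0 => i.
case: (ltP i N) => [iN|Ni]; first by rewrite AB AN ?(lin0 (lB _)).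
by rewrite BM ?(lin0 (lA _))//; lia.
Qed.

End BoundedProducts.

(** The Fock space enters only through the properties below: two commuting
    Heisenberg currents of opposite levels with equal momenta, shifts of the
    momentum, and generation from the vectors [one l]. The translation operator D
    is kept abstract together with its expression by the currents. *)
Section FreeFields.
Context {K : numFieldType} {V : lmodType K}.
Implicit Types (k l m n mu nu : int) (v w : V).
Variables (kappa : K) (a b : int -> V -> V) (one : int -> V) (sh : int -> V -> V).
Hypothesis kappa0 : kappa != 0.
Hypotheses (fa : mode_field a) (fb : mode_field b).
Hypotheses (ha : heisenberg_bracket kappa a) (hb : heisenberg_bracket (- kappa) b).
Hypothesis ab : forall m n v, a m (b n v) = b n (a m v).
Hypothesis lsh : forall mu, linear (sh mu).
Hypothesis a_one : forall n l, 0 <= n ->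
  a n (one l) = if n == 0 then l%:~R *: one l else 0.
Hypothesis b_one : forall n l, 0 <= n ->
  b n (one l) = if n == 0 then l%:~R *: one l else 0.
Hypothesis sh_one : forall mu l, sh mu (one l) = one (l + mu).
Hypothesis a_sh : forall mu n v, a n (sh mu v) - sh mu (a n v) =
  (if n == 0 then mu%:~R else 0) *: sh mu v.
Hypothesis b_sh : forall mu n v, b n (sh mu v) - sh mu (b n v) =
  (if n == 0 then mu%:~R else 0) *: sh mu v.
Hypothesis ind : forall W : V -> Prop,
  (forall c u v, W u -> W v -> W (c *: u + v)) -> (forall l, W (one l)) ->
  (forall n v, n < 0 -> W v -> W (a n v)) ->
  (forall n v, n < 0 -> W v -> W (b n v)) -> forall v, W v.

Let la := fa.1.
Let lb := fb.1.

Variable D : V -> V.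
Hypothesis DE : forall v,
  D v = (4 * kappa)^-1 *: (nprod a a (-1) 0 v - nprod b b (-1) 0 v).

Lemma translation_linear : linear D.
Proof.
move=> c u v; rewrite !DE.
have lSa : linear (nprod a a (-1) 0) := borcherds_linear 0 (-1) 0 fa fa.
have lSb : linear (nprod b b (-1) 0) := borcherds_linear 0 (-1) 0 fb fb.
by rewrite (lSa c u v) (lSb c u v); module_ring K.
Qed.

Lemma a_covariant : covariant D a.
Proof.
move=> n v; rewrite !DE.
rewrite -(sugawara_commute fb 0 v (la n)) => [|m w]; last by rewrite ab.
have := sugawara_current fa ha n 0 v => /eqP.
rewrite subr_eq addr0 => /eqP E.
rewrite (linZ (la _)) (linB (la _)) E.
by module_eq K; field.
Qed.

Lemma b_covariant : covariant D b.
Proof.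
move=> n v; rewrite !DE.
rewrite -(sugawara_commute fa 0 v (lb n)) => [|m w]; last by rewrite ab.
have := sugawara_current fb hb n 0 v => /eqP.
rewrite subr_eq addr0 => /eqP E.
rewrite (linZ (lb _)) (linB (lb _)) E.
by module_eq K; field.
Qed.

Lemma translation_one l :
  D (one l) = (l%:~R / (2 * kappa)) *: (a (-1) (one l) - b (-1) (one l)).
Proof.
rewrite !DE.
rewrite (sugawara_lowest fa)//; last first.
  by move=> n n0; rewrite a_one ?ltW//; case: eqP n0 => // ->.
rewrite (sugawara_lowest fb)//; last first.
  by move=> n n0; rewrite b_one ?ltW//; case: eqP n0 => // ->.
rewrite eqxx a_one// b_one// eqxx !(linZ (la _)) !(linZ (lb _)).
by module_eq K; field.
Qed.

Section VertexOperator.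
Variable mu : int.
Let s : K := mu%:~R / (2 * kappa).
Let E1 := creation_exp s a.
Let E2 := annihilation_exp s a.
Let E3 := creation_exp (- s) b.
Let E4 := annihilation_exp (- s) b.
Let S : int -> V -> V := fconst (sh mu).
Let W4 := fprod E4 S.
Let W3 := fprod E3 W4.
Let W2 := fprod E2 W3.

Definition vertex : int -> V -> V := fprod E1 W2.
(** The creation part of the vertex operator: as vectors [one l] are killed by the
    annihilation modes, it gives the action of the whole operator on them. *)
Definition vertex_creation : int -> V -> V := fprod E1 E3.

Let Y := vertex.
Let Q := vertex_creation.
Let b0 := fun v => a (-1) v - b (-1) v.

Let lE1 : forall k, linear (E1 k) := creation_exp_linear s la.
Let lE2 : forall k, linear (E2 k) := annihilation_exp_linear s la.
Let lE3 : forall k, linear (E3 k) := creation_exp_linear (- s) lb.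
Let lE4 : forall k, linear (E4 k) := annihilation_exp_linear (- s) lb.
Let E1_neg : forall k v, k < 0 -> E1 k v = 0 := creation_exp_neg s la.
Let E3_neg : forall k v, k < 0 -> E3 k v = 0 := creation_exp_neg (- s) lb.
Let E2_pos : forall k v, 0 < k -> E2 k v = 0 := annihilation_exp_pos s la.
Let E4_pos : forall k v, 0 < k -> E4 k v = 0 := annihilation_exp_pos (- s) lb.

Let s2 : 2 * s * kappa = mu%:~R.
Proof. by rewrite /s; field. Qed.

Let s2N : 2 * - s * - kappa = mu%:~R.
Proof. by rewrite -s2; ring. Qed.

Let E1_a n k v : a n (E1 k v) - E1 k (a n v) =
  (if 0 < n then mu%:~R else 0) *: E1 (k - n) v.
Proof. by rewrite (creation_exp_current _ la ha) s2. Qed.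

Let E2_a n k v : a n (E2 k v) - E2 k (a n v) =
  (if n < 0 then mu%:~R else 0) *: E2 (k - n) v.
Proof. by rewrite (annihilation_exp_current _ la ha) s2. Qed.

Let E3_b n k v : b n (E3 k v) - E3 k (b n v) =
  (if 0 < n then mu%:~R else 0) *: E3 (k - n) v.
Proof. by rewrite (creation_exp_current _ lb hb) s2N. Qed.

Let E4_b n k v : b n (E4 k v) - E4 k (b n v) =
  (if n < 0 then mu%:~R else 0) *: E4 (k - n) v.
Proof. by rewrite (annihilation_exp_current _ lb hb) s2N. Qed.

Let E1_b n k v : b n (E1 k v) = E1 k (b n v).
Proof. by apply: (creation_exp_commute _ la (lb n)) => m w _. Qed.
Let E2_b n k v : b n (E2 k v) = E2 k (b n v).
Proof. by apply: (annihilation_exp_commute _ la (lb n)) => m w _. Qed.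
Let E3_a n k v : a n (E3 k v) = E3 k (a n v).
Proof. by apply: (creation_exp_commute _ lb (la n)) => m w _. Qed.
Let E4_a n k v : a n (E4 k v) = E4 k (a n v).
Proof. by apply: (annihilation_exp_commute _ lb (la n)) => m w _. Qed.

(* Moving E past the creation mode c_(n) shifts the bound by n. *)
Let bounded_exp E (c d : int -> V -> V) : (forall k, linear (E k)) ->
  (forall n, linear (c n)) -> (forall n, linear (d n)) ->
  (forall l k, E k (one l) = if k == 0 then one l else 0) ->
  (forall n k v, c n (E k v) - E k (c n v) =
     (if n < 0 then mu%:~R else 0) *: E (k - n) v) ->
  (forall n k v, d n (E k v) = E k (d n v)) ->
  (forall W : V -> Prop,
    (forall x u v, W u -> W v -> W (x *: u + v)) -> (forall l, W (one l)) ->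
    (forall n v, n < 0 -> W v -> W (c n v)) ->
    (forall n v, n < 0 -> W v -> W (d n v)) -> forall v, W v) ->
  bounded_below E.
Proof.
move=> lE lc ld E1' Ec Ed; apply.
- move=> x u v [N uN] [M vM]; exists (Num.min N M) => k.
  rewrite lt_min => /andP[kN kM].
  by rewrite lE uN// vM// scaler0 addr0.
- by move=> l; exists 0 => k k0; rewrite E1'; case: eqP k0 => // ->.
- move=> n v n0 [N vN]; exists (N + n) => k kN.
  have := Ec n k v; rewrite vN; last by lia.
  rewrite vN; last by lia.
  by rewrite (lin0 (lc n)) scaler0 sub0r => /eqP; rewrite oppr_eq0 => /eqP.
- move=> n v n0 [N vN]; exists N => k kN.
  by rewrite -Ed vN// (lin0 (ld n)).
Qed.

Let E2_bounded : bounded_below E2.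
Proof.
apply: (bounded_exp lE2 la lb _ E2_a E2_b ind) => l k.
apply: (annihilation_exp_fixed s la) => n n0.
by rewrite a_one ?ltW//; case: eqP n0 => // ->.
Qed.

Let E4_bounded : bounded_below E4.
Proof.
apply: (bounded_exp lE4 lb la _ E4_b E4_a) => [l k|W Wl W1 Wb Wa].
  apply: (annihilation_exp_fixed (- s) lb) => n n0.
  by rewrite b_one ?ltW//; case: eqP n0 => // ->.
exact: ind.
Qed.

Let lS k : linear (S k).
Proof.
move=> c u v; rewrite /S /fconst; case: eqP => _; first exact: lsh.
by rewrite scaler0 addr0.
Qed.

Let S_bounded : bounded_below S.
Proof. by move=> v; exists 0 => k k0; rewrite /S /fconst; case: eqP k0 => // ->. Qed.

Let S_current (c : int -> V -> V) : (forall n, linear (c n)) ->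
  (forall n v, c n (sh mu v) - sh mu (c n v) =
     (if n == 0 then mu%:~R else 0) *: sh mu v) ->
  forall n k v, c n (S k v) - S k (c n v) =
     (if n == 0 then mu%:~R else 0) *: S (k - n) v.
Proof.
move=> lc c_sh n k v; rewrite /S /fconst.
case: (eqVneq k 0) => [->|k0].
  rewrite c_sh; case: eqP => [->|n0]; first by rewrite subrr eqxx.
  by rewrite !scale0r.
rewrite (lin0 (lc n)) subrr; case: eqP => [->|n0]; last by rewrite scale0r.
by rewrite subr0 (negbTE k0) scaler0.
Qed.

Let S_a := S_current la (a_sh mu).
Let S_b := S_current lb (b_sh mu).

Let E4_S i j v : E4 i (S j v) = S j (E4 i v).
Proof.
symmetry; apply: (annihilation_exp_commute _ lb (lS j)) => n w n0.
have := S_b n j w; rewrite (_ : (n == 0) = false); last by lia.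
by rewrite scale0r => /eqP; rewrite subr_eq0 => /eqP.
Qed.

Let sum4 : summable E4 S.
Proof. exact: summable_annihilation. Qed.
Let lW4 : forall k, linear (W4 k) := fprod_linear lE4 lS sum4.
Let W4_bounded : bounded_below W4.
Proof. exact: bounded_below_annihilation. Qed.

Let sum3 : summable E3 W4.
Proof. exact: summable_creation. Qed.
Let lW3 : forall k, linear (W3 k) := fprod_linear lE3 lW4 sum3.
Let W3_bounded : bounded_below W3.
Proof. exact: bounded_below_creation. Qed.

Let W4_a n k v : a n (W4 k v) - W4 k (a n v) =
  (0 + if n == 0 then mu%:~R else 0) *: W4 (k - n) v.
Proof.
apply: (fprod_comm lE4 (la n) sum4) => k' w; last exact: S_a.
by rewrite E4_a subrr scale0r.
Qed.

Let W4_b n k v : b n (W4 k v) - W4 k (b n v) =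
  ((if n < 0 then mu%:~R else 0) + if n == 0 then mu%:~R else 0) *:
    W4 (k - n) v.
Proof.
by apply: (fprod_comm lE4 (lb n) sum4) => k' w; [exact: E4_b|exact: S_b].
Qed.

Let W3_a n k v : a n (W3 k v) - W3 k (a n v) =
  (0 + (0 + if n == 0 then mu%:~R else 0)) *: W3 (k - n) v.
Proof.
apply: (fprod_comm lE3 (la n) sum3) => k' w; last exact: W4_a.
by rewrite E3_a subrr scale0r.
Qed.

Let W3_b n k v : b n (W3 k v) - W3 k (b n v) = mu%:~R *: W3 (k - n) v.
Proof.
rewrite (fprod_comm lE3 (lb n) sum3 (E3_b n) (W4_b n)); congr (_ *: _).
by case: (ltgtP n 0) => _; rewrite ?add0r ?addr0.
Qed.

Let E2_W3 i j v : E2 i (W3 j v) = W3 j (E2 i v).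
Proof.
symmetry; apply: (annihilation_exp_commute _ la (lW3 j)) => n w n0.
have := W3_a n j w; rewrite (_ : (n == 0) = false); last by lia.
by rewrite !addr0 scale0r => /eqP; rewrite subr_eq0 => /eqP.
Qed.

Let sum2 : summable E2 W3.
Proof. exact: summable_annihilation. Qed.
Let lW2 : forall k, linear (W2 k) := fprod_linear lE2 lW3 sum2.
Let W2_bounded : bounded_below W2.
Proof. exact: bounded_below_annihilation. Qed.

Let sum1 : summable E1 W2.
Proof. exact: summable_creation. Qed.

Lemma vertex_linear k : linear (Y k).
Proof. exact: (fprod_linear lE1 lW2 sum1). Qed.

Lemma vertex_bounded : bounded_below Y.
Proof. exact: bounded_below_creation. Qed.

(** The creation exponential of a accounts for n > 0, its annihilation exponential
    for n < 0 and the shift of the momentum for n = 0; their sum is uniform. *)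
Lemma vertex_a n k v : a n (Y k v) - Y k (a n v) = mu%:~R *: Y (k - n) v.
Proof.
have W2_a := fprod_comm lE2 (la n) sum2 (E2_a n) (W3_a n).
rewrite (fprod_comm lE1 (la n) sum1 (E1_a n) W2_a); congr (_ *: _).
by case: (ltgtP n 0) => _; rewrite ?add0r ?addr0.
Qed.

Lemma vertex_b n k v : b n (Y k v) - Y k (b n v) = mu%:~R *: Y (k - n) v.
Proof.
have E2_b' k' w : b n (E2 k' w) - E2 k' (b n w) = 0 *: E2 (k' - n) w.
  by rewrite E2_b subrr scale0r.
have E1_b' k' w : b n (E1 k' w) - E1 k' (b n w) = 0 *: E1 (k' - n) w.
  by rewrite E1_b subrr scale0r.
have W2_b := fprod_comm lE2 (lb n) sum2 E2_b' (W3_b n).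
by rewrite (fprod_comm lE1 (lb n) sum1 E1_b' W2_b) !add0r.
Qed.

Lemma vertex_one k l : Y k (one l) = Q k (one (l + mu)).
Proof.
have e4 i j : E4 i (one j) = if i == 0 then one j else 0.
  apply: (annihilation_exp_fixed (- s) lb) => n n0.
  by rewrite b_one ?ltW//; case: eqP n0 => // ->.
have e2 i j : E2 i (one j) = if i == 0 then one j else 0.
  apply: (annihilation_exp_fixed s la) => n n0.
  by rewrite a_one ?ltW//; case: eqP n0 => // ->.
have w4 i : W4 i (one l) = if i == 0 then one (l + mu) else 0.
  rewrite /W4 /fprod (fsum_single (i0 := i)) => [|i' ii'].
    by rewrite /S /fconst subrr eqxx sh_one e4.
  by rewrite /S /fconst subr_eq0 eq_sym (negbTE ii') (lin0 (lE4 _)).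
have w3 i : W3 i (one l) = E3 i (one (l + mu)).
  rewrite /W3 /fprod (fsum_single (i0 := i)) => [|i' ii'].
    by rewrite subrr w4 eqxx.
  by rewrite w4 subr_eq0 eq_sym (negbTE ii') (lin0 (lE3 _)).
have w2 i : W2 i (one l) = E3 i (one (l + mu)).
  rewrite /W2 /fprod (fsum_single (i0 := 0)) => [|i' ii'].
    by rewrite E2_W3 e2 eqxx subr0 w3.
  by rewrite E2_W3 e2 (negbTE ii') (lin0 (lW3 _)).
by apply: eq_fsum => i; rewrite w2.
Qed.

Let E3_bounded : bounded_below E3.
Proof. by move=> v; exists 0 => k k0; exact: E3_neg. Qed.

Let sumQ : summable E1 E3.
Proof. exact: summable_creation. Qed.

Lemma vertex_creation_linear k : linear (Q k).
Proof. exact: (fprod_linear lE1 lE3 sumQ). Qed.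

Lemma vertex_creation_neg k v : k < 0 -> Q k v = 0.
Proof.
move=> k0; apply: fsum0 => i; case: (ltP i 0) => i0; first exact: E1_neg.
by rewrite E3_neg ?(lin0 (lE1 _))//; lia.
Qed.

Lemma vertex_creation0 v : Q 0 v = v.
Proof.
rewrite /Q /vertex_creation /fprod (fsum_single (i0 := 0)) => [|i i0].
  by rewrite subrr /E1 /E3 !creation_exp0.
case: (ltP i 0) => ii; first exact: E1_neg.
by rewrite E3_neg ?(lin0 (lE1 _))//; lia.
Qed.

Lemma vertex_creation_commute X : linear X ->
    (forall n v, n < 0 -> X (a n v) = a n (X v)) ->
    (forall n v, n < 0 -> X (b n v) = b n (X v)) ->
  forall k v, X (Q k v) = Q k (X v).
Proof.
move=> lX Xa Xb k v; apply/eqP; rewrite -subr_eq0; apply/eqP.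
rewrite (@fprod_comm _ _ E1 E3 X 0 0 0 lE1 lX sumQ) ?addr0 ?scale0r//.
- move=> k' w; rewrite scale0r; apply/eqP; rewrite subr_eq0; apply/eqP.
  exact: (creation_exp_commute _ la lX).
- move=> k' w; rewrite scale0r; apply/eqP; rewrite subr_eq0; apply/eqP.
  exact: (creation_exp_commute _ lb lX).
Qed.

(** The creation part fails to be covariant by the lowest mode of a - abar, which is
    what the change of momentum makes up for. *)
Lemma vertex_creation_der k v : D (Q k v) - Q k (D v) =
  (k + 1)%:~R *: Q (k + 1) v - s *: b0 (Q k v).
Proof.
have lp : linear (fun v => s *: a (-1) v).
  by move=> c u w; rewrite (la (-1) c u w); module_ring K.
have lq : linear (fun v => - s *: b (-1) v).
  by move=> c u w; rewrite (lb (-1) c u w); module_ring K.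
have D1 := creation_exp_der s la ha translation_linear a_covariant.
have D3 := creation_exp_der (- s) lb hb translation_linear b_covariant.
rewrite (fprod_der lE1 lE3 translation_linear lp lq sumQ _ D1 D3) => [|i w].
  by rewrite /b0 /Q /vertex_creation -/E1 -/E3; module_ring K.
by rewrite (linZ (lE1 _)) E1_b.
Qed.

End VertexOperator.

(** * Translation covariance and commutation of vertex operators *)

Local Notation Y := vertex.
Local Notation Q := vertex_creation.

(* The difference of the currents is null and carries no momentum. *)
Let diff_ab v := a (-1) v - b (-1) v.

Let ab_linear : linear diff_ab.
Proof.
by move=> c u v; rewrite /diff_ab (la (-1) c u v) (lb (-1) c u v); module_ring K.
Qed.

Lemma vertex_current_diff mu k v : Y mu k (diff_ab v) = diff_ab (Y mu k v).
Proof.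
rewrite /diff_ab (linB (vertex_linear mu k)).
have := vertex_a mu (-1) k v => /eqP; rewrite subr_eq => /eqP->.
have := vertex_b mu (-1) k v => /eqP; rewrite subr_eq => /eqP->.
by module_ring K.
Qed.

Let heis_neg (c : int -> V -> V) x n v : heisenberg_bracket x c -> n < 0 ->
  c (-1) (c n v) = c n (c (-1) v).
Proof.
move=> hc n0; have := hc (-1) n v.
rewrite (_ : (-1 + n == 0) = false); last by lia.
by rewrite scale0r => /eqP; rewrite subr_eq0 => /eqP.
Qed.

Lemma vertex_creation_current_diff mu k v : Q mu k (diff_ab v) = diff_ab (Q mu k v).
Proof.
symmetry; apply: (vertex_creation_commute _ ab_linear) => n w n0; rewrite /diff_ab.
  by rewrite (heis_neg w ha n0) -ab (linB (la _)).
by rewrite (heis_neg w hb n0) ab (linB (lb _)).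
Qed.

Let vertex_translation_step (c : int -> V -> V) mu :
  (forall n, linear (c n)) -> covariant D c ->
  (forall n k v, c n (Y mu k v) - Y mu k (c n v) = mu%:~R *: Y mu (k - n) v) ->
  forall n v,
    (forall k, D (Y mu k v) - Y mu k (D v) = (k + 1)%:~R *: Y mu (k + 1) v) ->
    forall k, D (Y mu k (c n v)) - Y mu k (D (c n v)) =
      (k + 1)%:~R *: Y mu (k + 1) (c n v).
Proof.
move=> lc Dc cY n v IH k.
have lY := vertex_linear mu; have lD := translation_linear.
have Yc k' w : Y mu k' (c n w) = c n (Y mu k' w) - mu%:~R *: Y mu (k' - n) w.
  by have := cY n k' w => /eqP; rewrite subr_eq => /eqP->; module_ring K.
have Dc' m w : D (c m w) = c m (D w) - m%:~R *: c (m - 1) w.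
  by have := Dc m w => /eqP; rewrite subr_eq => /eqP->; module_ring K.
have Yc1 : Y mu k (c (n - 1) v) =
    c (n - 1) (Y mu k v) - mu%:~R *: Y mu (k - n + 1) v.
  have := cY (n - 1) k v => /eqP; rewrite subr_eq => /eqP->.
  by rewrite (_ : k - (n - 1) = k - n + 1); [module_ring K|lia].
have IH1 : D (Y mu k v) = Y mu k (D v) + (k + 1)%:~R *: Y mu (k + 1) v.
  by have := IH k => /eqP; rewrite subr_eq => /eqP->; module_ring K.
have IH2 : D (Y mu (k - n) v) =
    Y mu (k - n) (D v) + (k - n + 1)%:~R *: Y mu (k - n + 1) v.
  by have := IH (k - n) => /eqP; rewrite subr_eq => /eqP->; module_ring K.
rewrite !Yc (linB lD) (linZ lD) Dc' IH1 IH2 (linD (lc n)) (linZ (lc n)).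
rewrite Dc' (linB (lY _)) (linZ (lY _) n%:~R) Yc Yc1.
rewrite (_ : k + 1 - n = k - n + 1); last by lia.
by rewrite !intrD !rmorphN /=; module_ring K.
Qed.

(** The defect [D, Y(z)] - Y'(z) has the same commutators with the currents as Y, so
    it is enough to evaluate it on [one l]. There the failure of covariance of the
    creation part cancels against the difference of the values of D on [one l]
    and on [one (l + mu)]. *)
Lemma vertex_translation mu k v :
  D (Y mu k v) - Y mu k (D v) = (k + 1)%:~R *: Y mu (k + 1) v.
Proof.
have [lY lD] := (vertex_linear mu, translation_linear).
move: v k; apply: ind => [c u v Hu Hv k|l k|n v _ IH k|n v _ IH k].
- rewrite (lY k c u v) (lD c u v) (lY (k + 1) c u v).
  rewrite (lD c (Y mu k u) (Y mu k v)) (lY k c (D u) (D v)).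
  have := Hu k => /eqP; rewrite subr_eq => /eqP->.
  have := Hv k => /eqP; rewrite subr_eq => /eqP->.
  by module_ring K.
- rewrite !vertex_one translation_one -/(diff_ab (one l)) (linZ (lY _)).
  rewrite vertex_current_diff vertex_one.
  have := vertex_creation_der mu k (one (l + mu)) => /eqP.
  rewrite subr_eq => /eqP->.
  rewrite translation_one -/(diff_ab _) (linZ (vertex_creation_linear mu k)).
  rewrite vertex_creation_current_diff -/(diff_ab _) intrD.
  by module_eq K; field.
- exact: (vertex_translation_step la a_covariant (vertex_a mu) n IH).
- exact: (vertex_translation_step lb b_covariant (vertex_b mu) n IH).
Qed.

(** [vertex_creation_der] computes each coefficient of the creation part from the
    previous one by D and the lowest mode of a - abar. The latter commutes with Y,
    and the commutator with D is the derivative of Y, to which the induction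
    hypothesis applies. *)
Lemma vertex_vertex_creation mu nu k l v :
  Y mu k (Q nu l v) = Q nu l (Y mu k v).
Proof.
case: l => [l|l]; last first.
  by rewrite !vertex_creation_neg// (lin0 (vertex_linear mu k)).
elim: l k v => [|l IH] k v; first by rewrite !vertex_creation0.
have lY := vertex_linear mu; have lQ := vertex_creation_linear nu.
have l1 : (l%:Z + 1)%:~R != 0 :> K by rewrite intr_eq0; lia.
have QS w : (l%:Z + 1)%:~R *: Q nu l.+1%:Z w = D (Q nu l%:Z w) - Q nu l%:Z (D w)
    + (nu%:~R / (2 * kappa)) *: diff_ab (Q nu l%:Z w).
  rewrite vertex_creation_der -/(diff_ab _) (_ : l.+1%:Z = l%:Z + 1); last by lia.
  by module_ring K.
apply: (scalerI l1); rewrite -(linZ (lY k)) (QS v) (QS (Y mu k v)).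
rewrite (linD (lY k)) (linB (lY k)) (linZ (lY k)) vertex_current_diff !IH.
have DY k' w : Y mu k' (D w) = D (Y mu k' w) - (k' + 1)%:~R *: Y mu (k' + 1) w.
  by have /eqP := vertex_translation mu k' w; rewrite subr_eq => /eqP->;
    module_ring K.
rewrite !DY !IH (linB (lQ _)) (linZ (lQ _)).
by module_ring K.
Qed.

Lemma vertex_creationC mu nu k l v : Q mu k (Q nu l v) = Q nu l (Q mu k v).
Proof.
apply: vertex_creation_commute => [|n w n0|n w n0].
- exact: vertex_creation_linear.
- symmetry; apply: (vertex_creation_commute _ (la n)) => m x m0; last exact: ab.
  have := ha n m x; rewrite (_ : (n + m == 0) = false); last by lia.
  by rewrite scale0r => /eqP; rewrite subr_eq0 => /eqP.
- symmetry; apply: (vertex_creation_commute _ (lb n)) => m x m0; first by rewrite ab.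
  have := hb n m x; rewrite (_ : (n + m == 0) = false); last by lia.
  by rewrite scale0r => /eqP; rewrite subr_eq0 => /eqP.
Qed.

Let vertexC_step (c : int -> V -> V) mu nu : (forall n, linear (c n)) ->
  (forall rho n k v,
     c n (Y rho k v) - Y rho k (c n v) = rho%:~R *: Y rho (k - n) v) ->
  forall n v, (forall k l, Y mu k (Y nu l v) = Y nu l (Y mu k v)) ->
  forall k l, Y mu k (Y nu l (c n v)) = Y nu l (Y mu k (c n v)).
Proof.
move=> lc cY n v IH k l; have lY := vertex_linear.
have Yc rho k' w :
    Y rho k' (c n w) = c n (Y rho k' w) - rho%:~R *: Y rho (k' - n) w.
  by have := cY rho n k' w => /eqP; rewrite subr_eq => /eqP->; module_ring K.
rewrite !Yc !(linB (lY _ _)) !(linZ (lY _ _)) !Yc !IH.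
by module_ring K.
Qed.

(** The commutators with the currents reduce this to the vectors [one j], where the
    two vertex operators become commuting creation parts. *)
Lemma vertexC mu nu k l v : Y mu k (Y nu l v) = Y nu l (Y mu k v).
Proof.
have lY := vertex_linear.
move: v k l; apply: ind => [c u v Hu Hv k l|j k l|n v _ IH k l|n v _ IH k l].
- by rewrite !(linD (lY _ _)) !(linZ (lY _ _)) Hu Hv.
- rewrite !vertex_one !vertex_vertex_creation !vertex_one vertex_creationC.
  by rewrite addrAC.
- exact: (vertexC_step la vertex_a n IH).
- exact: (vertexC_step lb vertex_b n IH).
Qed.

Let y mu : int -> V -> V := va_mode (Y mu).

Let fy mu : mode_field (y mu).
Proof.
apply: is_field_mode_field; split; first exact: vertex_linear.
exact: vertex_bounded.
Qed.

Let y_covariant mu : covariant D (y mu).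
Proof.
move=> n v; rewrite /y /va_mode vertex_translation -scaleNr -mulrNz.
rewrite (_ : - (n - 1) - 1 = - n - 1 + 1); last by lia.
by congr (_%:~R *: _); lia.
Qed.

Let a_y mu m n v : a m (y mu n v) - y mu n (a m v) = mu%:~R *: y mu (m + n) v.
Proof.
by rewrite /y /va_mode vertex_a (_ : - n - 1 - m = - (m + n) - 1)//; lia.
Qed.

Let b_y mu m n v : b m (y mu n v) - y mu n (b m v) = mu%:~R *: y mu (m + n) v.
Proof.
by rewrite /y /va_mode vertex_b (_ : - n - 1 - m = - (m + n) - 1)//; lia.
Qed.

Let local_commuting (A B : int -> V -> V) :
  (forall m n v, A m (B n v) = B n (A m v)) -> local A B.
Proof.
move=> AB; exists 0%N => v; apply/funext => -[m n].
by rewrite /= /commutator_at /commutator AB subrr.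
Qed.

(* [c(z), c(w)] has a pole of order two: its modes are linear in m, and (z - w)^2
   takes their second difference. *)
Let local_heisenberg x (c : int -> V -> V) : heisenberg_bracket x c -> local c c.
Proof.
move=> hc; exists 2%N => v; apply/funext => -[m n].
rewrite iter_diff_binomial !big_ord_recl big_ord0 /commutator_at /commutator /=.
rewrite !hc /bump /=.
have -> : (m + 2 - 0%N%:Z + (n + 0%N%:Z) == 0) = (m + n + 2 == 0) by lia.
have -> : (m + 2 - (1 + 0)%N%:Z + (n + (1 + 0)%N%:Z) == 0) = (m + n + 2 == 0).
  by lia.
have -> : (m + 2 - (1 + (1 + 0))%N%:Z + (n + (1 + (1 + 0))%N%:Z) == 0) =
  (m + n + 2 == 0) by lia.
case: eqP => _; last by rewrite !scale0r !scaler0 !addr0.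
rewrite !intrD !rmorphN /= (_ : 'C(2, 0) = 1%N)// (_ : 'C(2, (1 + 0)%N) = 2%N)//.
rewrite (_ : 'C(2, (1 + (1 + 0))%N) = 1%N)//; module_eq K.
by rewrite -!pmulrn /=; ring.
Qed.

Let local_current_vertex (c : int -> V -> V) mu :
  (forall m n v, c m (y mu n v) - y mu n (c m v) = mu%:~R *: y mu (m + n) v) ->
  local c (y mu).
Proof.
move=> cy; exists 1%N => v; apply/funext => -[m n] /=.
rewrite /diff /commutator_at /commutator /= !cy.
by rewrite (_ : m + (n + 1) = m + 1 + n) ?subrr//; lia.
Qed.

Definition generator (A : int -> V -> V) : Prop :=
  [\/ A = a, A = b | exists mu, A = va_mode (vertex mu)].

Let G_field A : generator A -> mode_field A.
Proof. by case=> [->|->|[mu ->]] //; exact: fy. Qed.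

Let G_covariant A : generator A -> covariant D A.
Proof.
case=> [->|->|[mu ->]]; [exact: a_covariant|exact: b_covariant|].
exact: y_covariant.
Qed.

Let G_local A B : generator A -> generator B -> local A B.
Proof.
case=> [->|->|[mu ->]]; case=> [->|->|[nu ->]].
- exact: local_heisenberg ha.
- exact: local_commuting ab.
- exact/local_current_vertex/a_y.
- exact/local_sym/local_commuting/ab.
- exact: local_heisenberg hb.
- exact/local_current_vertex/b_y.
- exact/local_sym/local_current_vertex/a_y.
- exact/local_sym/local_current_vertex/b_y.
- by apply: local_commuting => m n v; exact: vertexC.
Qed.

Let vac := one 0.

Let y_vac mu : y mu (-1) vac = one mu.
Proof.
rewrite /y /va_mode (_ : - -1 - 1 = 0)// vertex_one vertex_creation0.
by rewrite add0r.
Qed.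

Let G_generates (W : V -> Prop) :
  (forall c u v, W u -> W v -> W (c *: u + v)) -> W vac ->
  (forall A n v, generator A -> W v -> W (A n v)) -> forall v, W v.
Proof.
move=> Wl W1 WG; apply: ind => // [l|n v _ Wv|n v _ Wv].
- by rewrite -y_vac; apply: WG => //; apply: Or33; exists l.
- by apply: WG => //; exact: Or31.
- by apply: WG => //; exact: Or32.
Qed.

Let D_vac : D vac = 0.
Proof. by rewrite /vac translation_one mul0r scale0r. Qed.

Let lD := translation_linear.

Definition fock_va : vertex_algebra V := reconstruction lD D_vac
  G_field G_covariant G_local G_generates.

Let T := stress kappa a (y (-2)).
Let T' := stress (- kappa) b (y (-2)).

Let sys : stress_system kappa a b (y (-2)) vac.
Proof.
have N2 : (-2)%:~R = -2 :> K by rewrite rmorphN.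
split=> //.
- by move=> m n v; exact: vertexC.
- by move=> n n0; rewrite a_one//; case: eqP; rewrite ?scale0r.
- by move=> n n0; rewrite b_one//; case: eqP; rewrite ?scale0r.
- move=> n n0; rewrite /y /va_mode vertex_one vertex_creation_neg//; lia.
- have := y_covariant (-2) (-1) vac.
  rewrite D_vac (lin0 ((fy (-2)).1 (-1))) subr0 y_vac translation_one N2.
  rewrite (_ : (-1)%:~R = -1 :> K)// scaleN1r opprK => <-.
  by rewrite invfM mulNr mulVKf ?pnatr_eq0// mulN1r.
Qed.

Let adG A : generator A -> admissible D generator A :=
  admissible_gen G_field G_covariant G_local (A := A).

Let stress_admissible (x : K) c mu : generator c ->
  admissible D generator (stress x c (y mu)).
Proof.
move=> Gc; have Gy : generator (y mu) by apply: Or33; exists mu.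
have adN := admissible_nprod lD D_vac G_field G_covariant G_local G_generates
  (-1) (adG Gc) (adG Gc).
have adD := admissible_deriv lD D_vac G_field G_covariant G_local G_generates
  (adG Gc).
have ad1 := admissible_lin lD G_field (4 * x)^-1 adN
  (admissible_lin lD G_field ((x - 1) / (2 * x)) adD
    (admissible_scale lD G_field (- x^-1) (adG Gy))).
have -> : stress x c (y mu) = fun n v => (4 * x)^-1 *: nprod c c (-1) n v +
    (((x - 1) / (2 * x)) *: (- (n%:~R *: c (n - 1) v)) + (- x^-1) *: y mu n v).
  by apply/funext => n; apply/funext => v; rewrite /stress; module_ring K.
exact: ad1.
Qed.

Let adT : admissible D generator T.
Proof. by apply: stress_admissible; exact: Or31. Qed.
Let adT' : admissible D generator T'.
Proof. by apply: stress_admissible; exact: Or32. Qed.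

Let DT v : T 0 v + T' 0 v = D v.
Proof.
rewrite /T /T' /stress DE !scale0r; module_eq K; field; exact: kappa0.
Qed.

Let u := T (-1) vac.
Let u' := T' (-1) vac.
Let sys' := stress_system_sym sys.

Let T'u n : 0 <= n -> T' n u = 0.
Proof. exact: (stress_other_state sys). Qed.

Let Tu' n : 0 <= n -> T n u' = 0.
Proof. by move=> n0; have := stress_other_state sys' n0; rewrite opprK. Qed.

(** The product u_(0)u is Du because Lbar_(0) kills u and D = L_(0) + Lbar_(0). *)
Lemma fock_virasoro : virasoro_action (charge kappa) (va_mode T).
Proof.
apply: (virasoro_of_ope lD D_vac G_field G_covariant G_local G_generates adT).
- by rewrite -DT T'u// addr0.
- exact: (stress_ope1 sys).
- exact: (stress_ope2 sys).
- exact: (stress_ope3 sys).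
- exact: (stress_ope_ge4 sys).
Qed.

Lemma fock_virasoro_bar : virasoro_action (charge (- kappa)) (va_mode T').
Proof.
apply: (virasoro_of_ope lD D_vac G_field G_covariant G_local G_generates adT').
- by rewrite -DT Tu'// add0r.
- exact: (stress_ope1 sys').
- exact: (stress_ope2 sys').
- exact: (stress_ope3 sys').
- exact: (stress_ope_ge4 sys').
Qed.

Lemma fock_commuting : commuting_actions (va_mode T) (va_mode T').
Proof.
exact: (commuting_of_ope lD D_vac G_field G_covariant G_local G_generates adT adT').
Qed.

Let Yu : va_Y fock_va u = va_mode T.
Proof. exact: reconstructionE. Qed.
Let Yu' : va_Y fock_va u' = va_mode T'.
Proof. exact: reconstructionE. Qed.

Lemma fock_voa : is_voa_of_rank fock_va (charge kappa + charge (- kappa)).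
Proof.
have YE : va_Y fock_va (u + u') = va_mode T + va_mode T'.
  by rewrite (linD (va_Y_linear fock_va)) Yu Yu'.
exists (u + u'); rewrite YE; split; last first.
  by apply/funext => v; exact: DT.
exact: virasoro_action_sum fock_virasoro fock_virasoro_bar fock_commuting.
Qed.

Lemma fock_compatible : compatible fock_va (va_mode T) (va_mode T').
Proof.
split.
- by rewrite -Yu; exact: reconstruction_jacobi.
- by rewrite -Yu'; exact: reconstruction_jacobi.
- by move=> v; rewrite -[X in va_Y _ X]/(T 0 v + T' 0 v) DT; exact: reconstruction_D.
- by split; [exists u|exists u'].
Qed.

End FreeFields.

(** * The free field realization *)

Section NormalOrder.
Context {K : numFieldType} {V : lmodType K}.

Lemma fsum_int_nonneg (F : int -> V) : finsum_ok F ->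
  (forall i, i < 0 -> F i = 0) ->
  \sum_(i \in [set: int]) F i = \sum_(i \in [set: nat]) F i%:Z.
Proof.
move=> [r Fr] F0; have okN : finsum_ok (fun i : nat => F i%:Z).
  exists (map absz r) => i ir; apply: Fr; apply: contra ir => ir.
  by apply/mapP; exists i%:Z.
have [N FN] := finsum_ok_nat_inv okN.
rewrite (@fsum_seq _ _ _ (map Posz (iota 0 N))).
- rewrite big_map; symmetry; apply: fsum_seq; first exact: iota_uniq.
  by move=> i; rewrite mem_iota add0n /= -leqNgt; exact: FN.
- by rewrite map_inj_uniq ?iota_uniq// => i j [].
- move=> [i|i] iN; last exact: F0.
  apply: FN; rewrite leqNgt; apply: contra iN => iN.
  by apply: map_f; rewrite mem_iota.
Qed.

(** The regular and the principal part of the left factor give the two sums over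
    nonnegative integers of the product with index -1. *)
Lemma normal_orderE (c : int -> V -> V) : mode_field c ->
  normal_order (va_mode c) (va_mode c) = va_mode (nprod c c (-1)).
Proof.
move=> fc; have lc := fc.1; apply/funext => k; apply/funext => v.
rewrite -[RHS]/(nprod c c (-1) (- k - 1) v) nprodN1//; set n := - k - 1.
have ok1 := antidiagonal_field v fc fc (-1) n.
have ok2 : finsum_ok (fun i : nat => c (n - 1 - i%:Z) (c i%:Z v)).
  apply: finsum_ok_ext (antidiagonal_field v fc fc (n - 1) 0) => i.
  by rewrite add0r.
rewrite (fsumD ok1 ok2) /normal_order.
have bc := (mode_field_is_field fc).2.
rewrite -[LHS]/(fprod _ _ k v + fprod _ _ k v) /fprod; congr (_ + _).
  rewrite fsum_int_nonneg; last 2 first.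
  - have [N cN] := bc v.
    apply: (finsum_ok_int (M := 0) (N := k - N)) => i ik.
      by rewrite /regular_part leNgt ik.
    rewrite cN; last by lia.
    by rewrite /regular_part; case: ifP => // _; exact: (lin0 (lc _)).
  - by move=> i i0; rewrite /regular_part leNgt i0.
  apply: eq_fsum => i; rewrite /regular_part /va_mode /n lez_nat /=.
  by congr (c _ (c _ v)); lia.
pose F i := va_mode c (k + 1 + i) (principal_part (va_mode c) (- 1 - i) v).
transitivity (\sum_(i \in [set: int]) F i).
  rewrite (fsum_shift (k + 1)); apply: eq_fsum => i; rewrite /F.
  rewrite (_ : i + (k + 1) = k + 1 + i); last by lia.
  by rewrite (_ : k - (k + 1 + i) = - 1 - i); last by lia.
rewrite fsum_int_nonneg; last 2 first.
- have [N cN] := bc v.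
  apply: (finsum_ok_int (M := 0) (N := - 1 - N)) => i ik.
    rewrite /F /principal_part (_ : (- 1 - i < 0) = false); last by lia.
    exact: (lin0 (lc _)).
  rewrite /F /principal_part cN; last by lia.
  by rewrite if_same; exact: (lin0 (lc _)).
- move=> i i0; rewrite /F /principal_part (_ : (- 1 - i < 0) = false); last by lia.
  exact: (lin0 (lc _)).
apply: eq_fsum => i; rewrite /F /principal_part (_ : (- 1 - i%:Z < 0) = true).
  by rewrite /va_mode /n; congr (c _ (c _ v)); lia.
by lia.
Qed.

Lemma stress_fieldE (k : K) (c y : int -> V -> V) : mode_field c ->
  (4 * k)^-1 *: normal_order (va_mode c) (va_mode c)
    + ((k - 1) / (2 * k)) *: fderiv (va_mode c) - k^-1 *: y =
  va_mode (stress k c (va_mode y)).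
Proof.
move=> fc; rewrite normal_orderE//; apply/funext => p; apply/funext => v.
rewrite -[LHS]/((4 * k)^-1 *: va_mode (nprod c c (-1)) p v
  + ((k - 1) / (2 * k)) *: fderiv (va_mode c) p v - k^-1 *: y p v).
rewrite /fderiv /va_mode /stress.
rewrite (_ : - (p + 1) - 1 = - p - 1 - 1); last by lia.
rewrite (_ : - (- p - 1) - 1 = p); last by lia.
rewrite (_ : (p + 1)%:~R = - (- p - 1)%:~R :> K); last first.
  by rewrite -mulrNz; congr (_%:~R); lia.
by rewrite scaleNr.
Qed.

Lemma stress_field_barE (k : K) (c y : int -> V -> V) :
  k != 0 -> mode_field c ->
  - ((4 * k)^-1 *: normal_order (va_mode c) (va_mode c))
    + ((k + 1) / (2 * k)) *: fderiv (va_mode c) + k^-1 *: y =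
  va_mode (stress (- k) c (va_mode y)).
Proof.
move=> k0 fc; rewrite -stress_fieldE//; apply/funext => p; apply/funext => v.
rewrite -[LHS]/(- ((4 * k)^-1 *: normal_order (va_mode c) (va_mode c) p v)
  + ((k + 1) / (2 * k)) *: fderiv (va_mode c) p v + k^-1 *: y p v).
rewrite -[RHS]/((4 * - k)^-1 *: normal_order (va_mode c) (va_mode c) p v
  + ((- k - 1) / (2 * - k)) *: fderiv (va_mode c) p v - (- k)^-1 *: y p v).
by module_eq K; field.
Qed.

End NormalOrder.

Section FreeFieldRealization.
Context {K : numFieldType}.
Variable kappa : K.
Hypothesis kappa0 : kappa != 0.
Local Notation F := (Ftilde K).

Let a : int -> F -> F := a_mode kappa.
Let b : int -> F -> F := abar_mode kappa.
Let sh : int -> F -> F := @shift K.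
Let Y : int -> F -> F := vertex kappa a b sh (-2).
Let D : F -> F := fun v =>
  (4 * kappa)^-1 *: (nprod a a (-1) 0 v - nprod b b (-1) 0 v).
Let DE v : D v = (4 * kappa)^-1 *: (nprod a a (-1) 0 v - nprod b b (-1) 0 v)
  := erefl.

Lemma L_fieldE : L_field kappa = va_mode (stress kappa a (va_mode Y)).
Proof. exact: (stress_fieldE kappa Y (a_mode_field kappa)). Qed.

Lemma Lbar_fieldE : Lbar_field kappa = va_mode (stress (- kappa) b (va_mode Y)).
Proof. exact: (stress_field_barE Y kappa0 (abar_mode_field kappa)). Qed.

Let fa := a_mode_field (K := K) kappa.
Let fb := abar_mode_field (K := K) kappa.
Let ha := a_mode_heisenberg (K := K) kappa.
Let hb := abar_mode_heisenberg (K := K) kappa.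
Let ab := a_abar_commute (K := K) kappa.
Let lsh := shift_linear (K := K).
Let a1 := a_mode_one (K := K) kappa.
Let b1 := abar_mode_one (K := K) kappa.
Let sh1 := shift_one (K := K).
Let ash := a_mode_shift (K := K) kappa.
Let bsh := abar_mode_shift (K := K) kappa.
Let ind := fock_ind (K := K) (kappa := kappa).

Lemma free_field_realization :
  [/\ virasoro_action (charge kappa) (L_field kappa),
      virasoro_action (charge (- kappa)) (Lbar_field kappa)
    & commuting_actions (L_field kappa) (Lbar_field kappa)] /\
  exists S : vertex_algebra F,
    is_voa_of_rank S (charge kappa + charge (- kappa)) /\
    compatible S (L_field kappa) (Lbar_field kappa).
Proof.
rewrite L_fieldE Lbar_fieldE; split; first split.
- exact: (fock_virasoro kappa0 fa fb ha hb ab lsh a1 b1 sh1 ash bsh ind DE).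
- exact: (fock_virasoro_bar kappa0 fa fb ha hb ab lsh a1 b1 sh1 ash bsh ind DE).
- exact: (fock_commuting kappa0 fa fb ha hb ab lsh a1 b1 sh1 ash bsh ind DE).
exists (fock_va kappa0 fa fb ha hb ab lsh a1 b1 sh1 ash bsh ind DE); split.
- exact: fock_voa.
- exact: fock_compatible.
Qed.

End FreeFieldRealization.

Theorem theorem3p3 (R : realType) (kappa : R[i]) (hkappa : kappa != 0) :
  let c : R[i] := 13 - 6 * kappa - 6 / kappa in
  let cbar : R[i] := 13 + 6 * kappa + 6 / kappa in
  [/\ virasoro_action c (L_field kappa),
      virasoro_action cbar (Lbar_field kappa)
    & commuting_actions (L_field kappa) (Lbar_field kappa)] /\
  exists S : vertex_algebra (Ftilde R[i]),
    is_voa_of_rank S 26 /\ compatible S (L_field kappa) (Lbar_field kappa).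
Proof.
move=> c cbar; have := free_field_realization hkappa.
have -> : charge kappa = c by [].
have -> : charge (- kappa) = cbar.
  by rewrite /charge /cbar invrN !mulrN !opprK.
by have -> : c + cbar = 26 by rewrite /c /cbar; field.
Qed.
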